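(* Let $n\in\mathbb{N}$ and let $f$ be a measurable, nonnegative function on $(0,\infty)$. For $m=1$ and $m=n$, suppose that $\mu_m^f$ is a generalized Poincaré limit with function $\rho_m$, that is, $\mu_m^f=\nu_m^{\rho_m}$ where $\rho_m$ satisfies (C), and suppose that $\rho_m$ satisfies (C$_m$). Then for any $a\in[0,1]$ with $a\neq1/2$, \[ I[\mu_n^f](a)\ \geq\ \frac{1}{L_n}\,I[\gamma_1](a), \] where $L_n$ is the smallest Lipschitz constant of $s_n^{\rho_n}$. Moreover, if $\limsup_{r\downarrow0}f(r)\in(0,\infty)$, then the inequality $I[\mu_n^f](a)\geq\frac{1}{L_n}I[\gamma_1](a)$ also holds for $a=1/2$.
   Context: $|\cdot|$ is the Euclidean norm; all subsets of $\mathbb{R}^n$ are Borel. For a Borel probability measure $\mu$ on $\mathbb{R}^n$ and $A\subset\mathbb{R}^n$, $\mu^+[A]:=\liminf_{\varepsilon\downarrow0}(\mu[A^\varepsilon]-\mu[A])/\varepsilon$, where $A^\varepsilon:=\{x\in\mathbb{R}^n: \inf_{a\in A}|x-a|<\varepsilon\}$; the isoperimetric profile of $\mu$ is $I[\mu](a):=\inf\{\mu^+[A] : A\subset\mathbb{R}^n,\ \mu[A]=a\}$ for $a\in[0,1]$. $\gamma_1$ is the standard Gaussian measure on $\mathbb{R}$, with density $(2\pi)^{-1/2}e^{-r^2/2}$. Radial probability measure: let $A_n$ be the surface measure of the unit sphere in $\mathbb{R}^n$ (so $A_1=2$). For a measurable nonnegative $f$ on $(0,\infty)$ with $0<M_n^f:=A_n\int_0^\infty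 f(r)r^{n-1}dr<\infty$, $\mu_n^f$ is the probability measure on $\mathbb{R}^n$ with Lebesgue density $f(|x|)/M_n^f$. For a function $\rho$ on $(0,\infty)$, $s_n^\rho:\mathbb{R}^n\to\mathbb{R}^n$ is $s_n^\rho(x)=\rho(|x|)x$ for $x\neq0$, $s_n^\rho(0)=0$. Condition (C): $\rho$ is a $C^1$, positive function on $(0,\infty)$ and $s_1^\rho$ is strictly increasing. Condition (C$_n$): the map $s_n^\rho$ is Lipschitz continuous. For $\rho$ satisfying (C), with $\sigma$ the inverse function of $s_1^\rho$, $\nu_n^\rho$ is the probability measure on $\mathbb{R}^n$ with Lebesgue density equal to $(2\pi)^{-n/2}\exp(-\sigma(|x|)^2/2)\{\sigma(|x|)/|x|\}^{n-1}\sigma'(|x|)$ for $x\in s_n^\rho(\mathbb{R}^n\setminus\{0\})$ and $0$ otherwise. $\mu_n^f$ is called a generalized Poincaré limit if there exists $\rho$ satisfying (C) with $\mu_n^f=\nu_n^\rho$. *)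

(* Defs.v *)
From HB Require Import structures.
From mathcomp Require Import all_boot all_order all_algebra.
From mathcomp Require Import all_classical all_reals all_analysis.
Set Implicit Arguments.
Unset Strict Implicit.
Unset Printing Implicit Defensive.
Import Order.TTheory GRing.Theory Num.Theory.
Import numFieldNormedType.Exports.
Local Open Scope classical_set_scope.
Local Open Scope ring_scope.

(* R^n is [n.-tuple R] with the sigma-algebra generated by the coordinates,
   which is the Borel sigma-algebra of R^n.  The norm is Euclidean, not the
   sup norm of ['rV[R]_n]. *)
Section euclidean.
Context {R : realType} {n : nat}.
Implicit Types (x y : n.-tuple R) (g : n.-tuple R -> n.-tuple R).

Definition eucl_norm x : R := Num.sqrt (\sum_(i < n) tnth x i ^+ 2).

Definition eucl_dist x y : R := Num.sqrt (\sum_(i < n) (tnth x i - tnth y i) ^+ 2).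

Definition lipschitz_bound g (k : R) : Prop :=
  0 <= k /\ forall x y, eucl_dist (g x) (g y) <= k * eucl_dist x y.

Definition lipschitz_cont g : Prop := exists k, lipschitz_bound g k.

Definition lipschitz_constant g : R := inf [set k | lipschitz_bound g k].

Lemma lipschitz_constantP g :
  lipschitz_cont g -> lipschitz_bound g (lipschitz_constant g).
Proof.
move=> gL; have hi : has_inf [set k | lipschitz_bound g k].
  by split=> //; exists 0 => k [].
split; first by apply: lb_le_inf => [|k []]; case: hi.
move=> x y; have : 0 <= eucl_dist x y by exact: sqrtr_ge0.
rewrite le_eqVlt => /predU1P[xy0|xy0].
  by case: gL => k [_ /(_ x y)]; rewrite -xy0 !mulr0.
rewrite -ler_pdivrMr//; apply: lb_le_inf => [|k [_ gk]]; first by case: hi.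
by rewrite ler_pdivrMr.
Qed.

End euclidean.

Section lebesgue_tuple.
Context {R : realType}.

Definition tuple_of_pair {n : nat}
    (p : measurableTypeR R * n.-tuple R) : n.+1.-tuple R :=
  [tuple of (p.1 : R) :: p.2].

Lemma measurable_tuple_of_pair n : measurable_fun setT (@tuple_of_pair n).
Proof.
apply: (measurable_cons (f := fun p : measurableTypeR R * n.-tuple R => p.1 : R)).
  exact: measurable_fst.
exact: measurable_snd.
Qed.

(* n-dimensional Lebesgue measure, as the n-fold product of the Lebesgue
   measure on the line *)
Fixpoint lebesgue_tuple (n : nat) : set (n.-tuple R) -> \bar R :=
  match n with
  | 0 => dirac [tuple]
  | m.+1 => pushforward (product_measure1 lebesgue_measure (@lebesgue_tuple m))
              tuple_of_pair
  end.
Arguments lebesgue_tuple n : clear implicits.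

Let sigma_finite_pushforward n (mu : {sigma_finite_measure set (n.-tuple R) -> \bar R}) :
  exists nu : {sigma_finite_measure set (n.+1.-tuple R) -> \bar R},
    pushforward (product_measure1 lebesgue_measure mu) tuple_of_pair = nu.
Proof.
pose p := [the {measure set _ -> \bar R} of product_measure1 (@lebesgue_measure R) mu].
pose q : {measure set (n.+1.-tuple R) -> \bar R} :=
  measure_function_pushforward__canonical__measure_function_Measure
    p (@measurable_tuple_of_pair n).
pose untuple (t : n.+1.-tuple R) : measurableTypeR R * n.-tuple R :=
  (thead t, [tuple of behead t]).
have untupleK : cancel (@tuple_of_pair n) untuple.
  by move=> [x t]; rewrite /untuple /tuple_of_pair theadE; congr pair; exact: val_inj.
have tupleK : cancel untuple (@tuple_of_pair n).
  by move=> t; rewrite /tuple_of_pair /= [RHS]tuple_eta.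
have mu' A : measurable A -> measurable (untuple @^-1` A).
  move=> mA; rewrite -[X in measurable X]setTI.
  have mu'' : measurable_fun setT untuple.
    apply: measurable_fun_pair; last exact: measurable_behead.
    exact: measurable_tnth.
  exact: mu''.
have qF : sigma_finite setT q.
  have [F TF Foo] : sigma_finite setT p.
    have /sigma_finiteP[F [TF ndF Foo]] := sigma_finiteT (@lebesgue_measure R).
    have /sigma_finiteP[G [TG ndG Goo]] := sigma_finiteT mu.
    exists (fun k => F k `*` G k).
      rewrite -setXTT TF TG; apply/seteqP; split=> [[x y] [/= [i _ Fx] [j _ Gy]]|].
        exists (maxn i j) => //; split.
        - by move: x Fx; exact/subsetPset/ndF/leq_maxl.
        - by move: y Gy; exact/subsetPset/ndG/leq_maxr.
      by move=> [x y] [i _ [/= ? ?]]; split; exists i.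
    move=> k; have [? ?] := Foo k; have [? ?] := Goo k.
    split; first exact: measurableX.
    by rewrite /p /= product_measure1E// lte_mul_pinfty// ge0_fin_numE.
  exists (fun i => untuple @^-1` F i) => [|i].
    by rewrite -preimage_bigcup -TF preimage_setT.
  have [mF Fi] := Foo i; split; first exact: mu'.
  rewrite /q /= /pushforward -comp_preimage.
  by rewrite (_ : _ \o _ = id)//; apply/funext => x /=; rewrite untupleK.
pose H := Measure_isSigmaFinite.Build _ _ _ q qF.
by exists (HB.pack_for {sigma_finite_measure set (n.+1.-tuple R) -> \bar R}
  (Measure.sort q) H).
Qed.

Lemma lebesgue_tuple_sigma_finite_measure n :
  exists mu : {sigma_finite_measure set (n.-tuple R) -> \bar R},
    lebesgue_tuple n = mu.
Proof.
elim: n => [|n [mu muE]]; first by exists (dirac [tuple]).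
by rewrite /= muE; exact: sigma_finite_pushforward.
Qed.

Let lebesgue_tuple0 n : lebesgue_tuple n set0 = 0%E.
Proof. by have [mu ->] := lebesgue_tuple_sigma_finite_measure n. Qed.

Let lebesgue_tuple_ge0 n A : (0 <= lebesgue_tuple n A)%E.
Proof. by have [mu ->] := lebesgue_tuple_sigma_finite_measure n. Qed.

Let lebesgue_tuple_sigma_additive n : semi_sigma_additive (lebesgue_tuple n).
Proof.
have [mu ->] := lebesgue_tuple_sigma_finite_measure n.
exact: measure_semi_sigma_additive.
Qed.

HB.instance Definition _ n := isMeasure.Build _ _ _ (lebesgue_tuple n)
  (@lebesgue_tuple0 n) (@lebesgue_tuple_ge0 n) (@lebesgue_tuple_sigma_additive n).

Let lebesgue_tuple_sigma_finite n : sigma_finite setT (lebesgue_tuple n).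
Proof.
have [mu ->] := lebesgue_tuple_sigma_finite_measure n.
exact: sigma_finiteT.
Qed.

HB.instance Definition _ n := Measure_isSigmaFinite.Build _ _ _
  (lebesgue_tuple n) (@lebesgue_tuple_sigma_finite n).

End lebesgue_tuple.
Arguments lebesgue_tuple {R} n A.

Section isoperimetric_profile.
Context {d : measure_display} {T : measurableType d} {R : realType}.
Variables (dist : T -> T -> R) (mu : set T -> \bar R).

(* The infimum is taken in [\bar R], so that it is +oo, and the enlargement is
   empty, when [A] is empty. *)
Definition enlargement (A : set T) (e : R) : set T :=
  [set x | (ereal_inf [set (dist x a)%:E | a in A] < e%:E)%E].

Definition boundary_measure (A : set T) : \bar R :=
  limf_einf (fun e : R => (mu (enlargement A e) - mu A) * (e^-1)%:E)%E 0^'+.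

Definition isoperimetric_profile (a : R) : \bar R :=
  ereal_inf [set boundary_measure A | A in
    [set A | measurable A /\ mu A = a%:E]].

End isoperimetric_profile.

Section radial.
Context {R : realType}.
Implicit Types (n : nat) (f rho : R -> R).

(* The surface measure of the unit sphere, obtained from the Lebesgue measure
   of cones as in integration in polar coordinates; for n = 1 it is the
   counting measure on {-1, 1}. *)
Definition sphere_measure n (E : set (n.-tuple R)) : \bar R :=
  let cone : set (n.-tuple R) :=
    [set x | 0 < eucl_norm x <= 1 /\ E [tuple tnth x i / eucl_norm x | i < n]] in
  (n%:R%:E * lebesgue_tuple n cone)%E.

Definition sphere_area n : \bar R :=
  sphere_measure [set x : n.-tuple R | eucl_norm x = 1].

(* Functions on (0,+oo) are represented by total functions on [R], of which
   only the values at positive arguments matter. *)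
Definition radial_mass n f : \bar R :=
  (sphere_area n *
   \int[lebesgue_measure]_(r in `]0%R, +oo[) (f r * r ^+ n.-1)%:E)%E.

Definition radial_measure n f (A : set (n.-tuple R)) : \bar R :=
  (\int[lebesgue_tuple n]_(x in A) (f (eucl_norm x) / fine (radial_mass n f))%:E)%E.

Definition radial_map n rho (x : n.-tuple R) : n.-tuple R :=
  if eucl_norm x == 0 then [tuple 0 | _ < n]
  else [tuple rho (eucl_norm x) * tnth x i | i < n].

(* [radial_map 1 rho] read as a map of the real line *)
Definition radial_map1 rho (r : R) : R :=
  tnth (radial_map rho [tuple r]) ord0.

Lemma radial_map1E rho r :
  radial_map1 rho r = if r == 0 then 0 else rho `|r| * r.
Proof.
have rE : eucl_norm [tuple r] = `|r|.
  by rewrite /eucl_norm big_ord_recl big_ord0 addr0 sqrtr_sqr.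
by rewrite /radial_map1 /radial_map rE normr_eq0; case: ifP => _; rewrite tnth_mktuple.
Qed.

Definition conditionC rho : Prop :=
  [/\ forall r, 0 < r -> derivable rho r 1 /\ {for r, continuous (derive1 rho)},
      forall r, 0 < r -> 0 < rho r
    & {homo radial_map1 rho : x y / x < y}].

Definition conditionCn n rho : Prop := lipschitz_cont (@radial_map n rho).

(* The inverse of [radial_map1 rho], with value 0 outside of its range. *)
Definition inverse_map1 rho (y : R) : R :=
  xget 0 [set r | radial_map1 rho r = y].

(* [inverse_map1 rho] has no finite derivative at the critical values of
   [radial_map1 rho], where its [derive1] is arbitrary.  By Sard's theorem
   these form a null set. *)
Definition poincare_density n rho (x : n.-tuple R) : R :=
  if x \in @radial_map n rho @` [set y | y != [tuple 0 | _ < n]] then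
    (2 * pi) `^ (- (n%:R / 2))
    * expR (- (inverse_map1 rho (eucl_norm x)) ^+ 2 / 2)
    * (inverse_map1 rho (eucl_norm x) / eucl_norm x) ^+ n.-1
    * derive1 (inverse_map1 rho) (eucl_norm x)
  else 0.

Definition poincare_measure n rho (A : set (n.-tuple R)) : \bar R :=
  (\int[lebesgue_tuple n]_(x in A) (poincare_density rho x)%:E)%E.

(* [f] defines a radial probability measure on R^n that is a generalized
   Poincare limit, with function [rho]. *)
Definition generalized_poincare_limit_with n f rho : Prop :=
  [/\ (0 < radial_mass n f < +oo)%E, conditionC rho
    & forall A : set (n.-tuple R), measurable A ->
        radial_measure f A = poincare_measure rho A].

End radial.
Arguments radial_measure {R} n f A.
Arguments radial_map {R} n rho x.
Arguments poincare_measure {R} n rho A.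

(* Main.v *)
Require Import Defs.
From HB Require Import structures.
From mathcomp Require Import all_boot all_order all_algebra.
From mathcomp Require Import all_classical all_reals all_analysis.
From mathcomp Require Import measurable_realfun ring lra.
Set Implicit Arguments.
Unset Strict Implicit.
Unset Printing Implicit Defensive.
Import Order.TTheory GRing.Theory Num.Theory.
Import numFieldNormedType.Exports.
Local Open Scope classical_set_scope.
Local Open Scope ring_scope.
(** The measure [mu] of the theorem is the image of the standard Gaussian measure
    of R^n under [S = radial_map n (rho n)], and [S] is [L]-Lipschitz; hence it
    inherits the Gaussian isoperimetric inequality, with a loss of the factor
    [L].  Two facts have to be established.

    The Gaussian isoperimetric inequality ([gauss_enlargement]): if a set has at
    least the Gaussian measure [gcdf c] of a half-line, then its
    [e]-enlargement has at least the measure [gcdf (c + e)].  By induction on the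
    dimension, with Fubini and the sections of a set and of its enlargement, it
    reduces to a statement about functions on the line, [functional_enlargement].
    That statement is two-dimensional in disguise: it says that enlarging a
    hypograph [{y <= gquantile (f x)}] by [e] raises its measure as a half-plane
    would be raised.  It is proved by Borell's method, in [heat_comparison].  For
    [u = gquantile (heat f)], the heat equation becomes [u_t = (u_xx - u u_x^2) / 2].
    If [v] is a second solution and [v (x + e sin th) >= u x + e cos th] for all
    [x] and [th] at time 0, then [v 0 >= u 0 + e] at time 1, because a
    maximum principle applies to the gap
    [v (x + e sin a sin th) - u x - e cos th], where the horizontal
    semi-axis [e sin a] shrinks to 0 while the heat runs for the time [cos a ^+ 2].
    The general case follows by approximation ([lipschitz_enlargement]), and
    [functional_enlargement] from it by sup-convolutions.

    The image of the Gaussian measure ([radial_measureE]).  In polar coordinates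
    ([polar_integral]) the Lebesgue measure is a product, so it is enough to
    compare measures on the sets [sector E B] of the points with norm in [B] and
    direction in [E].  There the comparison is a substitution
    [y = s r] on the half-line, with [s = radial_map1 rho].  The map [s] may have
    critical points, at whose images the Poincare density vanishes, since
    [derive1] of the inverse is 0 there ([derive1_inverse]).  This yields only that
    the Poincare measure is at most the image measure ([poincare_sector_le]), but
    both measures are probability measures (the Poincare one because it is equal to
    a normalised radial measure), so they are equal
    ([measure_rectangles_unique]).

    Finally, for [mu A = a = gcdf c], the preimage of the [e]-enlargement of [A]
    contains the [e / L]-enlargement of the preimage of [A], so that the boundary
    measure of [A] is at least the slope [gpdf c / L] of [gcdf (c + e / L)] at
    [e = 0].  The half-line up to [c] shows that the Gaussian profile on the line
    at [a] is at most [gpdf c] ([lipschitz_image_profile]). *)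

(** * Measures given by a density *)

Section density.
Context d (T : measurableType d) (R : realType).
Variables (m : {measure set T -> \bar R}) (p : T -> R).
Hypotheses (p_ge0 : forall x, 0 <= p x) (mp : measurable_fun setT p).

(** The proofs are arguments, so that the measure structure can be inferred. *)
Definition density_measure of (forall x, 0 <= p x) & measurable_fun setT p :=
  fun A : set T => (\int[m]_(x in A) (p x)%:E)%E.
Local Notation nu := (density_measure p_ge0 mp).

Let nu0 : nu set0 = 0%E. Proof. exact: integral_set0. Qed.
Let nu_ge0 A : (0 <= nu A)%E.
Proof. by apply: integral_ge0 => x _; rewrite lee_fin. Qed.
Let nu_additive : semi_sigma_additive nu.
Proof.
move=> F mF tF mUF; rewrite /density_measure ge0_integral_bigcup//; last 2 first.
  by apply/measurable_EFinP/measurable_funTS.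
  by move=> x _; rewrite lee_fin.
by apply: is_cvg_ereal_nneg_natsum_cond => n _ _; exact: nu_ge0.
Qed.
HB.instance Definition _ := isMeasure.Build _ _ _ nu nu0 nu_ge0 nu_additive.

Import HBNNSimple.

Lemma integral_density (f : T -> \bar R) (E : set T) : measurable E ->
  measurable_fun E f -> (forall x, E x -> 0 <= f x)%E ->
  (\int[nu]_(x in E) f x = \int[m]_(x in E) (f x * (p x)%:E))%E.
Proof.
move=> mE mf f0.
have mpE : measurable_fun E (EFin \o p) by exact/measurable_EFinP/measurable_funTS.
pose h := nnsfun_approx mE mf.
have mh n : measurable_fun E (EFin \o h n).
  by apply/measurable_EFinP/measurable_funTS.
have hE x : E x -> (h n x)%:E @[n --> \oo] --> f x.
  by move=> Ex; apply: cvg_nnsfun_approx.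
have hnd x : E x -> {homo (fun n => (h n x)%:E) : a b / (a <= b)%N >-> (a <= b)%E}.
  by move=> Ex a b ab; rewrite lee_fin; exact/lefP/nd_nnsfun_approx.
have -> : (\int[nu]_(x in E) f x = limn (fun n => \int[nu]_(x in E) (h n x)%:E))%E.
  under eq_integral => x /[!inE] Ex do rewrite -(cvg_lim _ (hE x Ex))//.
  by apply: (@monotone_convergence _ _ _ nu E mE (fun n x => (h n x)%:E)) => // n x Ex; rewrite lee_fin.
have -> : (\int[m]_(x in E) (f x * (p x)%:E) =
    limn (fun n => \int[m]_(x in E) ((h n x)%:E * (p x)%:E)))%E.
  under eq_integral => x /[!inE] Ex.
    rewrite -(cvg_lim _ (cvgeZr (y:=(p x)%:E) isT (hE x Ex)))//; over.
  apply: (@monotone_convergence _ _ _ m E mE (fun n x => (h n x)%:E * (p x)%:E)%E) => //.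
  - by move=> n; exact: (emeasurable_funM (mh n) mpE).
  - by move=> n x Ex; rewrite mule_ge0// lee_fin.
  - by move=> x Ex a b ab; rewrite lee_wpmul2r ?lee_fin//; exact: hnd.
congr (limn _); apply/funext => n.
transitivity (\int[nu]_(x in E)
   (\sum_(y \in range (h n)) (y * \1_(h n @^-1` [set y]) x)%:E))%E.
  by apply: eq_integral => t tE; rewrite /= fimfunE -fsumEFin.
have indich r : measurable_fun E (fun x => (r * \1_(h n @^-1` [set r]) x)%:E).
  by apply: (measurable_comp measurableT) => //; exact: measurable_funM.
rewrite ge0_integral_fsum//; last by move=> y x Ex; exact: nnfun_muleindic_ge0.
transitivity (\int[m]_(x in E) (\sum_(y \in range (h n))
    ((y * \1_(h n @^-1` [set y]) x)%:E * (p x)%:E)))%E; last first.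
  apply: eq_integral => x xE.
  rewrite -ge0_mule_fsuml => [|y]; last exact: nnfun_muleindic_ge0.
  by rewrite fsumEFin // -(fimfunE _ x).
rewrite ge0_integral_fsum//; last 2 first.
  - by move=> y; exact: (emeasurable_funM (indich y) mpE).
  - by move=> y x Ex; rewrite mule_ge0 ?lee_fin// -lee_fin nnfun_muleindic_ge0.
apply: eq_fsbigr => r rhn.
under eq_integral do rewrite EFinM.
rewrite integralZl_indic_nnsfun => //.
under [RHS]eq_integral do rewrite EFinM -muleA.
rewrite ge0_integralZl//.
- under [in RHS]eq_integral do rewrite muleC.
  rewrite [in RHS](eq_integral ((EFin \o p) \_ (h n @^-1` [set r]))); last first.
    by move=> x xE; rewrite epatch_indic.
  by rewrite -integral_mkcondr integral_indic// setIC.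
- by apply: emeasurable_funM => //; exact/measurable_EFinP.
- by move=> t Et; rewrite mule_ge0 ?lee_fin.
- by move: rhn; rewrite inE => -[t _ <-]; rewrite lee_fin.
Qed.
End density.

Lemma integral_density_signed d (T : measurableType d) (R : realType)
    (m : {measure set T -> \bar R}) (p : T -> R)
    (p_ge0 : forall x, 0 <= p x) (mp : measurable_fun setT p)
    (f : T -> \bar R) (E : set T) : measurable E -> measurable_fun E f ->
  (\int[density_measure m p_ge0 mp]_(x in E) f x =
   \int[m]_(x in E) (f x * (p x)%:E))%E.
Proof.
move=> mE mf; rewrite [LHS]integralE [RHS]integralE.
rewrite !integral_density//; [|exact: measurable_funeneg|exact: measurable_funepos].
congr (_ - _)%E; apply: eq_integral => x _; rewrite ?funeposE ?funenegE.
  by rewrite muleC maxe_pMr ?lee_fin// mule0 muleC.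
by rewrite muleC maxe_pMr ?lee_fin// mule0 muleN muleC.
Qed.

(** * The Gaussian distribution on the line *)

Section gaussian_line.
Context {R : realType}.
Implicit Types (x y z c : R) (f g : R -> R).

Definition gpdf x : R := normal_pdf 0 1 x.
Definition gcdf x : R := fine (normal_prob (0 : R) 1 `]-oo, x]).
Local Notation gamma := (normal_prob (0 : R) 1).

Lemma gpdfE x : gpdf x = normal_peak 1 * expR (- (x ^+ 2 / 2)).
Proof.
rewrite /gpdf normal_pdfE ?oner_neq0// /normal_fun subr0 expr1n.
by rewrite mulNr.
Qed.

Lemma gpdf_gt0 x : 0 < gpdf x.
Proof. by rewrite gpdfE mulr_gt0 ?expR_gt0// normal_peak_gt0// oner_neq0. Qed.

Lemma gpdf_ge0 x : 0 <= gpdf x. Proof. exact/ltW/gpdf_gt0. Qed.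

Lemma gpdfN x : gpdf (- x) = gpdf x.
Proof. by rewrite !gpdfE sqrrN. Qed.

Lemma continuous_gpdf : continuous gpdf.
Proof. by move=> x; apply: continuous_normal_pdf; rewrite oner_neq0. Qed.

Lemma measurable_gpdf : measurable_fun setT gpdf.
Proof. exact: measurable_normal_pdf. Qed.

Global Instance is_derive_gpdf x : is_derive x 1 gpdf (- x * gpdf x).
Proof.
have -> : gpdf = (fun x => normal_peak 1 * expR (- (x ^+ 2 / 2))).
  by apply/funext => y; rewrite gpdfE.
apply: is_derive_eq.
by rewrite /GRing.scale/=; field.
Qed.

Lemma integrable_gpdf : lebesgue_measure.-integrable setT (EFin \o gpdf).
Proof. exact: integrable_normal_pdf. Qed.

Global Instance is_derive_gcdf x : is_derive x 1 gcdf (gpdf x).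
Proof.
have [||||dF F'E] := @continuous_FTC1 R gpdf (BInfty R true) x (x + 1).
- by rewrite ltrDl.
- by apply: integrableS integrable_gpdf.
- by rewrite ltNyr.
- exact: continuous_gpdf.
by apply: DeriveDef; [exact: dF | rewrite -derive1E].
Qed.

Lemma continuous_gcdf : continuous gcdf.
Proof.
by move=> x; apply/differentiable_continuous/derivable1_diffP; have [] := is_derive_gcdf x.
Qed.

Lemma gcdf_lt : {homo gcdf : x y / x < y}.
Proof.
move=> x y xy; have [z _] := MVT xy (fun z _ => is_derive_gcdf z)
  (continuous_subspaceT continuous_gcdf).
by rewrite -subr_gt0 => ->; rewrite mulr_gt0 ?gpdf_gt0 ?subr_gt0.
Qed.

Lemma gcdf_ltE : {mono gcdf : x y / x < y}.
Proof. exact: leW_mono (le_mono gcdf_lt). Qed.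

Lemma gcdf_leE : {mono gcdf : x y / x <= y}.
Proof. exact: le_mono gcdf_lt. Qed.

Lemma gcdfEFin x : normal_prob 0 1 `]-oo, x] = (gcdf x)%:E.
Proof. by rewrite fineK// fin_num_measure. Qed.

Lemma gcdf_ge0 x : 0 <= gcdf x.
Proof. by rewrite -lee_fin -gcdfEFin. Qed.

Lemma gcdf_le1 x : gcdf x <= 1.
Proof. by rewrite -lee_fin -gcdfEFin; apply: probability_le1. Qed.

Lemma gcdf_gt0 x : 0 < gcdf x.
Proof. by apply: le_lt_trans (gcdf_ge0 (x - 1)) _; apply: gcdf_lt; rewrite gtrBl. Qed.

Lemma gcdf_lt1 x : gcdf x < 1.
Proof. by apply: lt_le_trans (gcdf_lt _) (gcdf_le1 (x + 1)); rewrite ltrDl. Qed.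

Let idTR : measurableTypeR R -> R := idfun.
#[local] HB.instance Definition _ :=
  @isMeasurableFun.Build _ _ _ _ idTR (@measurable_id _ _ setT).

Lemma gcdf_cvgNy : gcdf x @[x --> -oo] --> (0 : R).
Proof.
have := @cvg_cdfNy0 _ _ _ gamma (idTR : {RV gamma >-> R}).
by move/fine_cvg; apply: cvg_trans; apply: near_eq_cvg; near=> x.
Unshelve. all: end_near. Qed.

Lemma gcdf_cvgy : gcdf x @[x --> +oo] --> (1 : R).
Proof.
have := @cvg_cdfy1 _ _ _ gamma (idTR : {RV gamma >-> R}).
by move/fine_cvg; apply: cvg_trans; apply: near_eq_cvg; near=> x.
Unshelve. all: end_near. Qed.

Lemma gcdf_tail (e : R) : 0 < e ->
  exists2 M, 0 < M & gcdf (- M) < e /\ 1 - e < gcdf M.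
Proof.
move=> e0.
have [A [_ hA]] : \forall x \near -oo, gcdf x < e.
  by have /cvgr_lt := gcdf_cvgNy; apply.
have [B [_ hB]] : \forall x \near +oo, 1 - e < gcdf x.
  by have /cvgr_gt := gcdf_cvgy; apply; rewrite gtrBl.
exists (`|A| + `|B| + 1); first by rewrite ltr_wpDl// addr_ge0.
split; [apply: hA | apply: hB].
  rewrite ltrNl; have := ler_norm (- A); rewrite normrN.
  by have := normr_ge0 B; lra.
by have := ler_norm B; have := normr_ge0 A; lra.
Qed.

(** The distribution function is continuous and has the limits 0 and 1. *)
Lemma gcdf_surj (p : R) : 0 < p < 1 -> exists c, gcdf c = p.
Proof.
move=> /andP[p0 p1].
have [M M0 [hM _]] := gcdf_tail p0.
have [M' M'0 [_ hM']] := @gcdf_tail (1 - p) ltac:(by rewrite subr_gt0).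
have MM' : - M <= M' by lra.
have [|c _ cE] := @IVT _ gcdf _ _ p MM' (continuous_subspaceT continuous_gcdf).
  by rewrite ge_min le_max (ltW hM)/=; apply/orP; right; move: hM'; lra.
by exists c.
Qed.

Definition gquantile (p : R) : R := xget 0 [set c | gcdf c = p].

Lemma gquantileK : {in [pred p | 0 < p < 1], cancel gquantile gcdf}.
Proof.
move=> p /= /gcdf_surj[c cp]; rewrite /gquantile.
by case: xgetP => [y _ //|/(_ c)].
Qed.

Lemma gcdf_inj : injective gcdf.
Proof. exact: (inc_inj gcdf_leE). Qed.

Lemma gcdfK : cancel gcdf gquantile.
Proof. by move=> c; apply: gcdf_inj; rewrite gquantileK// inE gcdf_gt0 gcdf_lt1. Qed.

Lemma is_derive_gquantile (p : R) : 0 < p < 1 ->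
  is_derive p 1 gquantile (gpdf (gquantile p))^-1.
Proof.
move=> p01; have pE := gquantileK p01; rewrite -{1}pE.
apply: (@is_derive_inverse _ gcdf gquantile (gpdf (gquantile p)) (gquantile p)).
- by near=> y; exact: gcdfK.
- by near=> y; exact: continuous_gcdf.
- by rewrite gt_eqF// gpdf_gt0.
Unshelve. all: end_near. Qed.

Lemma gquantile_le (p q : R) : 0 < p < 1 -> 0 < q < 1 ->
  (gquantile p <= gquantile q) = (p <= q).
Proof. by move=> p01 q01; rewrite -gcdf_leE !gquantileK. Qed.

Lemma gquantile_le_gcdf (p c : R) : 0 < p < 1 -> (gquantile p <= c) = (p <= gcdf c).
Proof. by move=> p01; rewrite -gcdf_leE gquantileK. Qed.

Lemma gquantile_ge_gcdf (p c : R) : 0 < p < 1 -> (c <= gquantile p) = (gcdf c <= p).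
Proof. by move=> p01; rewrite -gcdf_leE gquantileK. Qed.

Lemma integral_gaussE (f : R -> \bar R) (E : set R) : measurable E ->
  measurable_fun E f ->
  (\int[gamma]_(x in E) f x = \int[lebesgue_measure]_(x in E) (f x * (gpdf x)%:E))%E.
Proof.
move=> mE mf.
rewrite -(integral_density_signed lebesgue_measure gpdf_ge0 measurable_gpdf)//.
Qed.

Lemma integrable_gauss_bounded f C : measurable_fun setT f ->
  (forall x, `|f x| <= C) -> gamma.-integrable setT (EFin \o f).
Proof.
move=> mf fC; apply: measurable_bounded_integrable => //.
  by rewrite -ge0_fin_numE// fin_num_measure.
by exists C; split=> [|x Cx y _]; [exact: num_real|apply: le_trans (fC y) (ltW Cx)].
Qed.

End gaussian_line.

Section gaussian_moments.
Context {R : realType}.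
Implicit Types (x y z c : R) (f g : R -> R).
Local Notation gamma := (normal_prob (0 : R) 1).
Local Notation mu := (@lebesgue_measure R).

Lemma derivable_continuous f : (forall x, derivable f x 1) -> continuous f.
Proof. by move=> df x; apply/differentiable_continuous/derivable1_diffP. Qed.

Lemma RintegralE_gauss f : measurable_fun setT f ->
  \int[gamma]_z f z = \int[mu]_z (f z * gpdf z).
Proof.
move=> mf; rewrite /Rintegral; congr fine.
by rewrite integral_gaussE//; exact/measurable_EFinP.
Qed.

Lemma integrable_gaussE f : gamma.-integrable setT (EFin \o f) ->
  mu.-integrable setT (fun z => (f z * gpdf z)%:E).
Proof.
move=> /integrableP[/measurable_EFinP mf fi]; apply/integrableP; split.
  by apply/measurable_EFinP; apply: measurable_funM => //; exact: measurable_gpdf.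
apply: le_lt_trans fi; rewrite integral_gaussE//; last first.
  by apply: measurableT_comp => //; exact/measurable_EFinP.
rewrite le_eqVlt; apply/orP; left; apply/eqP; apply: eq_integral => x _ /=.
by rewrite normrM (ger0_norm (gpdf_ge0 _)).
Qed.

(** Comparison with the density of the Gaussian measure of standard deviation 2. *)
Lemma integrable_gauss_sqr : gamma.-integrable setT (fun z => (z ^+ 2)%:E).
Proof.
have mX : measurable_fun setT (fun z : R => (z ^+ 2)%:E).
  by apply/measurable_EFinP; exact: measurable_funX.
apply/integrableP; split => //.
rewrite integral_gaussE//; last exact: measurableT_comp.
pose C := normal_peak 1 * (8 / 3) / normal_peak 2 : R.
have p2 : 0 < normal_peak 2 :> R by apply: normal_peak_gt0; rewrite pnatr_eq0.
have p1 : 0 < normal_peak 1 :> R by apply: normal_peak_gt0; rewrite oner_neq0.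
have C0 : 0 <= C by rewrite !mulr_ge0 ?invr_ge0// ltW.
(* [1 + u <= expR u] at [u = 3 / 8 * x ^+ 2] trades the factor [x ^+ 2] for the
   wider Gaussian of standard deviation 2, since [3 / 8 = 1 / 2 - 1 / 8]. *)
apply: (@le_lt_trans _ _ (\int[mu]_x (C * normal_pdf 0 2 x)%:E)%E).
  apply: ge0_le_integral => //.
  - by move=> x _; rewrite mule_ge0// lee_fin ?gpdf_ge0//.
  - apply: emeasurable_funM; first exact: measurableT_comp.
    by apply/measurable_EFinP; exact: measurable_gpdf.
  - apply/measurable_EFinP; apply: measurable_funM => //.
    exact: measurable_normal_pdf.
  move=> x _; rewrite /= -EFinM lee_fin ger0_norm ?sqr_ge0// gpdfE.
  rewrite normal_pdfE ?pnatr_eq0// /normal_fun /C subr0.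
  have -> : expR (- x ^+ 2 / (2 ^+ 2 *+ 2)) = expR (- (x ^+ 2 / 2)) * expR (3 / 8 * x ^+ 2).
    by rewrite -expRD; congr expR; field.
  have key : x ^+ 2 <= 8 / 3 * expR (3 / 8 * x ^+ 2).
    by have := expR_ge1Dx (3 / 8 * x ^+ 2); lra.
  set a := expR (- _); set b := expR (3 / 8 * _) in key *.
  have -> : normal_peak 1 * (8 / 3) / normal_peak 2 * (normal_peak 2 * (a * b)) =
      normal_peak 1 * a * (8 / 3 * b) by field; rewrite gt_eqF.
  by rewrite [leLHS]mulrC ler_pM2l// mulr_gt0// expR_gt0.
under eq_integral do rewrite EFinM.
rewrite integralZl//; last exact: integrable_normal_pdf.
by rewrite integral_normal_pdf mule1 ltry.
Qed.

Lemma integrable_gauss_id : gamma.-integrable setT (EFin \o (fun z => z)).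
Proof.
have i1 : gamma.-integrable setT (fun z => 1%:E + (z ^+ 2)%:E)%E.
  apply: (integrableD _ _ integrable_gauss_sqr) => //.
  exact: finite_measure_integrable_cst.
apply: (le_integrable _ _ _ i1) => //; first exact/measurable_EFinP.
move=> x _ /=; rewrite lee_fin [leRHS]ger0_norm; last by rewrite addr_ge0// sqr_ge0.
have := sqr_ge0 (`|x| - 1); have := sqr_ge0 x; rewrite sqrrB real_normK ?num_real//.
set u := `|x|; set v := x ^+ 2; lra.
Qed.

Lemma integrable_gaussM f g (C : R) : measurable_fun setT f -> (forall x, `|f x| <= C) ->
  gamma.-integrable setT (EFin \o g) ->
  gamma.-integrable setT (EFin \o (fun z => g z * f z)).
Proof.
move=> mf fC gi; have C0 : 0 <= C by apply: le_trans (fC 0).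
have mg : measurable_fun setT g by case/integrableP: gi => /measurable_EFinP.
have i1 : gamma.-integrable setT (fun z => C%:E * (g z)%:E)%E by exact: integrableZl.
apply: (le_integrable _ _ _ i1) => //.
  by apply/measurable_EFinP; exact: measurable_funM.
move=> x _ /=; rewrite lee_fin !normrM mulrC ler_pM// (le_trans (fC x))//.
exact: ler_norm.
Qed.

Lemma gpdf_le_inv n : gpdf n.+1%:R <= normal_peak 1 * n.+1%:R^-1 :> R.
Proof.
rewrite gpdfE ler_pM2l; last by rewrite normal_peak_gt0// oner_neq0.
rewrite expRN lef_pV2 ?posrE ?expR_gt0//.
apply: le_trans (expR_ge1Dx _).
by have := sqr_ge0 (n.+1%:R - 1 : R); rewrite sqrrB; lra.
Qed.

(** The function [g z * gpdf z] vanishes at infinity and its derivative is the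
    difference of the two integrands times [gpdf]. *)
Lemma gauss_ibp g g' (C : R) : (forall z, is_derive z 1 g (g' z)) -> continuous g' ->
  (forall z, `|g z| <= C) -> (forall z, `|g' z| <= C) ->
  \int[gamma]_z (z * g z) = \int[gamma]_z g' z.
Proof.
move=> dg cg' gC g'C.
have cg : continuous g by apply: derivable_continuous => z; have [] := dg z.
have mg : measurable_fun setT g by exact: continuous_measurable_fun.
have mg' : measurable_fun setT g' by exact: continuous_measurable_fun.
have C0 : 0 <= C by apply: le_trans (gC 0).
have ig' : gamma.-integrable setT (EFin \o g') by exact: integrable_gauss_bounded g'C.
have izg : gamma.-integrable setT (EFin \o (fun z => z * g z)).
  exact: integrable_gaussM gC integrable_gauss_id.
pose J z := (g' z - z * g z) * gpdf z.
have dJ z : is_derive z 1 (fun z => g z * gpdf z) (J z).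
  by apply: is_derive_eq; rewrite /J /GRing.scale/=; ring.
have iJ : mu.-integrable setT (EFin \o J).
  exact: (integrable_gaussE (integrableB measurableT ig' izg)).
have cJ : continuous J.
  move=> z; apply: cvgM; last exact: continuous_gpdf.
  by apply: cvgB; [exact: cg'|apply: cvgM; [exact: cvg_id|exact: cg]].
suff J0 : \int[mu]_z J z = 0.
  apply/esym/eqP; rewrite -subr_eq0 -RintegralB// RintegralE_gauss//.
  - exact/eqP.
  - by apply: measurable_funB => //; exact: measurable_funM.
pose I n := `[(- n.+1%:R : R), n.+1%:R]%classic.
have mI n : measurable (I n) by exact: measurable_itv.
have [|||||_ _ cvJ] := @dominated_convergence _ _ _ mu _ measurableT
   (fun n x => ((J \_ (I n)) x)%:E) (EFin \o J) (fun x => `|(J x)%:E|%E).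
- move=> n; apply/measurable_EFinP; apply: (iffLR (measurable_restrictT J (mI n))).
  by apply: measurable_funTS; exact: continuous_measurable_fun.
- by apply/measurable_EFinP; exact: continuous_measurable_fun.
- apply: aeW => x _; apply: cvg_near_cst.
  exists (Num.bound `|x|) => // n /= xn.
  rewrite patchE mem_set// /I /= in_itv/= -ler_norml.
  apply: le_trans (ltW (archi_boundP (normr_ge0 x))) _.
  by rewrite ler_nat; exact: leq_trans xn (leqnSn n).
- exact: integrable_abse.
- apply: aeW => x n _; rewrite patchE; case: ifP => //= _.
  by rewrite normr0 lee_fin.
have {}cvJ : \int[mu]_(z in I n) J z @[n --> \oo] --> \int[mu]_z J z.
  have JE : (\int[mu]_x (EFin \o J) x = (\int[mu]_z J z)%:E)%E.
    by rewrite /Rintegral fineK// integrable_fin_num.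
  move: cvJ; rewrite JE => /fine_cvg; apply: cvg_trans.
  apply: near_eq_cvg; apply: nearW => n; rewrite /= [in RHS]/Rintegral.
  by rewrite integral_mkcond restrict_EFin.
have JE n : \int[mu]_(z in I n) J z =
    g n.+1%:R * gpdf n.+1%:R - g (- n.+1%:R) * gpdf n.+1%:R.
  rewrite /Rintegral (@continuous_FTC2 _ _ (fun z => g z * gpdf z)) ?gpdfN//.
  - by rewrite (@lt_trans _ _ 0)// oppr_lt0.
  - exact: continuous_subspaceT.
  - split.
    + by move=> x _; have [] := dJ x.
    + apply: cvg_at_right_filter; apply: cvgM; [exact: cg|exact: continuous_gpdf].
    + apply: cvg_at_left_filter; apply: cvgM; [exact: cg|exact: continuous_gpdf].
  - by move=> x _; rewrite derive1E; have [] := dJ x.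
suff : \int[mu]_(z in I n) J z @[n --> \oo] --> (0 : R).
  by move=> cv0; exact: (cvg_unique _ cvJ cv0).
under eq_fun do rewrite JE.
apply: (@norm_cvg0 R^o).
apply: (@squeeze_cvgr _ _ _ _ (cst 0) (fun n => 2 * C * normal_peak 1 * n.+1%:R^-1)).
- apply: nearW => n; rewrite normr_ge0/= -mulrBl normrM (ger0_norm (gpdf_ge0 _)).
  rewrite -mulrA ler_pM ?gpdf_ge0 ?gpdf_le_inv//.
  apply: (le_trans (ler_normB _ _)).
  by rewrite mulr2n mulrDl mul1r lerD.
- exact: cvg_cst.
- rewrite -[X in _ --> X](mulr0 (2 * C * normal_peak 1)); apply: cvgM; first exact: cvg_cst.
  exact: cvg_harmonic.
Qed.

End gaussian_moments.

(** * Gaussian averages at a variable time *)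

Section heat.
Context {R : realType}.
Implicit Types (x y z c h k : R) (f g : R -> R).
Local Notation gamma := (normal_prob (0 : R) 1).

(** The heat semigroup at the time [c ^+ 2]; the parameter [c] is kept because
    the averages are smooth in it down to [c = 0]. *)
Definition heat g c x : R := \int[gamma]_z g (x + c * z).

Definition lipschitz_fun (K : R) g := forall x y, `|g x - g y| <= K * `|x - y|.

Lemma lipschitz_fun_ge0 K g : lipschitz_fun K g -> 0 <= K.
Proof. by move=> /(_ 0 1); rewrite sub0r normrN1 mulr1; exact: le_trans. Qed.

Lemma lipschitz_fun_continuous K g : lipschitz_fun K g -> continuous g.
Proof.
move=> gK x; apply/(@cvgrPdist_lt _ R^o) => e e0.
have K1 : 0 < K + 1 by rewrite ltr_wpDl// (lipschitz_fun_ge0 gK).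
near=> y; apply: le_lt_trans (gK _ _) _.
apply: (@le_lt_trans _ _ ((K + 1) * `|x - y|)); first by rewrite ler_wpM2r// lerDl.
rewrite mulrC -ltr_pdivlMr//; near: y.
by apply: cvgr_dist_lt; [exact: cvg_id|rewrite divr_gt0].
Unshelve. all: end_near. Qed.

Lemma derivable_lipschitz K g g' : (forall x, is_derive x 1 g (g' x)) ->
  (forall x, `|g' x| <= K) -> lipschitz_fun K g.
Proof.
move=> dg gK x y; wlog xy : x y / x <= y => [hw|].
  by case/orP: (le_total x y) => /hw//; rewrite distrC (distrC y).
have [z _ E] : exists2 z, z \in `[x, y]%R & g y - g x = g' z * (y - x).
  apply: MVT_segment => //; apply: continuous_subspaceT.
  by apply: derivable_continuous => z; have [] := dg z.
by rewrite distrC E normrM (distrC x) ler_wpM2r.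
Qed.

Lemma taylor1_lipschitz K g g' x h : (forall x, is_derive x 1 g (g' x)) ->
  lipschitz_fun K g' -> `|g (x + h) - g x - h * g' x| <= K * h ^+ 2.
Proof.
move=> dg gK; have K0 := lipschitz_fun_ge0 gK.
pose r t := g (x + t * h) - t * (h * g' x).
have dr (t : R) : is_derive t 1 r (h * (g' (x + t * h) - g' x)).
  have d1 : is_derive t 1 (fun t => x + t * h) h.
    by apply: is_derive_eq; rewrite /GRing.scale/=; ring.
  have d2 := @is_derive1_comp _ g (fun t => x + t * h) t _ _ (dg _) d1.
  by apply: is_derive_eq; rewrite /GRing.scale/=; ring.
have [t t01 E] : exists2 t, t \in `[0, 1]%R & r 1 - r 0 = h * (g' (x + t * h) - g' x) * (1 - 0).
  apply: (@MVT_segment _ r) => //; apply: continuous_subspaceT.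
  by apply: derivable_continuous => z; have [] := dr z.
have -> : g (x + h) - g x - h * g' x = r 1 - r 0.
  by rewrite /r !mul1r !mul0r addr0 subr0; ring.
rewrite E subr0 mulr1 normrM -[h ^+ 2]real_normK ?num_real// expr2 mulrCA.
rewrite ler_wpM2l//; apply: le_trans (gK _ _) _.
rewrite addrAC subrr add0r ler_wpM2l// normrM ler_piMl//.
by move: t01; rewrite in_itv/= => /andP[t0 t1]; rewrite ger0_norm.
Qed.

Lemma continuous_affine c x : continuous (fun z => x + c * z).
Proof.
by move=> z; apply: cvgD; [exact: cvg_cst|apply: cvgM; [exact: cvg_cst|exact: cvg_id]].
Qed.

Lemma continuous_comp_affine g c x : continuous g -> continuous (fun z => g (x + c * z)).
Proof.
by move=> cg z; apply: (continuous_comp (@continuous_affine c x z)); exact: cg.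
Qed.

Definition bounded_by (K : R) g := forall x, `|g x| <= K.

Lemma integrable_heat K g c x : continuous g -> bounded_by K g ->
  gamma.-integrable setT (EFin \o (fun z => g (x + c * z))).
Proof.
move=> cg gK; apply: integrable_gauss_bounded (fun z => gK (x + c * z)).
by apply: continuous_measurable_fun; exact: continuous_comp_affine.
Qed.

Lemma Rintegral_gauss_cst (a : R) : \int[gamma]_z a = a.
Proof.
by rewrite Rintegral_cst// [X in fine X](_ : _ = 1%E) ?mulr1//; exact: probability_setT.
Qed.

Lemma integrable_gaussD f g : gamma.-integrable setT (EFin \o f) ->
  gamma.-integrable setT (EFin \o g) ->
  gamma.-integrable setT (EFin \o (fun z => f z + g z)).
Proof. by move=> fi gi; exact: (integrableD measurableT fi gi). Qed.

Lemma integrable_gaussB f g : gamma.-integrable setT (EFin \o f) ->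
  gamma.-integrable setT (EFin \o g) ->
  gamma.-integrable setT (EFin \o (fun z => f z - g z)).
Proof. by move=> fi gi; exact: (integrableB measurableT fi gi). Qed.

Lemma integrable_gaussZ k f : gamma.-integrable setT (EFin \o f) ->
  gamma.-integrable setT (EFin \o (fun z => k * f z)).
Proof. by move=> fi; exact: (integrableZl measurableT k fi). Qed.

Lemma integrable_gauss_cst k : gamma.-integrable setT (EFin \o (fun=> k)).
Proof. exact: finite_measure_integrable_cst. Qed.

Lemma heat_itv K g c x (a b : R) : continuous g -> bounded_by K g ->
  (forall y, a <= g y <= b) -> a <= heat g c x <= b.
Proof.
move=> cg gK gab; have ig := integrable_heat c x cg gK.
have ic t : gamma.-integrable setT (EFin \o cst t) by exact: finite_measure_integrable_cst.
rewrite -{1}(Rintegral_gauss_cst a) -(Rintegral_gauss_cst b).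
by apply/andP; split; [apply: (le_Rintegral _ (ic a) ig)|apply: (le_Rintegral _ ig (ic b))] => // z _; have /andP[] := gab (x + c * z).
Qed.

Lemma heat_bounded K g c : continuous g -> bounded_by K g -> bounded_by K (heat g c).
Proof.
move=> cg gK x; rewrite ler_norml; apply: (heat_itv c x cg gK) => y.
by rewrite -ler_norml.
Qed.

Let M1 : R := \int[gamma]_z `|z|.
Let M2 : R := \int[gamma]_z (z ^+ 2).

Lemma heat0 g x : heat g 0 x = g x.
Proof.
rewrite /heat -[RHS]Rintegral_gauss_cst; apply: eq_Rintegral => z _.
by rewrite mul0r addr0.
Qed.

(** Joint Lipschitz continuity in space and in the parameter, by integrating the
    pointwise estimate; it gives the compactness argument its continuity. *)
Lemma heat_lipschitz K g c k x h : bounded_by K g -> lipschitz_fun K g ->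
  `|heat g (c + k) (x + h) - heat g c x| <= K * (`|h| + `|k| * M1).
Proof.
move=> gB gK; have cg := lipschitz_fun_continuous gK.
have K0 := lipschitz_fun_ge0 gK.
have iabs : gamma.-integrable setT (EFin \o (fun z => `|z|)).
  exact: (integrable_norm integrable_gauss_id).
have ik : gamma.-integrable setT (EFin \o (fun z => `|k| * `|z|)) by exact: integrable_gaussZ.
have ih : gamma.-integrable setT (EFin \o (fun z => `|h| + `|k| * `|z|)).
  by apply: integrable_gaussD => //; exact: integrable_gauss_cst.
have i1 := integrable_heat (c + k) (x + h) cg gB.
have i2 := integrable_heat c x cg gB.
have i12 := integrable_gaussB i1 i2.
rewrite /heat -RintegralB//.
apply: le_trans (le_normr_Rintegral _ i12) _ => //.
have -> : K * (`|h| + `|k| * M1) = \int[gamma]_z (K * (`|h| + `|k| * `|z|)).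
  rewrite RintegralZl// RintegralD//; last exact: integrable_gauss_cst.
  by rewrite RintegralZl// Rintegral_gauss_cst.
apply: le_Rintegral => //; [exact: (integrable_norm i12)|exact: integrable_gaussZ|].
move=> z _; apply: le_trans (gK _ _) _; rewrite ler_wpM2l// -normrM.
by apply: le_trans (ler_normD _ _); rewrite le_eqVlt; apply/orP; left; apply/eqP; congr `|_|; ring.
Qed.

(** The error is quadratic because the pointwise one is, and the second moment of
    the Gaussian measure is finite.  No differentiation under the integral is
    involved. *)
Lemma heat_taylor K g g' c k x h : bounded_by K g -> bounded_by K g' ->
  (forall x, is_derive x 1 g (g' x)) -> lipschitz_fun K g' ->
  `|heat g (c + k) (x + h) - heat g c x
     - (h * heat g' c x + k * \int[gamma]_z (z * g' (x + c * z)))| <=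
  2 * K * (h ^+ 2 + k ^+ 2 * M2).
Proof.
move=> gB g'B dg gK; have K0 := lipschitz_fun_ge0 gK.
have cg : continuous g by apply: derivable_continuous => y; have [] := dg y.
have cg' := lipschitz_fun_continuous gK.
have i1 := integrable_heat (c + k) (x + h) cg gB.
have i2 := integrable_heat c x cg gB.
have i3 := integrable_heat c x cg' g'B.
have i4 : gamma.-integrable setT (EFin \o (fun z => z * g' (x + c * z))).
  apply: integrable_gaussM (fun z => g'B (x + c * z)) integrable_gauss_id.
  by apply: continuous_measurable_fun; exact: continuous_comp_affine.
have i12 := integrable_gaussB i1 i2.
have i34 := integrable_gaussD (integrable_gaussZ h i3) (integrable_gaussZ k i4).
have iz2 : gamma.-integrable setT (EFin \o (fun z : R => z ^+ 2)) := integrable_gauss_sqr.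
have i5 := integrable_gaussD (integrable_gauss_cst (h ^+ 2)) (integrable_gaussZ (k ^+ 2) iz2).
have i0 := integrable_gaussB i12 i34.
rewrite /heat -RintegralB// -(RintegralZl h measurableT i3) -(RintegralZl k measurableT i4).
rewrite -RintegralD//; [|exact: integrable_gaussZ..].
rewrite -RintegralB//.
apply: le_trans (le_normr_Rintegral _ i0) _ => //.
have -> : 2 * K * (h ^+ 2 + k ^+ 2 * M2) =
    \int[gamma]_z (2 * K * (h ^+ 2 + k ^+ 2 * z ^+ 2)).
  rewrite RintegralZl// RintegralD//; last 2 first.
  - exact: integrable_gauss_cst.
  - exact: integrable_gaussZ.
  by rewrite RintegralZl// Rintegral_gauss_cst.
apply: le_Rintegral => //; [exact: (integrable_norm i0)|exact: integrable_gaussZ|].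
move=> z _; have := taylor1_lipschitz (x + c * z) (h + k * z) dg gK.
have -> : x + c * z + (h + k * z) = x + h + (c + k) * z by ring.
have -> : h * g' (x + c * z) + k * (z * g' (x + c * z)) = (h + k * z) * g' (x + c * z) by ring.
move=> /le_trans; apply; rewrite (mulrC 2) -mulrA ler_wpM2l//.
by have := sqr_ge0 (h - k * z); rewrite -exprMn; nra.
Qed.

(** Caratheodory's form of the derivative: [heat_taylor] makes the remainder a
    product of [u - t] with a continuous function that vanishes at [t]. *)
Lemma is_derive_heat_curve K g g' (c y : R -> R) (t dc dy : R) :
  bounded_by K g -> bounded_by K g' ->
  (forall x, is_derive x 1 g (g' x)) -> lipschitz_fun K g' ->
  is_derive t 1 c dc -> is_derive t 1 y dy ->
  is_derive t 1 (fun t => heat g (c t) (y t))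
    (dy * heat g' (c t) (y t) + dc * \int[gamma]_z (z * g' (y t + c t * z))).
Proof.
move=> gB g'B dg gK Dc Dy.
have /is_derive1_caratheodory [gc [cE gcC gcE]] := Dc.
have /is_derive1_caratheodory [gy [yE gyC gyE]] := Dy.
set A := heat g' (c t) (y t); set B := \int[gamma]_z _.
pose F u := heat g (c u) (y u).
pose r u := F u - F t - ((y u - y t) * A + (c u - c t) * B).
have rle u : `|r u| <= 2 * K * ((gy u) ^+ 2 + (gc u) ^+ 2 * M2) * (u - t) ^+ 2.
  have := heat_taylor (c t) (c u - c t) (y t) (y u - y t) gB g'B dg gK.
  rewrite ![_ t + (_ - _)]addrC !subrK -/A -/B -/(F u) -/(F t) => /le_trans; apply.
  by rewrite yE cE !exprMn le_eqVlt; apply/orP; left; apply/eqP; ring.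
apply/is_derive1_caratheodory.
exists (fun u => gy u * A + gc u * B + r u / (u - t)); split.
- move=> u; have [->|ut] := eqVneq u t; first by rewrite !subrr mulr0.
  rewrite -/(F u) -/(F t) 2!mulrDl divfK ?subr_eq0// /r -!/(F _).
  by rewrite (yE u) (cE u); ring.
- suff : gy u * A + gc u * B + r u / (u - t) @[u --> t] --> gy t * A + gc t * B + 0.
    by rewrite /prop_for /continuous_at subrr invr0 mulr0.
  apply: cvgD.
    by apply: cvgD; apply: cvgM => //; exact: cvg_cst.
  apply: (@norm_cvg0 R^o).
  have cv0 : 2 * K * (gy u ^+ 2 + gc u ^+ 2 * M2) * `|u - t| @[u --> t] --> (0 : R).
    rewrite -[X in _ --> X](mulr0 (2 * K * (gy t ^+ 2 + gc t ^+ 2 * M2))).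
    apply: cvgM.
      apply: cvgM; first exact: cvg_cst.
      apply: cvgD; first exact: (cvgM gyC gyC).
      by apply: cvgM; [exact: (cvgM gcC gcC)|exact: cvg_cst].
    suff : `|u - t| @[u --> t] --> `|t - t| by rewrite subrr normr0.
    by apply: (@cvg_norm _ R^o); apply: cvgB; [exact: cvg_id|exact: cvg_cst].
  apply: (@squeeze_cvgr _ _ _ _ (cst 0) _ _ _ _ (cvg_cst _) cv0).
  apply: nearW => u; rewrite normr_ge0/=.
  have [->|ut] := eqVneq u t; first by rewrite subrr invr0 mulr0 !normr0 mulr0.
  rewrite normrM normfV ler_pdivrMr ?normr_gt0 ?subr_eq0//.
  apply: le_trans (rle u) _; rewrite -[leRHS]mulrA -normrM -[X in `|X|]expr2.
  by rewrite ger0_norm// sqr_ge0.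
- by rewrite subrr invr0 mulr0 addr0 gyE gcE.
Qed.

End heat.

(** * Borell's comparison of heat flows in the quantile scale *)

Section extremum_tests.
Context {R : realType}.
Implicit Types (f g : R -> R) (x a b l : R).

Lemma right_min_derive f a b l : a < b -> is_derive a 1 f l ->
  (forall t, a <= t <= b -> f a <= f t) -> 0 <= l.
Proof.
move=> ab /is_derive1_caratheodory[g [fE gC gE]] fmin.
rewrite leNgt; apply/negP => l0.
have : \forall t \near a, g t < 0 by apply: (cvgr_lt _ gC); rewrite gE.
move=> /nbhs_ballP[r /= r0 gr].
pose t := a + Num.min (r / 2) (b - a).
have m0 : 0 < Num.min (r / 2) (b - a) by rewrite lt_min subr_gt0 ab divr_gt0.
have ta : a < t by rewrite ltrDl.
have : g t < 0.
  apply: gr; rewrite /ball/= /t opprD addrA subrr add0r normrN ger0_norm ?ltW//.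
  by rewrite gt_min; apply/orP; left; lra.
have : f a <= f t.
  by apply: fmin; rewrite ltW//= /t -lerBrDl ge_min lexx orbT.
rewrite -subr_ge0 fE pmulr_lge0 ?subr_gt0// => /le_lt_trans h /h.
by rewrite ltxx.
Qed.

Lemma min_derive f f' a : (forall t : R, is_derive t 1 f (f' t)) ->
  (forall t, f a <= f t) -> f' a = 0.
Proof.
move=> df fmin.
have da : is_derive a 1 f 0.
  apply: (@derive1_at_min _ f (a - 1) (a + 1)) => //.
  - by rewrite lerD2l; lra.
  - by rewrite in_itv/=; apply/andP; split; lra.
by have [_ <-] := df a; have [_ ->] := da.
Qed.

(** A negative second derivative would make [f] decrease to the right of the
    minimum, by the mean value theorem. *)
Lemma min_derive2 f f' a l : (forall t : R, is_derive t 1 f (f' t)) ->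
  is_derive a 1 f' l -> (forall t, f a <= f t) -> 0 <= l.
Proof.
move=> df df' fmin; have f'a := min_derive df fmin.
have /is_derive1_caratheodory[g [fE gC gE]] := df'.
rewrite leNgt; apply/negP => l0.
have : \forall t \near a, g t < 0 by apply: (cvgr_lt _ gC); rewrite gE.
move=> /nbhs_ballP[r /= r0 gr].
have ar : a < a + r / 2 by rewrite ltrDl divr_gt0.
have [t] : exists2 t, t \in `]a, a + r / 2[%R & f (a + r / 2) - f a = f' t * (a + r / 2 - a).
  apply: MVT => //; apply: continuous_subspaceT.
  by apply: derivable_continuous => z; have [] := df z.
rewrite in_itv/= => /andP[at_ tr] E.
have : g t < 0.
  by apply: gr; rewrite /ball/= ler0_norm; lra.
have := fE t; rewrite f'a subr0 => f'E.
have := fmin (a + r / 2); rewrite -subr_ge0 E f'E (addrC a) addrK.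
rewrite pmulr_lge0 ?divr_gt0// pmulr_lge0 ?subr_gt0// => /le_lt_trans h /h.
by rewrite ltxx.
Qed.

End extremum_tests.

Section quantile_of_heat.
Context {R : realType}.
Implicit Types (x y z c : R).
Local Notation gamma := (normal_prob (0 : R) 1).

(** Initial data for the heat flow with values away from 0 and 1, so that
    [gquantile] is smooth along the flow. *)
Record smooth_profile (K lo hi : R) (f f1 f2 : R -> R) : Prop := SmoothProfile {
  profile_derive1 : forall x, is_derive x 1 f (f1 x);
  profile_derive2 : forall x, is_derive x 1 f1 (f2 x);
  profile_bound1 : bounded_by K f1;
  profile_bound2 : bounded_by K f2;
  profile_lipschitz2 : lipschitz_fun K f2;
  profile_itv : forall x, lo <= f x <= hi }.

Variables (K lo hi : R) (lo_gt0 : 0 < lo) (hi_lt1 : hi < 1).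
Variables (f f1 f2 : R -> R) (fP : smooth_profile K lo hi f f1 f2).

Let f_bounded : bounded_by 1 f.
Proof.
move=> x; have /andP[h1 h2] := profile_itv fP x.
by rewrite ger0_norm ?(le_trans (ltW lo_gt0) h1)// (le_trans h2 (ltW hi_lt1)).
Qed.

Let K1 := Num.max K 1.
Let K_le : K <= K1. Proof. by rewrite le_max lexx. Qed.

Let f_bounded' : bounded_by K1 f.
Proof. by move=> x; apply: le_trans (f_bounded x) _; rewrite le_max lexx orbT. Qed.
Let f1_bounded : bounded_by K1 f1.
Proof. by move=> x; apply: le_trans (profile_bound1 fP x) _. Qed.
Let f2_bounded : bounded_by K1 f2.
Proof. by move=> x; apply: le_trans (profile_bound2 fP x) _. Qed.
Let f_lip : lipschitz_fun K f.
Proof. exact: derivable_lipschitz (profile_derive1 fP) (profile_bound1 fP). Qed.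
Let f1_lip : lipschitz_fun K1 f1.
Proof. exact: derivable_lipschitz (profile_derive2 fP) f2_bounded. Qed.
Let f2_lip : lipschitz_fun K1 f2.
Proof. by move=> x y; apply: le_trans (profile_lipschitz2 fP x y) _; rewrite ler_wpM2r. Qed.

Lemma heat_profile_itv c x : lo <= heat f c x <= hi.
Proof.
exact: (heat_itv c x (lipschitz_fun_continuous f_lip) f_bounded (profile_itv fP)).
Qed.

Lemma heat_profile_itv01 c x : 0 < heat f c x < 1.
Proof. by have /andP[h1 h2] := heat_profile_itv c x; rewrite (lt_le_trans lo_gt0 h1) (le_lt_trans h2 hi_lt1). Qed.

(** The flow in the quantile scale, where the flow of a half-line is affine. *)
Definition qheat c x := gquantile (heat f c x).

Definition qheat1 c x := heat f1 c x / gpdf (qheat c x).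

(** The heat equation along a curve: the derivative in the parameter [c] is
    [\int z * f1 (y + c z)], which [gauss_ibp] turns into [c * heat f2]. *)
Lemma is_derive_heat_profile (c y : R -> R) (t dc dy : R) :
  is_derive t 1 c dc -> is_derive t 1 y dy ->
  is_derive t 1 (fun t => heat f (c t) (y t))
    (dy * heat f1 (c t) (y t) + dc * (c t * heat f2 (c t) (y t))).
Proof.
move=> Dc Dy.
have D := is_derive_heat_curve f_bounded' f1_bounded (profile_derive1 fP) f1_lip Dc Dy.
apply: is_derive_eq; congr (_ + _ * _).
have cf2 := lipschitz_fun_continuous f2_lip.
have dg (z : R) : is_derive z 1 (fun z => f1 (y t + c t * z)) (c t * f2 (y t + c t * z)).
  have d1 : is_derive z 1 (fun z => y t + c t * z) (c t).
    by apply: is_derive_eq; rewrite /GRing.scale/=; ring.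
  have := @is_derive1_comp _ f1 (fun z => y t + c t * z) z _ _ (profile_derive2 fP _) d1.
  by rewrite mulrC.
rewrite (gauss_ibp dg (C := K1 * (1 + `|c t|))).
- by rewrite RintegralZl//; exact: integrable_heat f2_bounded.
- by move=> z; apply: cvgM; [exact: cvg_cst|exact: continuous_comp_affine].
- move=> z; apply: le_trans (f1_bounded _) _; rewrite ler_peMr//.
    exact: le_trans (f1_bounded 0).
  by rewrite lerDl.
- move=> z; rewrite normrM mulrC ler_pM// ?f2_bounded//.
  by rewrite lerDr.
Qed.

Lemma is_derive_qheat (c y : R -> R) (t dc dy : R) :
  is_derive t 1 c dc -> is_derive t 1 y dy ->
  is_derive t 1 (fun t => qheat (c t) (y t))
    (dy * qheat1 (c t) (y t) + dc * (c t * heat f2 (c t) (y t) / gpdf (qheat (c t) (y t)))).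
Proof.
move=> Dc Dy; have D := is_derive_heat_profile Dc Dy.
have := @is_derive1_comp _ gquantile (fun t => heat f (c t) (y t)) t _ _
  (is_derive_gquantile (heat_profile_itv01 _ _)) D.
rewrite -/(qheat _ _) => D2; apply: is_derive_eq.
by rewrite /qheat1; ring.
Qed.

(** The second spatial derivative of [qheat]; the term [qheat * qheat1 ^+ 2] comes
    from [gpdf' = - id * gpdf], and it is the nonlinearity of the equation
    satisfied by [qheat]. *)
Definition qheat2 c x := heat f2 c x / gpdf (qheat c x) + qheat c x * qheat1 c x ^+ 2.

Lemma is_derive_qheat1 c (y : R -> R) (t dy : R) : is_derive t 1 y dy ->
  is_derive t 1 (fun t => qheat1 c (y t)) (dy * qheat2 c (y t)).
Proof.
move=> Dy; have Dc : is_derive t 1 (fun=> c) 0 by exact: is_derive_cst.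
have D1 : is_derive t 1 (fun t => qheat c (y t)) (dy * qheat1 c (y t)).
  have D := is_derive_qheat Dc Dy.
  by apply: is_derive_eq; rewrite mul0r addr0.
have D2 : is_derive t 1 (fun t => heat f1 c (y t)) (dy * heat f2 c (y t)).
  have D := is_derive_heat_curve f1_bounded f2_bounded (profile_derive2 fP) f2_lip Dc Dy.
  by apply: is_derive_eq; rewrite mul0r addr0.
have g0 : gpdf (qheat c (y t)) != 0 by rewrite gt_eqF// gpdf_gt0.
have Dg := @is_derive1_comp _ gpdf (fun t => qheat c (y t)) t _ _ (is_derive_gpdf _) D1.
have DV := @is_deriveV _ (fun t => gpdf (qheat c (y t))) t _ 1 g0 Dg.
rewrite /qheat1; apply: is_derive_eq.
by rewrite /qheat2 /qheat1 /GRing.scale/= /comp; field.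
Qed.

Lemma qheat_itv c x : gquantile lo <= qheat c x <= gquantile hi.
Proof.
have /andP[h1 h2] := heat_profile_itv c x; have h01 := heat_profile_itv01 c x.
have /andP[h3 h4] := h01.
by rewrite !gquantile_le// ?h1 ?h2// ?lo_gt0 ?hi_lt1 ?andbT/=; lra.
Qed.

Lemma qheat0 x : qheat 0 x = gquantile (f x).
Proof. by rewrite /qheat heat0. Qed.

End quantile_of_heat.

Section maximum_principle.
Context {R : realType}.
Implicit Types (x y z c : R).
Local Notation gamma := (normal_prob (0 : R) 1).

Lemma continuous_gquantile (p : R) : 0 < p < 1 -> {for p, continuous gquantile}.
Proof.
move=> /is_derive_gquantile Dp.
by apply/differentiable_continuous/derivable1_diffP; case: Dp.
Qed.

Lemma continuous_qheat K lo hi (f f1 f2 : R -> R) (T : topologicalType)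
    (u v : T -> R) (p : T) : 0 < lo -> hi < 1 -> smooth_profile K lo hi f f1 f2 ->
  {for p, continuous u} -> {for p, continuous v} ->
  {for p, continuous (fun p => qheat f (u p) (v p))}.
Proof.
move=> lo0 hi1 fP cu cv.
apply: (@continuous_comp _ _ _ (fun p => heat f (u p) (v p)) gquantile); last first.
  by apply: continuous_gquantile; exact: (heat_profile_itv01 lo0 hi1 fP).
set M := \int[gamma]_z `|z|; pose K1 := Num.max K 1.
have fB : bounded_by K1 f.
  move=> x; have /andP[h1 h2] := profile_itv fP x.
  rewrite ger0_norm ?(le_trans (ltW lo0) h1)// le_max; apply/orP; right.
  exact: le_trans h2 (ltW hi1).
have fL : lipschitz_fun K1 f.
  apply: derivable_lipschitz (profile_derive1 fP) _ => x.
  by apply: le_trans (profile_bound1 fP x) _; rewrite le_max lexx.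
suff d0 : heat f (u q) (v q) - heat f (u p) (v p) @[q --> p] --> (0 : R).
  suff : heat f (u q) (v q) - heat f (u p) (v p) + heat f (u p) (v p) @[q --> p]
      --> (0 + heat f (u p) (v p)).
    by under eq_fun do rewrite subrK; rewrite add0r.
  by apply: cvgD; [exact: d0|exact: cvg_cst].
apply: (@norm_cvg0 R^o).
have c0 : K1 * (`|v q - v p| + `|u q - u p| * M) @[q --> p] --> (0 : R).
  suff : K1 * (`|v q - v p| + `|u q - u p| * M) @[q --> p] -->
      K1 * (`|v p - v p| + `|u p - u p| * M).
    by rewrite !subrr normr0 mul0r addr0 mulr0.
  apply: cvgM; first exact: cvg_cst.
  apply: cvgD.
    by apply: (@cvg_norm _ R^o); apply: cvgB => //; exact: cvg_cst.
  apply: cvgM; last exact: cvg_cst.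
  by apply: (@cvg_norm _ R^o); apply: cvgB => //; exact: cvg_cst.
apply: (@squeeze_cvgr _ _ _ _ (cst 0) _ _ _ _ (cvg_cst _) c0).
apply: nearW => q; rewrite normr_ge0/=.
have := heat_lipschitz (u p) (u q - u p) (v p) (v q - v p) fB fL.
by rewrite ![_ p + (_ - _)]addrC !subrK.
Qed.

(** The gap function depends on [th] through [cos th] and [sin th] only, so that its
    minimum can be sought on a compact set of angles. *)
Lemma circle_reparam (th : R) : exists2 t, - pi <= t <= pi & cos t = cos th /\ sin t = sin th.
Proof.
have cB : -1 <= cos th <= 1 by rewrite cos_geN1 cos_le1.
have sE : sin (acos (cos th)) = `|sin th|.
  by rewrite sin_acos// -sqrtr_sqr; congr Num.sqrt; rewrite -(cos2Dsin2 th) addrC addKr.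
have p0 := pi_gt0 R.
have [s0|s0] := leP 0 (sin th).
  exists (acos (cos th)); last by rewrite acosK// sE ger0_norm.
  by rewrite acos_lepi// andbT (le_trans _ (acos_ge0 cB))//; lra.
exists (- acos (cos th)).
  by rewrite lerN2 acos_lepi//= lerNl (le_trans _ (acos_ge0 cB))//; lra.
by rewrite cosN sinN acosK// sE ltr0_norm// opprK.
Qed.

(** The maximum principle.  At a negative minimum of the penalised gap, [p] and [q]
    are the slopes of the two flows, [V] and [U] their values, and [Hs], [Fs] their
    diffusive terms.  Criticality in the angle gives [st = - p s ct]; inserted in
    the time derivative, it bounds [eta] by [Fs - Hs - e ct p^2].  By the
    second-order condition this is at most [p^2 (V - U - e ct) + U (p^2 - q^2) + 2 kap],
    whose first term is nonpositive as the gap is negative, and whose other terms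
    are small because [p - q] and [kap] are.  The number [om] quantifies how weak
    the confining penalty [kap x^2] has to be in terms of [eta]. *)
Lemma minimum_contradiction (e eta kap om M P B s c ct st x V U p q Hs Fs : R) :
  0 < e -> 0 <= s <= 1 -> 0 <= c <= 1 -> 0 <= M -> 0 <= P -> 0 <= B ->
  0 < om -> om <= 1 -> om * (3 + 4 * M * P * (1 + B)) <= eta -> kap = om ^+ 2 ->
  p - q + 2 * kap * x = 0 ->
  0 <= Hs + V * p ^+ 2 - (Fs + U * q ^+ 2) + 2 * kap ->
  p * (e * s * ct) + e * st = 0 ->
  0 <= e * c * st * p - s * c * Hs + s * c * Fs - eta ->
  V - U - e * ct <= 0 -> `|U| <= M -> `|p| <= P -> `|q| <= P -> kap * x ^+ 2 <= B ->
  False.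
Proof.
move=> e0 /andP[s0 s1] /andP[c0 c1] M0 P0 B0 om0 om1 omE kE eq1 eq2 eq3 eq4 neg UM pP qP xB.
have eq3' : st = - (p * s * ct).
  have : e * (p * s * ct + st) = 0 by rewrite -eq3; ring.
  by move=> /eqP; rewrite mulf_eq0 gt_eqF//= addrC addr_eq0 => /eqP.
have omx : `|om * x| <= 1 + B.
  have : `|om * x| ^+ 2 <= B by rewrite real_normK ?num_real// exprMn -kE.
  have := sqr_ge0 (`|om * x| - 1); have := normr_ge0 (om * x).
  set v := `|om * x|; nra.
have UU : U * (p ^+ 2 - q ^+ 2) <= 4 * M * P * (1 + B) * om.
  apply: le_trans (ler_norm _) _.
  have -> : U * (p ^+ 2 - q ^+ 2) = U * ((p - q) * (p + q)) by ring.
  have -> : p - q = - (2 * om * (om * x)) by move: eq1; rewrite kE => eq1; lra.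
  rewrite (normrM U) normrM normrN (normrM (2 * om)) (@ger0_norm _ (2 * om)); last first.
    by rewrite mulr_ge0// ltW.
  have pq : `|p + q| <= 2 * P by apply: le_trans (ler_normD _ _) _; lra.
  have -> : 4 * M * P * (1 + B) * om = M * (2 * om * (1 + B) * (2 * P)) by ring.
  have om2 : 0 <= 2 * om by rewrite mulr_ge0// ltW.
  apply: ler_pM => //; first by rewrite !mulr_ge0// ltW.
  by apply: ler_pM => //; [rewrite mulr_ge0|exact: ler_wpM2l].
have kom : kap <= om by rewrite kE expr2 ler_piMl// ltW.
have br : - Hs + Fs - e * ct * p ^+ 2 <= 2 * om + 4 * M * P * (1 + B) * om.
  have : p ^+ 2 * (V - U - e * ct) <= 0 by rewrite mulr_ge0_le0// sqr_ge0.
  have -> : p ^+ 2 * (V - U - e * ct) = V * p ^+ 2 - U * p ^+ 2 - e * ct * p ^+ 2 by ring.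
  by move: UU; rewrite mulrBr; lra.
have : eta <= s * c * (- Hs + Fs - e * ct * p ^+ 2).
  by move: eq4; rewrite eq3' => eq4; rewrite -subr_ge0; apply: le_trans eq4 _; lra.
have sc1 : 0 <= s * c <= 1 by rewrite mulr_ge0//= mulr_ile1.
have Q0 : 0 <= 2 * om + 4 * M * P * (1 + B) * om.
  by rewrite addr_ge0// ?mulr_ge0// ?addr_ge0// ltW.
have : s * c * (- Hs + Fs - e * ct * p ^+ 2) <= 2 * om + 4 * M * P * (1 + B) * om.
  have /andP[sc0 sc1'] := sc1.
  by apply: le_trans (ler_wpM2l sc0 br) _; rewrite ler_piMl.
move: omE; rewrite mulrDr; set t := 4 * M * P * _.
by rewrite [_ * t]mulrC; lra.
Qed.

End maximum_principle.

Section comparison_theorem.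
Context {R : realType}.
Implicit Types (x y z c : R).
Local Notation gamma := (normal_prob (0 : R) 1).

Lemma gpdf_ge_norm (u M : R) : `|u| <= M -> gpdf M <= gpdf u.
Proof.
move=> uM; rewrite !gpdfE ler_pM2l ?normal_peak_gt0 ?oner_neq0//.
rewrite ler_expR lerN2 ler_pM2r// -[u ^+ 2]real_normK ?num_real//.
by rewrite ler_pXn2r// ?nnegrE ?(le_trans _ uM).
Qed.

(** Both flows have run for the time [cos a ^+ 2], and their arguments differ by
    a point of an ellipse with the semi-axes [e sin a] and [e].  At [a = pi / 2] the
    ellipse is the circle of the hypothesis of [heat_comparison]; at [a = 0] it is a
    vertical segment, as in its conclusion. *)
Definition heat_gap (f h : R -> R) (e w a x th : R) : R :=
  qheat h (cos a) (x + e * sin a * sin th) - qheat f (cos a) x - e * cos th + w.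

(** The first penalty makes the inequality in time strict; the second one confines
    the minimum in space. *)
Definition penalised_gap (f h : R -> R) (e w eta kap a x th : R) : R :=
  heat_gap f h e w a x th + (eta * (pi / 2 - a) + kap * x ^+ 2).

Lemma is_derive_qheat_space K lo hi (f f1 f2 y : R -> R) (c t dy : R) :
  0 < lo -> hi < 1 -> smooth_profile K lo hi f f1 f2 -> is_derive t 1 y dy ->
  is_derive t 1 (fun t => qheat f c (y t)) (dy * qheat1 f f1 c (y t)).
Proof.
move=> lo0 hi1 fP Dy.
have Dc : is_derive t 1 (fun=> c) 0 by exact: is_derive_cst.
have D := is_derive_qheat lo0 hi1 fP Dc Dy.
by apply: is_derive_eq; rewrite mul0r addr0.
Qed.

(** Only a one-sided derivative in [a] is available, since [a = 0] is not excluded;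
    at [a = pi / 2] the gap is controlled by the initial condition. *)
Lemma penalised_gap_critical K lo hi (f f1 f2 h h1 h2 : R -> R) (e w eta kap a x th : R) :
  0 < lo -> hi < 1 ->
  smooth_profile K lo hi f f1 f2 -> smooth_profile K lo hi h h1 h2 ->
  0 <= a < pi / 2 ->
  (forall a' x' th', 0 <= a' <= pi / 2 ->
    penalised_gap f h e w eta kap a x th <= penalised_gap f h e w eta kap a' x' th') ->
  let y := x + e * sin a * sin th in
  let p := qheat1 h h1 (cos a) y in
  let q := qheat1 f f1 (cos a) x in
  [/\ p - q + 2 * kap * x = 0,
      0 <= qheat2 h h1 h2 (cos a) y - qheat2 f f1 f2 (cos a) x + 2 * kap,
      p * (e * sin a * cos th) + e * sin th = 0 &
      0 <= e * cos a * sin th * p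
        - sin a * cos a * (heat h2 (cos a) y / gpdf (qheat h (cos a) y))
        + sin a * cos a * (heat f2 (cos a) x / gpdf (qheat f (cos a) x)) - eta].
Proof.
move=> lo0 hi1 fP hP /andP[a0 api] glob y p q.
have a01 : 0 <= a <= pi / 2 by rewrite a0 ltW.
have Dsh (t : R) : is_derive t 1 (fun t => t + e * sin a * sin th) 1.
  by apply: is_derive_eq; rewrite addr0.
have Did (t : R) : is_derive t 1 (fun t : R => t) 1 by exact: is_derive_id.
have dx (t : R) : is_derive t 1 (fun t => penalised_gap f h e w eta kap a t th)
    (qheat1 h h1 (cos a) (t + e * sin a * sin th) - qheat1 f f1 (cos a) t + 2 * kap * t).
  have D1 := @is_derive_eq _ _ _ _ _ _ _ _ (is_derive_qheat_space (cos a) lo0 hi1 hP (Dsh t)) (mul1r _).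
  have D2 := @is_derive_eq _ _ _ _ _ _ _ _ (is_derive_qheat_space (cos a) lo0 hi1 fP (Did t)) (mul1r _).
  rewrite /penalised_gap /heat_gap.
  apply: is_derive_eq; rewrite /GRing.scale/=.
  by move: (qheat1 h _ _ _) (qheat1 f _ _ _) => u v; rewrite !addr0 subr0 add0r mul1r mulr1 -mulr2n mulr_natl mulrnAr mulrnAl.
split.
- exact: (min_derive dx (fun t => glob a t th a01)).
- apply: (min_derive2 dx _ (fun t => glob a t th a01)).
  have D1 := @is_derive_eq _ _ _ _ _ _ _ _ (is_derive_qheat1 lo0 hi1 hP (cos a) (Dsh x)) (mul1r _).
  have D2 := @is_derive_eq _ _ _ _ _ _ _ _ (is_derive_qheat1 lo0 hi1 fP (cos a) (Did x)) (mul1r _).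
  by apply: is_derive_eq; rewrite /GRing.scale/= mulr1.
- have dth (t : R) : is_derive t 1 (fun t => penalised_gap f h e w eta kap a x t)
      (qheat1 h h1 (cos a) (x + e * sin a * sin t) * (e * sin a * cos t) + e * sin t).
    have Dy : is_derive t 1 (fun t => x + e * sin a * sin t) (e * sin a * cos t).
      by apply: is_derive_eq; rewrite /GRing.scale/=; ring.
    have D1 := is_derive_qheat_space (cos a) lo0 hi1 hP Dy.
    rewrite /penalised_gap /heat_gap; apply: is_derive_eq; rewrite /GRing.scale/=.
    by rewrite subr0 !addr0 mulrN opprK mulrC.
  exact: (min_derive dth (fun t => glob a x t a01)).
- apply: (@right_min_derive _ (fun t => penalised_gap f h e w eta kap t x th) a (pi / 2)) => //.
    have Dy : is_derive a 1 (fun t => x + e * sin t * sin th) (e * cos a * sin th).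
      by apply: is_derive_eq; rewrite /GRing.scale/=; ring.
    have Dx : is_derive a 1 (fun=> x) 0 by exact: is_derive_cst.
    have D1 := is_derive_qheat lo0 hi1 hP (is_derive_cos a) Dy.
    have D2 := is_derive_qheat lo0 hi1 fP (is_derive_cos a) Dx.
    rewrite /penalised_gap /heat_gap; apply: is_derive_eq; rewrite -/y /p -!(mulrA (cos a)) /GRing.scale/=.
    move: (sin a) (cos a) (sin th) (heat h2 _ _ / _) (heat f2 _ _ / _) (qheat1 h _ _ _) (qheat1 f _ _ _).
    by move=> sa ca st u v p' q'; ring.
  by move=> t /andP[at_ tpi]; apply: glob; rewrite (le_trans a0 at_).
Qed.

(** The slack [w] absorbs the errors of a later approximation. *)
Theorem heat_comparison (K lo hi e w : R) (f f1 f2 h h1 h2 : R -> R) :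
  0 < lo -> hi < 1 -> 0 < e -> 0 <= w ->
  smooth_profile K lo hi f f1 f2 -> smooth_profile K lo hi h h1 h2 ->
  (forall x th, gquantile (f x) + e * cos th <= gquantile (h (x + e * sin th)) + w) ->
  qheat f 1 0 + e <= qheat h 1 0 + w.
Proof.
move=> lo0 hi1 e0 w0 fP hP fh; rewrite leNgt; apply/negP => gap.
pose D := heat_gap f h e w.
have D0 : D 0 0 0 < 0.
  by rewrite /D /heat_gap cos0 sin0 !mulr0 addr0 mulr1; lra.
have pi0 := pi_gt0 R.
pose eta : R := - D 0 0 0 / pi.
have eta0 : 0 < eta by rewrite divr_gt0// oppr_gt0.
pose M : R := `|gquantile lo| + `|gquantile hi|.
have M0 : 0 <= M by rewrite addr_ge0.
have qM g g1 g2 c x : smooth_profile K lo hi g g1 g2 -> `|qheat g c x| <= M.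
  move=> gP; have /andP[q1 q2] := qheat_itv lo0 hi1 gP c x.
  rewrite ler_norml /M; have := ler_norm (gquantile hi); have := ler_norm (- gquantile lo).
  by rewrite normrN; have := normr_ge0 (gquantile hi); have := normr_ge0 (gquantile lo);
     move=> *; apply/andP; split; lra.
have K0 : 0 <= K by apply: le_trans (profile_bound1 fP 0).
pose P := K / gpdf M.
have P0 : 0 <= P by rewrite divr_ge0// gpdf_ge0.
have q1P g g1 g2 c x : smooth_profile K lo hi g g1 g2 -> `|qheat1 g g1 c x| <= P.
  move=> gP; rewrite /qheat1 normrM normfV (ger0_norm (gpdf_ge0 _)).
  rewrite ler_pM ?invr_ge0 ?gpdf_ge0//.
    apply: heat_bounded (profile_bound1 gP) x.
    by apply: derivable_continuous => z; have [] := profile_derive2 gP z.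
  by rewrite lef_pV2 ?posrE ?gpdf_gt0// gpdf_ge_norm// (qM _ _ _ _ _ gP).
pose B : R := 2 * M + e.
have B0 : 0 <= B by rewrite addr_ge0 ?mulr_ge0// ltW.
have DB a x th : - B <= D a x th.
  have := qM _ _ _ (cos a) (x + e * sin a * sin th) hP.
  have := qM _ _ _ (cos a) x fP; rewrite !ler_norml => /andP[_ ?] /andP[? _].
  have : e * cos th <= e by rewrite ler_piMr ?cos_le1// ltW.
  by rewrite /D /heat_gap /B; lra.
clearbody B P M.
(* the largest [om] allowed by [minimum_contradiction] *)
pose om : R := Num.min 1 (eta / (3 + 4 * M * P * (1 + B))).
have den0 : 0 < 3 + 4 * M * P * (1 + B).
  have : 0 <= 4 * M * P * (1 + B) by rewrite !mulr_ge0// addr_ge0.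
  by lra.
have om0 : 0 < om by rewrite lt_min ltr01 divr_gt0.
have om1 : om <= 1 by rewrite ge_min lexx.
have omE : om * (3 + 4 * M * P * (1 + B)) <= eta.
  by rewrite -ler_pdivlMr// ge_min lexx orbT.
pose kap : R := om ^+ 2.
pose Dt := penalised_gap f h e w eta kap.
have Dt0 : Dt 0 0 0 < 0.
  rewrite /Dt /penalised_gap subr0 expr0n/= mulr0 addr0 -/D /eta.
  rewrite mulrA divfK ?gt_eqF//.
  by lra.
pose X : R := (B + 1) / om.
have X0 : 0 < X by rewrite divr_gt0// ltr_wpDl.
(* Outside of [- X, X] the spatial penalty exceeds the lower bound [- B] of the
   gap, so that a negative minimum over the box is a global one. *)
have far a x th : a <= pi / 2 -> X < `|x| -> 0 <= Dt a x th.
  move=> api Xx; rewrite /Dt /penalised_gap -/D.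
  have u1 : 0 <= eta * (pi / 2 - a) by rewrite mulr_ge0 ?subr_ge0// ltW.
  have u2 : B + 1 <= om * `|x| by rewrite mulrC -ler_pdivrMr// ltW.
  have u3 : kap * x ^+ 2 = (om * `|x|) ^+ 2 by rewrite exprMn real_normK ?num_real.
  have := DB a x th; rewrite u3; set v := om * `|x| in u2 *; nra.
pose A : set (R * (R * R)) := `[0, pi / 2] `*` (`[- X, X] `*` `[- pi, pi]).
have cA : compact A.
  by apply: compact_setX; [exact: segment_compact|apply: compact_setX; exact: segment_compact].
pose G (p : R * (R * R)) := Dt p.1 p.2.1 p.2.2.
have cG : continuous G.
  move=> p; rewrite /G /Dt /penalised_gap /heat_gap.
  have c1 : {for p, continuous (fun q : R * (R * R) => q.1)} by exact: cvg_fst.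
  have c2 : {for p, continuous (fun q : R * (R * R) => q.2.1)}.
    by apply: (@continuous_comp _ _ _ snd fst); [exact: cvg_snd|exact: cvg_fst].
  have c3 : {for p, continuous (fun q : R * (R * R) => q.2.2)}.
    by apply: (@continuous_comp _ _ _ snd snd); exact: cvg_snd.
  have ccos (u : R * (R * R) -> R) : {for p, continuous u} ->
      {for p, continuous (fun q => cos (u q))}.
    by move=> cu; apply: (@continuous_comp _ _ _ u cos) => //; exact: continuous_cos.
  have csin (u : R * (R * R) -> R) : {for p, continuous u} ->
      {for p, continuous (fun q => sin (u q))}.
    by move=> cu; apply: (@continuous_comp _ _ _ u sin) => //; exact: continuous_sin.
  have cc (t : R) : {for p, continuous (fun=> t)} by exact: cvg_cst.
  have cD (u v : R * (R * R) -> R) : {for p, continuous u} -> {for p, continuous v} ->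
      {for p, continuous (fun q => u q + v q)} by move=> cu cv; exact: cvgD.
  have cB (u v : R * (R * R) -> R) : {for p, continuous u} -> {for p, continuous v} ->
      {for p, continuous (fun q => u q - v q)} by move=> cu cv; exact: cvgB.
  have cM (u v : R * (R * R) -> R) : {for p, continuous u} -> {for p, continuous v} ->
      {for p, continuous (fun q => u q * v q)} by move=> cu cv; exact: cvgM.
  have cV := continuous_qheat lo0 hi1 hP (ccos _ c1)
    (cD _ _ c2 (cM _ _ (cM _ _ (cc e) (csin _ c1)) (csin _ c3))).
  have cU := continuous_qheat lo0 hi1 fP (ccos _ c1) c2.
  exact: (cD _ _ (cD _ _ (cB _ _ (cB _ _ cV cU) (cM _ _ (cc e) (ccos _ c3))) (cc w))
    (cD _ _ (cM _ _ (cc eta) (cB _ _ (cc (pi / 2)) c1)) (cM _ _ (cc kap) (cM _ _ c2 c2)))).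
have A0 : A !=set0.
  exists (0, (0, 0)); rewrite /A /= !in_itv/= lexx.
  by split; [rewrite divr_ge0// ltW|split; rewrite oppr_le0 !ltW].
have [[/= a [x th]]] := compact_EVT_min A0 cA (continuous_subspaceT cG).
rewrite inE /A /= !in_itv/= => -[/andP[a0 api] [/andP[xX1 xX2] /andP[th1 th2]]] Gmin.
have Gneg : Dt a x th < 0.
  apply: le_lt_trans Dt0; apply: (Gmin (0, (0, 0))).
  rewrite inE /A /= !in_itv/= lexx.
  by split; [rewrite divr_ge0// ltW|split; rewrite oppr_le0 !ltW].
have glob a' x' th' : 0 <= a' <= pi / 2 -> Dt a x th <= Dt a' x' th'.
  move=> /andP[a'0 a'pi]; have [xX|Xx] := leP `|x'| X; last first.
    exact: le_trans (ltW Gneg) (far _ _ _ a'pi Xx).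
  have [t tpi [ct st]] := circle_reparam th'.
  have -> : Dt a' x' th' = Dt a' x' t by rewrite /Dt /penalised_gap /heat_gap ct st.
  apply: (Gmin (a', (x', t))); rewrite inE /A /= !in_itv/= a'0 a'pi tpi.
  by split=> //; split=> //; rewrite -ler_norml.
have {}api : a < pi / 2.
  rewrite lt_neqAle api andbT; apply: contraTneq Gneg => ->.
  have k0 : 0 <= kap * x ^+ 2 by apply: mulr_ge0; exact: sqr_ge0.
  rewrite -leNgt /Dt /penalised_gap subrr mulr0 add0r addr_ge0//.
  rewrite /D /heat_gap cos_pihalf sin_pihalf mulr1 (qheat0 h) (qheat0 f).
  by have := fh x th; lra.
have a01 : 0 <= a <= pi / 2 by rewrite a0 ltW.
have xB : kap * x ^+ 2 <= B.
  have := DB a x th; have : 0 <= eta * (pi / 2 - a) by rewrite mulr_ge0 ?subr_ge0// ltW.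
  by move: Gneg; rewrite /Dt /penalised_gap -/D; lra.
have s01 : 0 <= sin a <= 1.
  have pi2 : pi / 2 <= pi :> R by lra.
  by rewrite sin_le1 andbT sin_ge0_pi// a0/= (le_trans (ltW api) pi2).
have c01 : 0 <= cos a <= 1.
  have pi2 : - (pi / 2) <= 0 :> R by lra.
  by rewrite cos_le1 andbT cos_ge0_pihalf// (ltW api) andbT (le_trans pi2 a0).
have [|eq1 eq2 eq3 eq4] := penalised_gap_critical lo0 hi1 fP hP _ glob; first by rewrite a0.
apply: (minimum_contradiction e0 s01 c01 M0 P0 B0 om0 om1 omE (erefl kap) eq1 eq2 eq3 eq4 _
  (qM _ _ _ _ _ fP) (q1P _ _ _ _ _ hP) (q1P _ _ _ _ _ fP) xB).
have k0 : 0 <= kap * x ^+ 2 by apply: mulr_ge0; exact: sqr_ge0.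
have k1 : 0 <= eta * (pi / 2 - a) by rewrite mulr_ge0 ?subr_ge0// ltW.
have gen (V U z u v : R) : 0 <= u -> 0 <= v -> V - U - z + w + (v + u) < 0 -> V - U - z <= 0.
  by move: w0; clear; lra.
exact: gen k0 k1 Gneg.
Qed.

End comparison_theorem.

(** * From Lipschitz functions to smooth profiles *)

Section steklov.
Context {R : realType}.
Implicit Types (x y k eta lo hi : R) (g : R -> R).
Local Notation mu := (@lebesgue_measure R).

(** The derivative of this average is a difference quotient, thus each averaging
    gains one derivative without any convolution theory. *)
Definition steklov eta g x : R := (\int[mu]_(t in `]x, x + eta]) g t) / eta.

Lemma integrable_itvcc g (a b : R) : continuous g -> mu.-integrable `[a, b] (EFin \o g).
Proof.
move=> cg; apply: continuous_compact_integrable; first exact: segment_compact.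
exact: continuous_subspaceT.
Qed.

Lemma steklov_itv eta g x lo hi : 0 < eta -> continuous g ->
  (forall t, x < t <= x + eta -> lo <= g t <= hi) -> lo <= steklov eta g x <= hi.
Proof.
move=> eta0 cg gb.
have ig : mu.-integrable `]x, x + eta] (EFin \o g).
  by apply: integrableS (integrable_itvcc x (x + eta) cg) => //; exact: subset_itv_oc_cc.
have muE : mu `]x, x + eta] = eta%:E.
  by rewrite lebesgue_measure_itv/= lte_fin ltrDl eta0 -EFinB addrC addKr.
have ic c : mu.-integrable `]x, x + eta] (EFin \o (fun=> c)).
  by apply: integrableS (integrable_itvcc x (x + eta) (@cst_continuous _ _ c)) => //; exact: subset_itv_oc_cc.
have cE c : \int[mu]_(t in `]x, x + eta]) c = c * eta.
  rewrite Rintegral_cst//; congr (_ * _).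
  by rewrite -[RHS]/(fine eta%:E); congr fine; exact: muE.
rewrite /steklov ler_pdivlMr// ler_pdivrMr// -!cE; apply/andP; split.
  apply: (le_Rintegral _ (ic lo) ig) => // t; rewrite /= in_itv/= => /gb /andP[]//.
by apply: (le_Rintegral _ ig (ic hi)) => // t; rewrite /= in_itv/= => /gb /andP[].
Qed.

Lemma is_derive_steklov eta g x : 0 < eta -> continuous g ->
  is_derive x 1 (steklov eta g) ((g (x + eta) - g x) / eta).
Proof.
move=> eta0 cg; pose G y := \int[mu]_(t in `[x - 1, y]) g t.
have dG y : x - 1 < y -> is_derive y 1 G (g y).
  move=> xy; have [dG' GE] := @continuous_FTC1_closed R g (x - 1) y (y + 1)
    ltac:(by rewrite ltrDl) (integrable_itvcc _ _ cg) xy (cg y).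
  by apply: DeriveDef; rewrite -?derive1E.
have dsh : is_derive x 1 (fun y : R => y + eta) 1.
  by apply: is_derive_eq; rewrite addr0.
have d1 : is_derive (x + eta) 1 G (g (x + eta)) by apply: dG; lra.
have d2 : is_derive x 1 G (g x) by apply: dG; lra.
have d3 := @is_derive1_comp _ G (fun y => y + eta) x _ _ d1 dsh.
apply: (@near_eq_is_derive _ _ _ (fun y => (G (y + eta) - G y) / eta)).
  have : x - 1 < x by lra.
  move=> /lt_nbhsr; apply: filterS => y xy.
  rewrite /steklov /G Rintegral_itvB//; first exact: integrable_itvcc.
  - by rewrite bnd_simp ltW.
  - by rewrite bnd_simp lerDl ltW.
apply: is_derive_eq.
by rewrite scaler0 add0r mulr1 /GRing.scale/= mulrC.
Qed.

Lemma steklov_close eta k g x : 0 < eta -> lipschitz_fun k g ->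
  `|steklov eta g x - g x| <= k * eta.
Proof.
move=> eta0 gk; have k0 := lipschitz_fun_ge0 gk.
have : g x - k * eta <= steklov eta g x <= g x + k * eta.
  apply: steklov_itv => //; first exact: lipschitz_fun_continuous gk.
  move=> t /andP[xt tx]; rewrite -ler_distl; apply: le_trans (gk _ _) _.
  by rewrite ler_wpM2l// ger0_norm; lra.
by rewrite -ler_distl.
Qed.

Lemma lipschitz_quotient eta k g : 0 < eta -> lipschitz_fun k g ->
  bounded_by k (fun x => (g (x + eta) - g x) / eta).
Proof.
move=> eta0 gk x; rewrite normrM normfV (ger0_norm (ltW eta0)) ler_pdivrMr//.
by apply: le_trans (gk _ _) _; rewrite (addrC x) addrK ger0_norm// ltW.
Qed.

Lemma lipschitz_quotient_lipschitz eta k g : 0 < eta -> lipschitz_fun k g ->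
  lipschitz_fun (2 * k / eta) (fun x => (g (x + eta) - g x) / eta).
Proof.
move=> eta0 gk x y; rewrite -mulrBl normrM normfV (ger0_norm (ltW eta0)).
rewrite ler_pdivrMr// mulrAC mulfVK ?gt_eqF//.
have -> : g (x + eta) - g x - (g (y + eta) - g y) = (g (x + eta) - g (y + eta)) - (g x - g y) by ring.
apply: le_trans (ler_normB _ _) _; rewrite -mulrA mulr2n mulrDl mul1r lerD//.
by apply: le_trans (gk _ _) _; rewrite opprD addrACA subrr addr0.
Qed.

Lemma steklov_lipschitz eta k g : 0 < eta -> lipschitz_fun k g ->
  lipschitz_fun k (steklov eta g).
Proof.
move=> eta0 gk; apply: derivable_lipschitz (lipschitz_quotient eta0 gk) => x.
exact: is_derive_steklov (lipschitz_fun_continuous gk).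
Qed.

Lemma lipschitz_funW (K K' : R) g : K <= K' -> lipschitz_fun K g -> lipschitz_fun K' g.
Proof. by move=> KK' gK x y; apply: le_trans (gK x y) _; rewrite ler_wpM2r. Qed.

(** Averaging twice makes a Lipschitz function twice differentiable with a
    Lipschitz second derivative; the constant [K] does not depend on the function,
    so that two functions can be smoothed with the same constant. *)
Lemma lipschitz_smoothing k lo hi (d : R) : 0 < d -> 0 <= k ->
  exists K, forall g, lipschitz_fun k g -> (forall x, lo <= g x <= hi) ->
    exists g0 g1 g2, smooth_profile K lo hi g0 g1 g2 /\ forall x, `|g0 x - g x| <= d.
Proof.
move=> d0 k0.
have [eta eta0 etaE] : exists2 eta, 0 < eta & k * eta + k * eta <= d.
  have k1 : 0 < k + 1 by rewrite ltr_wpDl.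
  exists (d / (2 * (k + 1))); first by rewrite divr_gt0// mulr_gt0.
  have -> : k * (d / (2 * (k + 1))) + k * (d / (2 * (k + 1))) = d * (k / (k + 1)).
    by field; rewrite gt_eqF.
  by rewrite ler_piMr ?ltW// ltr_pdivrMr// mul1r; lra.
exists (k + 2 * k / eta + 2 * (2 * k / eta) / eta) => g gk gb.
have cg := lipschitz_fun_continuous gk.
pose h := steklov eta g; pose Q u x : R := (u (x + eta) - u x) / eta.
have hk : lipschitz_fun k h by exact: steklov_lipschitz.
have q0 : 0 <= 2 * k / eta by rewrite !mulr_ge0// invr_ge0 ltW.
have q1 : 0 <= 2 * (2 * k / eta) / eta by apply: divr_ge0; [exact: mulr_ge0|exact: ltW].
have Qk : bounded_by k (Q g) by exact: lipschitz_quotient.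
have Ql : lipschitz_fun (2 * k / eta) (Q g) by exact: lipschitz_quotient_lipschitz.
exists (steklov eta h), (Q h), (Q (Q g)); split; first split.
- by move=> x; apply: is_derive_steklov => //; exact: lipschitz_fun_continuous hk.
- move=> x; have dh (y : R) : is_derive y 1 h (Q g y) by exact: is_derive_steklov.
  have dsh : is_derive x 1 (fun y : R => y + eta) 1.
    by apply: is_derive_eq; rewrite addr0.
  have d3 := @is_derive1_comp _ h (fun y => y + eta) x _ _ (dh _) dsh.
  by apply: is_derive_eq; rewrite scaler0 add0r mulr1 /GRing.scale/= mulrC.
- move=> x; apply: le_trans (lipschitz_quotient eta0 hk x) _.
  by rewrite -addrA lerDl addr_ge0.
- move=> x; apply: le_trans (lipschitz_quotient eta0 Ql x) _.
  by rewrite addrAC lerDr addr_ge0.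
- apply: lipschitz_funW (lipschitz_quotient_lipschitz eta0 Ql).
  by rewrite lerDr addr_ge0.
- move=> x; apply: steklov_itv => //; first exact: lipschitz_fun_continuous hk.
  by move=> t _; exact: steklov_itv.
- move=> x; have -> : steklov eta h x - g x = (steklov eta h x - h x) + (h x - g x) by ring.
  apply: le_trans (ler_normD _ _) _.
  apply: le_trans (lerD (steklov_close x eta0 hk) (steklov_close x eta0 gk)) _.
  exact: etaE.
Qed.

End steklov.

Section lipschitz_enlargement.
Context {R : realType}.
Implicit Types (x y k e c M : R) (f g v w : R -> R).
Local Notation gamma := (normal_prob (0 : R) 1).

Lemma gpdf_le_peak x : `|gpdf x| <= normal_peak 1.
Proof. by rewrite ger0_norm ?gpdf_ge0//; apply: normal_pdf_ub; exact: oner_neq0. Qed.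

Lemma gcdf_lipschitz : lipschitz_fun (normal_peak 1) (@gcdf R).
Proof. exact: (derivable_lipschitz (@is_derive_gcdf R) gpdf_le_peak). Qed.

(** A lower bound for the slope of [gcdf] on [[- M, M]], hence an upper bound for
    that of [gquantile]. *)
Lemma gcdf_expand M (a b : R) : `|a| <= M -> `|b| <= M ->
  gpdf M * `|a - b| <= `|gcdf a - gcdf b|.
Proof.
move=> aM bM; wlog ab : a b aM bM / b <= a => [hw|].
  by case/orP: (le_total a b) => /hw; [rewrite distrC (distrC (gcdf a))|]; exact.
have [z zab ->] := MVT_segment ab (fun z _ => is_derive_gcdf z)
  (continuous_subspaceT (@continuous_gcdf R)).
rewrite normrM ler_wpM2r// ger0_norm ?gpdf_ge0// gpdf_ge_norm//.
move: zab aM bM; rewrite in_itv/= !ler_norml => /andP[? ?] /andP[? ?] /andP[? ?].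
by apply/andP; split; lra.
Qed.

Lemma heat_le_close d f g c x K : continuous f -> continuous g ->
  bounded_by K f -> bounded_by K g -> (forall y, `|f y - g y| <= d) ->
  `|heat f c x - heat g c x| <= d.
Proof.
move=> cf cg fK gK fg.
have i1 := integrable_heat c x cf fK; have i2 := integrable_heat c x cg gK.
rewrite /heat -RintegralB//; apply: le_trans (le_normr_Rintegral _ (integrable_gaussB i1 i2)) _ => //.
rewrite -[leRHS](Rintegral_gauss_cst d); apply: le_Rintegral => //.
- exact: (integrable_norm (integrable_gaussB i1 i2)).
- exact: integrable_gauss_cst.
Qed.

(** [heat_comparison] for the smoothings of [gcdf \o v] and [gcdf \o w]; the
    smoothing errors become the slack, which then tends to 0. *)
Theorem lipschitz_enlargement M k e v w : 0 < e ->
  lipschitz_fun k v -> lipschitz_fun k w -> bounded_by M v -> bounded_by M w ->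
  (forall x th, v x + e * cos th <= w (x + e * sin th)) ->
  forall c, gcdf c <= \int[gamma]_z gcdf (v z) -> gcdf (c + e) <= \int[gamma]_z gcdf (w z).
Proof.
move=> e0 vk wk vM wM vw c.
have E g : \int[gamma]_z gcdf (g z) = heat (gcdf \o g) 1 0.
  by apply: eq_Rintegral => z _; rewrite add0r mul1r.
rewrite !E => cE; have k0 := lipschitz_fun_ge0 vk.
have M0 : 0 <= M by apply: le_trans (vM 0).
pose lo : R := gcdf (- M); pose hi : R := gcdf M.
have lo0 : 0 < lo by exact: gcdf_gt0.
have hi1 : hi < 1 by exact: gcdf_lt1.
pose m : R := gpdf M; have m0 : 0 < m by exact: gpdf_gt0.
have p0 : 0 <= normal_peak 1 :> R by exact: normal_peak_ge0.
pose C : R := normal_peak 1 * k; have C0 : 0 <= C by exact: mulr_ge0.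
have lipC u : lipschitz_fun k u -> lipschitz_fun C (gcdf \o u).
  move=> uk x y; apply: le_trans (gcdf_lipschitz _ _) _.
  by rewrite /C -mulrA ler_wpM2l.
have itv u : bounded_by M u -> forall x, lo <= (gcdf \o u) x <= hi.
  by move=> uM x; have := uM x; rewrite /= !gcdf_leE -ler_norml.
have lohi p : lo <= p <= hi -> 0 < p < 1.
  by move=> /andP[p1 p2]; rewrite (lt_le_trans lo0 p1) (le_lt_trans p2 hi1).
have qM p : lo <= p <= hi -> `|gquantile p| <= M.
  by move=> ph; rewrite ler_norml -(gcdf_leE (- M)) -(gcdf_leE _ M) gquantileK//; exact: lohi.
have qlip d p q : lo <= p <= hi -> lo <= q <= hi -> `|p - q| <= d ->
    `|gquantile p - gquantile q| <= d / m.
  move=> ph qh pq; rewrite ler_pdivlMr// mulrC.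
  by apply: le_trans (gcdf_expand (qM p ph) (qM q qh)) _; rewrite !gquantileK//; exact: lohi.
have bd u : (forall x, lo <= u x <= hi) -> bounded_by 1 u.
  by move=> uh x; have /andP[u1 u2] := lohi _ (uh x); rewrite ger0_norm ?ltW.
have cE' := lipschitz_fun_continuous (lipC v vk).
have cH' := lipschitz_fun_continuous (lipC w wk).
have Ev := heat_itv 1 0 cE' (bd _ (itv v vM)) (itv v vM).
have Ew := heat_itv 1 0 cH' (bd _ (itv w wM)) (itv w wM).
rewrite -gquantile_ge_gcdf; last exact: lohi.
have {}cE : c <= gquantile (heat (gcdf \o v) 1 0) by rewrite gquantile_ge_gcdf//; exact: lohi.
apply/ler_addgt0Pr => d' d'0.
have [d d0 dm] : exists2 d : R, 0 < d & d / m = d' / 4.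
  exists (d' * m / 4); first by rewrite divr_gt0// mulr_gt0.
  by field; rewrite gt_eqF.
have [K HK] := lipschitz_smoothing lo hi d0 C0.
have [f0 [f1 [f2 [fP fd]]]] := HK _ (lipC v vk) (itv v vM).
have [h0 [h1 [h2 [hP hd]]]] := HK _ (lipC w wk) (itv w wM).
have cf0 : continuous f0 by apply: derivable_continuous => z; have [] := profile_derive1 fP z.
have ch0 : continuous h0 by apply: derivable_continuous => z; have [] := profile_derive1 hP z.
have close1 := qlip _ _ _ (heat_profile_itv lo0 hi1 fP 1 0) Ev
  (heat_le_close 1 0 cf0 cE' (bd _ (profile_itv fP)) (bd _ (itv v vM)) fd).
have close2 := qlip _ _ _ (heat_profile_itv lo0 hi1 hP 1 0) Ew
  (heat_le_close 1 0 ch0 cH' (bd _ (profile_itv hP)) (bd _ (itv w wM)) hd).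
have : qheat f0 1 0 + e <= qheat h0 1 0 + 2 * (d / m).
  apply: (heat_comparison lo0 hi1 e0 _ fP hP) => [|x th].
    by rewrite mulr_ge0// divr_ge0// ltW.
  have := qlip _ _ _ (profile_itv fP x) (itv v vM x) (fd x).
  have := qlip _ _ _ (profile_itv hP (x + e * sin th)) (itv w wM (x + e * sin th)) (hd (x + e * sin th)).
  rewrite /= !gcdfK !ler_norml => /andP[hw _] /andP[_ fv].
  have ar (a b p q t s : R) : - t <= b - q -> a - p <= t -> p + s <= q -> a + s <= b + 2 * t.
    by clear; lra.
  exact: ar hw fv (vw x th).
have /ler_normlP[cl1 _] := close1; have /ler_normlP[_ cl2] := close2.
have ar (p q a b t : R) : t = d' / 4 -> - (p - a) <= t -> q - b <= t -> c <= a ->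
    p + e <= q + 2 * t -> c + e <= b + d' by clear; lra.
exact: ar dm cl1 cl2 cE.
Qed.

End lipschitz_enlargement.

(** * The Gaussian isoperimetric inequality on the line, for functions *)

Section supremum_of_functions.
Context {R : realType} (I : Type) (i0 : I) (F : I -> R -> R) (B : R).
Hypothesis FB : forall i x, F i x <= B.

(** A supremum of equi-Lipschitz functions is Lipschitz, thus measurable without
    any countability of the index type. *)
Definition sup_fun (x : R) : R := sup (range (F^~ x)).

Let hs x : has_sup (range (F^~ x)).
Proof. by split; [exists (F i0 x), i0|exists B => _ [i _ <-]]. Qed.

Lemma sup_fun_ge i x : F i x <= sup_fun x.
Proof. by apply: ub_le_sup; [case: (hs x)|exists i]. Qed.

Lemma sup_fun_le x b : (forall i, F i x <= b) -> sup_fun x <= b.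
Proof. by move=> Fb; apply: ge_sup; [case: (hs x)|move=> _ [i _ <-]]. Qed.

Lemma sup_fun_lipschitz k : (forall i, lipschitz_fun k (F i)) -> lipschitz_fun k sup_fun.
Proof.
move=> Fk x y; have half a b : sup_fun a - sup_fun b <= k * `|a - b|.
  rewrite lerBlDr; apply: sup_fun_le => i; rewrite -lerBlDr.
  apply: le_trans (le_trans (ler_norm _) (Fk i a b)).
  by rewrite lerB// sup_fun_ge.
by rewrite ler_norml lerNl opprB half distrC half.
Qed.

End supremum_of_functions.

Section functional_enlargement.
Context {R : realType}.
Implicit Types (x y z k e c d M : R) (f g v w : R -> R).
Local Notation gamma := (normal_prob (0 : R) 1).

(** The half-disk of radius [e - d] fits into the half-disk of radius [e] after a
    horizontal shift of at most [d / 2]; this gives room for a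
    sup-convolution. *)
Lemma half_disk_shift e d s t u : 0 < d -> d < e -> s ^+ 2 + t ^+ 2 = 1 -> `|u| <= d / 2 ->
  `|(e - d) * s + u| < e /\ (e - d) * t <= Num.sqrt (e ^+ 2 - ((e - d) * s + u) ^+ 2).
Proof.
move=> d0 de st ud; set r := e - d; have r0 : 0 < r by rewrite subr_gt0.
have re : r + d / 2 < e by rewrite /r; lra.
clearbody r.
have s1 : `|s| <= 1.
  rewrite -[leRHS]normr1 -ler_sqr ?qualifE/= ?normr_ge0// !real_normK ?num_real//.
  by rewrite expr1n -st lerDl sqr_ge0.
have key : (r * t) ^+ 2 + (r * s + u) ^+ 2 <= (r + d / 2) ^+ 2.
  have -> : (r * t) ^+ 2 + (r * s + u) ^+ 2 = r ^+ 2 * (s ^+ 2 + t ^+ 2) + 2 * r * (s * u) + u ^+ 2 by ring.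
  have -> : (r + d / 2) ^+ 2 = r ^+ 2 + 2 * r * (d / 2) + (d / 2) ^+ 2 by ring.
  rewrite st mulr1.
  have su : s * u <= d / 2.
    apply: le_trans (ler_norm _) _; rewrite normrM.
    by apply: le_trans (ler_wpM2r (normr_ge0 u) s1) _; rewrite mul1r.
  have u2 : u ^+ 2 <= (d / 2) ^+ 2.
    by rewrite -[u ^+ 2]real_normK ?num_real// ler_sqr ?qualifE/= ?divr_ge0// ltW.
  by rewrite lerD// lerD2l ler_pM2l// mulr_gt0.
have d20 : 0 <= r + d / 2 by rewrite addr_ge0 ?divr_ge0// ltW.
have e0 : 0 < e by apply: le_lt_trans re.
have key2 : (r * t) ^+ 2 + (r * s + u) ^+ 2 < e ^+ 2.
  by apply: le_lt_trans key _; rewrite ltr_sqr ?nnegrE ?(ltW e0).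
split.
  rewrite -ltr_sqr ?nnegrE ?(ltW e0)// real_normK ?num_real//.
  by apply: le_lt_trans key2; rewrite lerDr sqr_ge0.
apply: le_trans (ler_norm _) _; rewrite -sqrtr_sqr ler_wsqrtr// lerBrDr.
exact: ltW.
Qed.

(** The hypothesis says that the [e]-enlargement of the hypograph of
    [gquantile \o f] lies in the hypograph of [gquantile \o g].  To apply
    [lipschitz_enlargement], the quantile of [f] is clamped to [[- M, M]] and made
    Lipschitz by a sup-convolution [vk], and [wk] is the supremum of its translates
    along a circle of the radius [e - d]. *)
Theorem functional_enlargement f g e : 0 < e ->
  measurable_fun setT f -> measurable_fun setT g ->
  (forall x, 0 <= f x <= 1) -> (forall x, 0 <= g x <= 1) ->
  (forall x y c, `|x - y| < e -> gcdf c <= f x ->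
     gcdf (c + Num.sqrt (e ^+ 2 - (x - y) ^+ 2)) <= g y) ->
  forall c, gcdf c <= \int[gamma]_z f z -> gcdf (c + e) <= \int[gamma]_z g z.
Proof.
move=> e0 mf mg f01 g01 fg c cf.
have bd u : (forall x, 0 <= u x <= 1) -> bounded_by 1 u.
  by move=> uh x; have /andP[u1 u2] := uh x; rewrite ger0_norm.
have igf := integrable_gauss_bounded mf (bd _ f01).
have igg := integrable_gauss_bounded mg (bd _ g01).
(* [main] loses [d] in the level, the radius and the integral; the losses vanish
   with [d] because [gcdf] is Lipschitz. *)
suff main d : 0 < d -> d < e -> gcdf (c - d + (e - d)) <= \int[gamma]_z g z + d.
  have p0 : 0 <= normal_peak 1 :> R by exact: normal_peak_ge0.
  have C0 : 0 < 2 * normal_peak 1 + 1 :> R by rewrite ltr_wpDl// mulr_ge0.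
  apply/ler_addgt0Pr => t t0.
  pose d := Num.min (e / 2) (t / (2 * normal_peak 1 + 1)).
  have d0 : 0 < d by rewrite lt_min !divr_gt0.
  have de : d < e by rewrite gt_min; apply/orP; left; lra.
  have dt : normal_peak 1 * (2 * d) + d <= t.
    have : d * (2 * normal_peak 1 + 1) <= t by rewrite -ler_pdivlMr// ge_min lexx orbT.
    by apply: le_trans; rewrite le_eqVlt; apply/orP; left; apply/eqP; ring.
  have h1 := main d d0 de.
  have := gcdf_lipschitz (c + e) (c - d + (e - d)).
  have -> : c + e - (c - d + (e - d)) = 2 * d by ring.
  have d2 : 0 <= 2 * d by apply: mulr_ge0; rewrite // ltW.
  rewrite (ger0_norm d2) => /ler_normlP[_ h2].
  have ar (a b q p : R) : a - b <= p -> b <= q + d -> p + d <= t -> a <= q + t by clear; lra.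
  exact: ar h2 h1 dt.
move=> d0 de.
have t10 : 0 < gcdf c - gcdf (c - d) by rewrite subr_gt0 gcdf_ltE; lra.
have [M0 M00 [M0d M0t]] := @gcdf_tail R (Num.min d (gcdf c - gcdf (c - d))) ltac:(by rewrite lt_min d0).
pose M : R := M0 + e.
have M_gt0 : 0 < M by rewrite addr_gt0.
have Mlow : gcdf (- M + e) <= d.
  rewrite /M opprD subrK; apply: ltW; apply: lt_le_trans M0d _.
  by rewrite ge_min lexx.
have Mhigh : 1 - gcdf M <= gcdf c - gcdf (c - d).
  have : gcdf M0 <= gcdf M by rewrite gcdf_leE lerDl ltW.
  have : Num.min d (gcdf c - gcdf (c - d)) <= gcdf c - gcdf (c - d) by rewrite ge_min lexx orbT.
  by move: M0t; clear; lra.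
pose v x := gquantile (Num.max (gcdf (- M)) (Num.min (f x) (gcdf M))).
have lohi : gcdf (- M) <= gcdf M by rewrite gcdf_leE ge0_cp// ltW.
have clamp01 x : 0 < Num.max (gcdf (- M)) (Num.min (f x) (gcdf M)) < 1.
  by rewrite lt_max gcdf_gt0/= gt_max gcdf_lt1/= gt_min gcdf_lt1 orbT.
have vE x : gcdf (v x) = Num.max (gcdf (- M)) (Num.min (f x) (gcdf M)).
  by rewrite gquantileK//; exact: clamp01.
have vleM x : v x <= M.
  by rewrite gquantile_le_gcdf// ge_max lohi/= ge_min lexx orbT.
have vgeM x : - M <= v x by rewrite gquantile_ge_gcdf// le_max lexx.
have vcase x : v x = - M \/ gcdf (v x) <= f x.
  rewrite vE; have [h|h] := leP (Num.min (f x) (gcdf M)) (gcdf (- M)).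
    left; apply: gcdf_inj; rewrite vE; exact/max_idPl.
  by right; rewrite ge_min lexx.
have vge x : f x - (1 - gcdf M) <= gcdf (v x).
  rewrite vE le_max; apply/orP; right; rewrite le_min; have /andP[f0 f1] := f01 x.
  have := gcdf_lt1 M; move: f0 f1; clear; move=> *; apply/andP; split; lra.
(* Beyond the distance [d / 2] the cone of slope [k] falls by more than the
   oscillation [2 * M] of [v]. *)
pose k : R := 4 * M / d.
have k0 : 0 < k by rewrite divr_gt0// mulr_gt0.
have kfar (u : R) : d / 2 < u -> 2 * M < k * u.
  have -> : 2 * M = k * (d / 2) by rewrite /k; field; rewrite gt_eqF.
  by rewrite ltr_pM2l.
clearbody k.
pose F z x : R := v z - k * `|x - z|.
have FM z x : F z x <= M.
  by rewrite /F lerBlDr (le_trans (vleM z))// lerDl mulr_ge0// ltW.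
pose vk := sup_fun F.
have vk_lip : lipschitz_fun k vk.
  apply: (sup_fun_lipschitz 0 FM) => z x y; rewrite /F opprD opprK addrACA subrr add0r.
  rewrite addrC -mulrBr normrM (ger0_norm (ltW k0)) ler_wpM2l ?(ltW k0)//.
  apply: le_trans (ler_dist_dist _ _) _.
  by rewrite opprB addrA subrK distrC.
have vk_ge x : v x <= vk x.
  by have := sup_fun_ge x FM x x; rewrite {1}/F subrr normr0 mulr0 subr0; apply.
have vk_le x : vk x <= M by apply: (sup_fun_le 0 FM) => z.
pose e' : R := e - d; have e'0 : 0 < e' by rewrite subr_gt0.
pose G th y : R := vk (y - e' * sin th) + e' * cos th.
have GM th y : G th y <= M + e'.
  by rewrite /G lerD// ler_piMr ?cos_le1 ?(ltW e'0).
pose wk := sup_fun G.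
have wk_lip : lipschitz_fun k wk.
  apply: (sup_fun_lipschitz 0 GM) => th x y; rewrite /G opprD addrACA subrr addr0.
  by apply: le_trans (vk_lip _ _) _; rewrite opprB addrA subrK.
have wk_ge x th : vk x + e' * cos th <= wk (x + e' * sin th).
  by have := sup_fun_ge x GM th (x + e' * sin th); rewrite {1}/G addrK; apply.
have wk_le y : wk y <= M + e' by apply: (sup_fun_le 0 GM).
have vk_bound : bounded_by (M + e') vk.
  move=> x; rewrite ler_norml; have := vk_le x; have := vk_ge x; have := vgeM x.
  by move: e'0; clear; move=> *; apply/andP; split; lra.
have wk_bound : bounded_by (M + e') wk.
  move=> y; rewrite ler_norml wk_le andbT.
  have := wk_ge y 0; rewrite cos0 sin0 mulr0 addr0 mulr1.
  have /ler_normlP[] := vk_bound y; have := vk_ge y; have := vgeM y.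
  by move: e'0; clear; lra.
(* A point of the hypograph of [vk] that is not at the level [- M] comes from
   the hypograph of [f], up to a shift of at most [d / 2]; the remaining ones
   only reach levels at which [gcdf] is at most [d]. *)
have wkg y : gcdf (wk y) <= g y + d.
  have /andP[g0 g1] := g01 y.
  have [b1|b1] := leP 1 (g y + d); first exact: le_trans (gcdf_le1 _) b1.
  have b01 : 0 < g y + d < 1 by rewrite b1 ltr_wpDl.
  rewrite -[leRHS](gquantileK b01) gcdf_leE; apply: (sup_fun_le 0 GM) => th.
  rewrite /G -lerBrDr; apply: (sup_fun_le 0 FM) => z.
  rewrite lerBrDr gquantile_ge_gcdf//.
  have low (u : R) : u <= - M + e -> gcdf u <= g y + d.
    move=> uM; apply: (@le_trans _ _ (gcdf (- M + e))); first by rewrite gcdf_leE.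
    by apply: le_trans Mlow _; rewrite lerDr.
  have ct : e' * cos th <= e.
    by apply: (@le_trans _ _ e'); [rewrite ler_piMr ?cos_le1// ltW|rewrite /e' gerBl ltW].
  have kn0 : 0 <= k * `|y - e' * sin th - z| by rewrite mulr_ge0// ltW.
  rewrite /F.
  case: (vcase z) => [vz|vz]; first by apply: low; rewrite vz; move: ct kn0; clear; lra.
  have [near|/kfar far] := leP `|y - e' * sin th - z| (d / 2); last first.
    by apply: low; have := vleM z; move: ct far; clear; lra.
  have sc : sin th ^+ 2 + cos th ^+ 2 = 1 by rewrite addrC cos2Dsin2.
  have := half_disk_shift d0 de sc near.
  have -> : (e - d) * sin th + (y - e' * sin th - z) = - (z - y) by rewrite /e'; ring.
  rewrite normrN sqrrN -/e' => -[h1 h2].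
  apply: (@le_trans _ _ (g y)); last by rewrite lerDl ltW.
  apply: le_trans (fg z y (v z) h1 vz); rewrite gcdf_leE.
  by rewrite lerD// lerBlDr lerDl.
have cgw : measurable_fun setT (fun z => gcdf (wk z)).
  apply: continuous_measurable_fun => z; apply: continuous_comp.
    exact: (lipschitz_fun_continuous wk_lip).
  exact: continuous_gcdf.
have cgv : measurable_fun setT (fun z => gcdf (vk z)).
  apply: continuous_measurable_fun => z; apply: continuous_comp.
    exact: (lipschitz_fun_continuous vk_lip).
  exact: continuous_gcdf.
have gc01 (u : R -> R) : bounded_by 1 (fun z => gcdf (u z)).
  by move=> x; rewrite ger0_norm ?gcdf_ge0 ?gcdf_le1.
have igv := integrable_gauss_bounded cgv (gc01 vk).
have igw := integrable_gauss_bounded cgw (gc01 wk).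
have step1 : gcdf (c - d) <= \int[gamma]_z gcdf (vk z).
  have h1 : \int[gamma]_z (f z - (1 - gcdf M)) <= \int[gamma]_z gcdf (vk z).
    apply: le_Rintegral => //.
      by apply: integrable_gaussB => //; exact: integrable_gauss_cst.
    by move=> z _; apply: le_trans (vge z) _; rewrite gcdf_leE.
  apply: le_trans h1; rewrite RintegralB//; last exact: integrable_gauss_cst.
  rewrite Rintegral_gauss_cst; have ar (a b p q : R) : p <= q -> 1 - a <= p - b -> b <= q - (1 - a) by clear; lra.
  exact: ar cf Mhigh.
have step2 := lipschitz_enlargement e'0 vk_lip wk_lip vk_bound wk_bound wk_ge step1.
apply: (le_trans step2); rewrite -[leRHS]/(_ + d).
have igd := integrable_gaussD igg (integrable_gauss_cst d).
apply: (@le_trans _ _ (\int[gamma]_z (g z + d))); first exact: le_Rintegral.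
by rewrite RintegralD//; [rewrite Rintegral_gauss_cst|exact: integrable_gauss_cst].
Qed.

End functional_enlargement.

(** * The Gaussian isoperimetric inequality in higher dimension *)

Section gaussian_tuple.
Context {R : realType}.
Local Notation mu := (@lebesgue_measure R).
Local Notation gamma := (normal_prob (0 : R) 1).
Implicit Types (n : nat).
Local Open Scope ereal_scope.

Lemma integral_lebesgue_tupleS n (f : n.+1.-tuple R -> \bar R) :
  measurable_fun setT f -> (forall x, 0 <= f x) ->
  \int[lebesgue_tuple n.+1]_x f x =
  \int[mu]_x \int[lebesgue_tuple n]_t f (tuple_of_pair (x, t)).
Proof.
move=> mf f0.
pose m2 : {measure set (measurableTypeR R * n.-tuple R) -> \bar R} := mu \x lebesgue_tuple n.
pose push : {measure set (n.+1.-tuple R) -> \bar R} :=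
  measure_function_pushforward__canonical__measure_function_Measure m2
    (@measurable_tuple_of_pair R n).
transitivity (\int[push]_x f x).
  by apply: eq_measure_integral => A mA _.
rewrite ge0_integral_pushforward//=.
rewrite (@fubini_tonelli1 _ _ _ _ _ mu (lebesgue_tuple n) (f \o @tuple_of_pair R n)) //.
- exact: measurableT_comp mf (@measurable_tuple_of_pair R n).
- by move=> x; exact: f0.
- exact: measurable_tuple_of_pair.
Qed.

Definition gauss_tuple_pdf n (x : n.-tuple R) : R := (\prod_(i < n) gpdf (tnth x i))%R.

Lemma gauss_tuple_pdf_ge0 n (x : n.-tuple R) : (0 <= gauss_tuple_pdf x)%R.
Proof. by apply: prodr_ge0 => i _; exact: gpdf_ge0. Qed.

Lemma measurable_gauss_tuple_pdf n : measurable_fun setT (@gauss_tuple_pdf n).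
Proof.
apply: measurable_prod => i _.
by apply: measurableT_comp; [exact: measurable_gpdf|exact: measurable_tnth].
Qed.

Definition gauss_tuple n : set (n.-tuple R) -> \bar R :=
  density_measure (lebesgue_tuple n) (@gauss_tuple_pdf_ge0 n) (@measurable_gauss_tuple_pdf n).

HB.instance Definition _ n := Measure.on (@gauss_tuple n).

Lemma gauss_tuple_pdfS n (x : R) (t : n.-tuple R) :
  gauss_tuple_pdf (tuple_of_pair (x, t)) = (gpdf x * gauss_tuple_pdf t)%R.
Proof.
rewrite /gauss_tuple_pdf big_ord_recl; congr (_ * _)%R.
by apply: eq_bigr => i _; rewrite tnthS.
Qed.

Definition tuple_section n (A : set (n.+1.-tuple R)) (x : R) : set (n.-tuple R) :=
  [set t | A (tuple_of_pair (x, t))].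

Lemma measurable_tuple_section n (A : set (n.+1.-tuple R)) (x : R) :
  measurable A -> measurable (tuple_section A x).
Proof.
move=> mA; rewrite -[X in measurable X]setTI.
have mf : measurable_fun setT (fun t : n.-tuple R => tuple_of_pair (x, t)).
  apply: measurableT_comp; first exact: measurable_tuple_of_pair.
  exact: measurable_fun_pair.
exact: mf.
Qed.

(** Fubini, together with the measurability of the section function. *)
Lemma gauss_tupleS n (A : set (n.+1.-tuple R)) : measurable A ->
  gauss_tuple A = \int[gamma]_x gauss_tuple (tuple_section A x) /\
  measurable_fun setT (fun x => gauss_tuple (tuple_section A x)).
Proof.
move=> mA.
pose f (x : n.+1.-tuple R) : \bar R := (gauss_tuple_pdf x)%:E * (\1_A x)%:E.
have mf : measurable_fun setT f.
  apply: emeasurable_funM; apply/measurable_EFinP => //.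
  exact: measurable_gauss_tuple_pdf.
have f0 x : 0 <= f x by rewrite mule_ge0// lee_fin gauss_tuple_pdf_ge0.
have fE (x : R) : \int[lebesgue_tuple n]_t f (tuple_of_pair (x, t)) =
    (gpdf x)%:E * gauss_tuple (tuple_section A x).
  rewrite -ge0_integralZl; last first.
  - by rewrite lee_fin gpdf_ge0.
  - by move=> t _; rewrite lee_fin gauss_tuple_pdf_ge0.
  - by apply: measurable_funTS; apply/measurable_EFinP; exact: measurable_gauss_tuple_pdf.
  - exact: measurable_tuple_section.
  rewrite [RHS]integral_mkcond; apply: eq_integral => t _.
  rewrite /f gauss_tuple_pdfS patchE indicE EFinM.
  have -> : (tuple_of_pair (x, t) \in A) = (t \in tuple_section A x).
    by apply/idP/idP; rewrite !inE.
  by case: ifPn => _; rewrite ?mule1// mule0.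
have mF : measurable_fun setT (fun x : R => (gpdf x)%:E * gauss_tuple (tuple_section A x)).
  under eq_fun do rewrite -fE.
  apply: (@measurable_fun_fubini_tonelli_F _ _ _ _ _ (lebesgue_tuple n) (f \o @tuple_of_pair R n)).
    exact: measurableT_comp mf (@measurable_tuple_of_pair R n).
  by move=> x; exact: f0.
have mG : measurable_fun setT (fun x : R => gauss_tuple (tuple_section A x)).
  rewrite (_ : (fun x => _) = (fun x : R => (gpdf x)^-1%:E *
      ((gpdf x)%:E * gauss_tuple (tuple_section A x)))); last first.
    by apply/funext => x; rewrite muleA -EFinM mulVf ?mul1e// gt_eqF// gpdf_gt0.
  apply: emeasurable_funM => //; apply/measurable_EFinP.
  apply: continuous_measurable_fun => x; apply: cvgV; last exact: continuous_gpdf.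
  by rewrite gt_eqF// gpdf_gt0.
split => //.
rewrite integral_gaussE//.
transitivity (\int[lebesgue_tuple n.+1]_x f x).
  rewrite /gauss_tuple /density_measure integral_mkcond; apply: eq_integral => x _.
  by rewrite patchE /f indicE; case: ifPn => _; rewrite ?mule1// mule0.
rewrite integral_lebesgue_tupleS//; apply: eq_integral => x _.
by rewrite fE muleC.
Qed.

Lemma gauss_tupleT n : @gauss_tuple n setT = 1.
Proof.
elim: n => [|n IHn].
  rewrite /gauss_tuple /density_measure /=.
  have -> : \int[lebesgue_tuple 0]_x (@gauss_tuple_pdf 0 x)%:E = \int[dirac ([tuple] : 0.-tuple R)]_x (@gauss_tuple_pdf 0 x)%:E.
    by apply: eq_measure_integral => A mA _.
  rewrite integral_dirac//; last by apply/measurable_EFinP; exact: measurable_gauss_tuple_pdf.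
  by rewrite diracT mul1e /gauss_tuple_pdf big_ord0.
have [-> _] := @gauss_tupleS n setT measurableT.
under eq_integral do rewrite [X in gauss_tuple X](_ : _ = setT)// IHn.
by rewrite integral_cst// mul1e; exact: probability_setT.
Qed.

HB.instance Definition _ n :=
  @Measure_isProbability.Build _ _ R (@gauss_tuple n) (gauss_tupleT n).

End gaussian_tuple.

Section euclidean_distance.
Context {R : realType}.
Implicit Types (n : nat) (e r : R).

Lemma cauchy_schwarz (I : finType) (a b : I -> R) :
  \sum_i a i * b i <= Num.sqrt (\sum_i a i ^+ 2) * Num.sqrt (\sum_i b i ^+ 2).
Proof.
set A := \sum_i a i ^+ 2; set B := \sum_i b i ^+ 2.
have A0 : 0 <= A by apply: sumr_ge0 => i _; exact: sqr_ge0.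
have B0 : 0 <= B by apply: sumr_ge0 => i _; exact: sqr_ge0.
have zero (u v : I -> R) : \sum_i u i ^+ 2 = 0 -> \sum_i u i * v i = 0.
  move=> u0; apply: big1 => i _; apply/eqP; rewrite mulf_eq0; apply/orP; left.
  have /eqP := u0; rewrite psumr_eq0 => [/allP/(_ i (mem_index_enum _))|j _]; last exact: sqr_ge0.
  by rewrite sqrf_eq0.
move: (A0); rewrite le_eqVlt => /predU1P[A00|Ap].
  by rewrite (zero _ _ (esym A00)) -A00 sqrtr0 mul0r.
move: (B0); rewrite le_eqVlt => /predU1P[B00|Bp].
  under eq_bigr do rewrite mulrC.
  by rewrite (zero _ _ (esym B00)) -B00 sqrtr0 mulr0.
set sA := Num.sqrt A; set sB := Num.sqrt B.
have sAp : 0 < sA by rewrite sqrtr_gt0.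
have sBp : 0 < sB by rewrite sqrtr_gt0.
have AE : A = sA ^+ 2 by rewrite sqr_sqrtr.
have BE : B = sB ^+ 2 by rewrite sqr_sqrtr.
apply: (@le_trans _ _ (\sum_i (a i ^+ 2 * (sB / sA / 2) + b i ^+ 2 * (sA / sB / 2)))).
  apply: ler_sum => i _; rewrite -subr_ge0.
  have -> : a i ^+ 2 * (sB / sA / 2) + b i ^+ 2 * (sA / sB / 2) - a i * b i =
     (a i * sB - b i * sA) ^+ 2 / (2 * sA * sB).
    by field; rewrite !gt_eqF.
  by rewrite divr_ge0 ?sqr_ge0// !mulr_ge0// ltW.
rewrite big_split/= -!mulr_suml -/A -/B AE BE le_eqVlt; apply/orP; left; apply/eqP.
by field; rewrite !gt_eqF.
Qed.

Lemma eucl_dist_ge0 n (x y : n.-tuple R) : 0 <= eucl_dist x y.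
Proof. exact: sqrtr_ge0. Qed.

Lemma eucl_distC n (x y : n.-tuple R) : eucl_dist x y = eucl_dist y x.
Proof. by congr Num.sqrt; apply: eq_bigr => i _; rewrite -sqrrN opprB. Qed.

Lemma eucl_distxx n (x : n.-tuple R) : eucl_dist x x = 0.
Proof.
by rewrite /eucl_dist big1 ?sqrtr0// => i _; rewrite subrr expr0n.
Qed.

Lemma eucl_dist_triangle n (x y z : n.-tuple R) :
  eucl_dist x z <= eucl_dist x y + eucl_dist y z.
Proof.
rewrite -ler_sqr ?nnegrE ?addr_ge0 ?eucl_dist_ge0// sqrrD.
rewrite !sqr_sqrtr; [|by apply: sumr_ge0 => i _; exact: sqr_ge0..].
have := cauchy_schwarz (fun i => tnth x i - tnth y i) (fun i => tnth y i - tnth z i).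
rewrite -/(eucl_dist x y) -/(eucl_dist y z) => cs.
apply: (@le_trans _ _ (\sum_i (tnth x i - tnth y i) ^+ 2 +
   (\sum_i (tnth x i - tnth y i) * (tnth y i - tnth z i)) *+ 2 +
   \sum_i (tnth y i - tnth z i) ^+ 2)).
  rewrite -sumrMnl -!big_split/= le_eqVlt; apply/orP; left; apply/eqP.
  by apply: eq_bigr => i _; ring.
by rewrite lerD2r lerD2l lerMn2r.
Qed.

Lemma measurable_eucl_dist n (y : n.-tuple R) :
  measurable_fun setT (fun x : n.-tuple R => eucl_dist x y).
Proof.
apply: measurableT_comp.
  by apply: continuous_measurable_fun; exact: sqrt_continuous.
apply: measurable_sum => i; apply: measurable_funX.
by apply: measurable_funB => //; exact: measurable_tnth.
Qed.

Lemma enlargementP d (T : measurableType d) (dist : T -> T -> R) (A : set T) e x :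
  enlargement dist A e x <-> exists2 a, A a & dist x a < e.
Proof.
split => [/ereal_inf_lt[_ [a Aa <-]]|[a Aa xa]].
  by rewrite lte_fin; exists a.
by apply: le_lt_trans (_ : (dist x a)%:E < _)%E; rewrite ?lte_fin//; apply: ereal_inf_lbound; exists a.
Qed.

Lemma rat_tuple_dense n (x : n.-tuple R) r : 0 < r ->
  exists q : n.-tuple rat, eucl_dist x [tuple ratr (tnth q i) | i < n] < r.
Proof.
move=> r0; pose h : R := r / n.+1%:R; have h0 : 0 < h by rewrite divr_gt0.
have hS : n%:R * h < r by rewrite /h mulrCA gtr_pMr// ltr_pdivrMr// mul1r ltr_nat.
clearbody h.
have ex i : exists q : rat, tnth x i - h < ratr q < tnth x i + h.
  have [q] := @rat_in_itvoo _ (tnth x i - h) (tnth x i + h) ltac:(by rewrite ltrBlDr -addrA ltrDl addr_gt0).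
  by rewrite in_itv/=; exists q.
pose q i := projT1 (cid (ex i)).
exists [tuple q i | i < n]; have le : eucl_dist x [tuple ratr (tnth [tuple q i | i < n] i) | i < n] <= n%:R * h.
  have nh0 : 0 <= n%:R * h by rewrite mulr_ge0// ltW.
  rewrite -[leRHS](ger0_norm nh0) -sqrtr_sqr; apply: ler_wsqrtr.
  apply: (@le_trans _ _ (\sum_(i < n) h ^+ 2)).
    apply: ler_sum => i _; rewrite !tnth_mktuple.
    have /andP[q1 q2] := projT2 (cid (ex i)); rewrite -/(q i) in q1 q2.
    rewrite -[X in X <= _]real_normK ?num_real// ler_sqr ?nnegrE ?(ltW h0)//.
    by rewrite ler_norml; apply/andP; split; lra.
  rewrite sumr_const card_ord exprMn -[X in X <= _]mulr_natl ler_wpM2r ?sqr_ge0//.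
  by case: (n) => [|m]; rewrite ?expr0n// ler_eXnr// ler1n.
exact: le_lt_trans hS.
Qed.

(** An enlargement is open, hence a union of balls that have rational centers and
    radii of the form [k.+1%:R^-1]. *)
Lemma measurable_enlargement n (A : set (n.-tuple R)) e :
  measurable (enlargement eucl_dist A e).
Proof.
set E := enlargement _ _ _.
pose ball_ (p : n.-tuple rat * nat) : set (n.-tuple R) :=
  [set x | eucl_dist x [tuple ratr (tnth p.1 i) | i < n] < p.2.+1%:R^-1].
pose F p := if `[< ball_ p `<=` E >] then ball_ p else set0.
have mB p : measurable (ball_ p).
  have := @measurable_eucl_dist n [tuple ratr (tnth p.1 i) | i < n] measurableT _
    (measurable_itv `]-oo, (p.2.+1%:R^-1 : R)[).
  rewrite setTI; congr measurable; apply/seteqP; split=> x /=; by rewrite in_itv.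
suff -> : E = \bigcup_p F p.
  apply: countable_bigcupT_measurable => // p; rewrite /F.
  by case: asboolP => // _; exact: mB.
apply/seteqP; split=> [x|x [p _]]; last by rewrite /F; case: asboolP => // h /h.
move=> /enlargementP[a Aa xa].
have [k kE] : exists k : nat, 2 * k.+1%:R^-1 < e - eucl_dist x a.
  have d0 : 0 < (e - eucl_dist x a) / 2 by rewrite divr_gt0// subr_gt0.
  exists (Num.bound ((e - eucl_dist x a) / 2)^-1).
  rewrite mulrC -ltr_pdivlMr// invf_plt ?posrE//.
  apply: lt_trans (archi_boundP _) _; first by rewrite invr_ge0 ltW.
  by rewrite ltr_nat.
have [q xq] := rat_tuple_dense x (r := k.+1%:R^-1) ltac:(by rewrite invr_gt0).
exists (q, k) => //; rewrite /F; case: asboolP => [_|]; first by rewrite /ball_/=.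
case=> z; rewrite /ball_/= => zq; apply/enlargementP; exists a => //.
apply: le_lt_trans (eucl_dist_triangle z x a) _.
apply: le_lt_trans (lerD (eucl_dist_triangle z [tuple ratr (tnth q i) | i < n] x) (lexx _)) _.
rewrite (eucl_distC _ x); move: kE xq zq; clear.
set b := k.+1%:R^-1; set u := eucl_dist _ _; set v := eucl_dist x _; set w := eucl_dist z _.
by rewrite -/v; lra.
Qed.

Lemma sub_enlargement n (A : set (n.-tuple R)) e : 0 < e -> A `<=` enlargement eucl_dist A e.
Proof. by move=> e0 x Ax; apply/enlargementP; exists x => //; rewrite eucl_distxx. Qed.

Lemma eucl_dist_pair n (x y : R) (s t : n.-tuple R) :
  eucl_dist (tuple_of_pair (x, s)) (tuple_of_pair (y, t)) ^+ 2 =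
  (x - y) ^+ 2 + eucl_dist s t ^+ 2.
Proof.
rewrite !sqr_sqrtr; [|by apply: sumr_ge0 => i _; exact: sqr_ge0..].
by rewrite big_ord_recl; congr (_ + _); apply: eq_bigr => i _; rewrite !tnthS.
Qed.

(** Pythagoras: a horizontal move by [x - y] leaves [sqrt (e ^+ 2 - (x - y) ^+ 2)]
    for the other coordinates. *)
Lemma tuple_section_enlargement n (A : set (n.+1.-tuple R)) e (x y : R) : `|x - y| < e ->
  enlargement eucl_dist (tuple_section A x) (Num.sqrt (e ^+ 2 - (x - y) ^+ 2)) `<=`
  tuple_section (enlargement eucl_dist A e) y.
Proof.
move=> xye t /enlargementP[s As ts]; apply/enlargementP.
exists (tuple_of_pair (x, s)) => //.
have e0 : 0 <= e by apply: le_trans (ltW xye).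
rewrite -ltr_sqr ?nnegrE ?eucl_dist_ge0// eucl_dist_pair.
have xy2 : 0 <= e ^+ 2 - (x - y) ^+ 2.
  by rewrite subr_ge0 -[X in X <= _]real_normK ?num_real// ler_sqr ?nnegrE// ltW.
have : eucl_dist t s ^+ 2 < Num.sqrt (e ^+ 2 - (x - y) ^+ 2) ^+ 2.
  by rewrite ltr_sqr// nnegrE ?sqrtr_ge0// eucl_dist_ge0.
by rewrite (sqr_sqrtr xy2) ltrBrDr addrC -[(x - y) ^+ 2]sqrrN opprB.
Qed.

End euclidean_distance.

Section gaussian_isoperimetry.
Context {R : realType}.
Local Notation gamma := (normal_prob (0 : R) 1).

(** Gaussian isoperimetric inequality, by induction on [n]: the induction hypothesis
    for the sections at [x] and [y] is the hypothesis of [functional_enlargement]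
    for the section functions of [A] and of its enlargement. *)
Theorem gauss_enlargement n (A : set (n.-tuple R)) (e c : R) : 0 < e -> measurable A ->
  ((gcdf c)%:E <= gauss_tuple A -> (gcdf (c + e))%:E <= gauss_tuple (enlargement eucl_dist A e))%E.
Proof.
move=> e0; elim: n => [|n IHn] in A e c e0 *.
  move=> mA cA; have [A0|[a Aa]] : A = set0 \/ A !=set0.
      by have [->|/set0P] := eqVneq A set0; [left|right].
    by move: cA; rewrite A0 measure0 lee_fin leNgt gcdf_gt0.
  rewrite (_ : enlargement _ _ _ = setT) ?gauss_tupleT ?lee_fin ?gcdf_le1//.
  by apply/seteqP; split=> // x _; apply: sub_enlargement => //; rewrite (tuple0 x) -(tuple0 a).
move=> mA.
have mE := measurable_enlargement A e.
have [-> mfA] := gauss_tupleS mA.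
have [-> mfE] := gauss_tupleS mE.
pose F (B : set (n.+1.-tuple R)) (x : R) : R := fine (gauss_tuple (tuple_section B x)).
have FE B x : measurable B -> gauss_tuple (tuple_section B x) = (F B x)%:E.
  by move=> mB; rewrite fineK// fin_num_measure//; exact: measurable_tuple_section.
have F01 B x : measurable B -> 0 <= F B x <= 1.
  move=> mB; rewrite -!lee_fin -FE// measure_ge0/=.
  by apply: probability_le1; exact: measurable_tuple_section.
have mF B : measurable_fun setT (fun x : R => gauss_tuple (tuple_section B x)) ->
    measurable_fun setT (F B).
  by move=> mB; apply: measurableT_comp => //; exact: measurable_fine.
have intE B : measurable B -> measurable_fun setT (fun x : R => gauss_tuple (tuple_section B x)) ->
    (\int[gamma]_x gauss_tuple (tuple_section B x) = (\int[gamma]_x F B x)%:E)%E.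
  move=> mB mfB; under eq_integral do rewrite (FE _ _ mB).
  rewrite /Rintegral fineK//; apply: integrable_fin_num => //.
  apply: (@integrable_gauss_bounded _ _ 1); first exact: mF.
  by move=> x; have /andP[f0 f1] := F01 B x mB; rewrite ger0_norm.
rewrite !intE// !lee_fin => cA.
apply: (functional_enlargement e0 (mF _ mfA) (mF _ mfE)) cA => [x|x|x y b xy bx].
- exact: F01.
- exact: F01.
have r0 : 0 < Num.sqrt (e ^+ 2 - (x - y) ^+ 2).
  by rewrite sqrtr_gt0 subr_gt0 -[X in X < _]real_normK ?num_real// ltr_sqr ?nnegrE// ltW.
rewrite -lee_fin -FE//; apply: (@le_trans _ _ (gauss_tuple (enlargement eucl_dist (tuple_section A x)
    (Num.sqrt (e ^+ 2 - (x - y) ^+ 2))))).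
  by apply: IHn => //; [exact: measurable_tuple_section|rewrite FE].
apply: le_measure; rewrite ?inE.
- exact: measurable_enlargement.
- exact: measurable_tuple_section.
- exact: tuple_section_enlargement.
Qed.

End gaussian_isoperimetry.

(** * Isoperimetric profiles of Lipschitz images *)

Section boundary_measure_bounds.
Context {R : realType}.
Local Notation gamma := (normal_prob (0 : R) 1).
Local Open Scope ereal_scope.

Lemma near_limf_einf_ge (f : R -> \bar R) (F : set_system R) (t : \bar R) :
  F [set e | t <= f e] -> t <= limf_einf f F.
Proof.
move=> Ft; rewrite limf_einfE.
apply: (@le_trans _ _ (ereal_inf (f @` [set e | t <= f e]))).
  by apply: le_ereal_inf_tmp => _ [e te <-].
by apply: ereal_sup_ubound; exists [set e | t <= f e].
Qed.

Lemma near_limf_einf_le (f : R -> \bar R) (F : set_system R) {FF : ProperFilter F} (t : \bar R) :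
  F [set e | f e <= t] -> limf_einf f F <= t.
Proof.
move=> Ft; rewrite limf_einfE; apply: ge_ereal_sup => _ [V FV <-].
have [e [Ve te]] := filter_ex (filterI FV Ft).
by apply: le_trans te; apply: ereal_inf_lbound; exists e.
Qed.

Section profile.
Context {d : measure_display} {T : measurableType d}.
Variables (dist : T -> T -> R) (mu : set T -> \bar R).

Lemma boundary_measure_ge (A : set T) (t : \bar R) :
  (\forall e \near (0%R : R)^'+, t <= (mu (enlargement dist A e) - mu A) * (e^-1)%:E) ->
  t <= boundary_measure dist mu A.
Proof. exact: near_limf_einf_ge. Qed.

Lemma boundary_measure_le (A : set T) (t : \bar R) :
  (\forall e \near (0%R : R)^'+, (mu (enlargement dist A e) - mu A) * (e^-1)%:E <= t) ->
  boundary_measure dist mu A <= t.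
Proof. by move=> h; apply: near_limf_einf_le. Qed.

End profile.

(** The derivative of [gcdf] with the explicit error [d], which suits lower limits
    along [0^'+]. *)
Lemma gcdf_slope (c L d : R) : (0 < L)%R -> (0 < d)%R ->
  \forall e \near (0%R : R)^'+,
    (gpdf c / L - d <= (gcdf (c + e / L) - gcdf c) / e <= gpdf c / L + d)%R.
Proof.
move=> L0 d0.
have /is_derive1_caratheodory[g [gE gC gcE]] := is_derive_gcdf c.
have [r /= r0 gr] : \forall z \near c, (`|g c - g z| < d * L)%R.
  by move/cvgrPdist_lt : gC; apply; rewrite mulr_gt0.
near=> e.
have e0 : (0 < e)%R by near: e; exact: nbhs_right_gt.
have eL : (e < r * L)%R by near: e; apply: nbhs_right_lt; rewrite mulr_gt0.
have h : (`|g c - g (c + e / L)| < d * L)%R.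
  apply: gr; rewrite /ball/= opprD addrA subrr add0r normrN ger0_norm ?ltr_pdivrMr//.
  by rewrite divr_ge0// ltW.
rewrite gE (addrC c) addrK.
have -> : (g (e / L + c) * (e / L) / e = g (c + e / L) / L)%R.
  by rewrite addrC; field; rewrite !gt_eqF.
move: h; rewrite gcE ltr_distl => /andP[h1 h2].
move: (g (c + e / L)%R) (gpdf c) h1 h2 => y u h1 h2.
by rewrite lerBlDr -lerBlDr -(ler_pM2r L0) -[X in _ && X](ler_pM2r L0) !mulrBl !mulfVK ?gt_eqF// ?mulrDl ?mulfVK ?gt_eqF//; clear -h1 h2; lra.
Unshelve. all: end_near. Qed.

(** The enlargement of the half-line up to [c] is the open half-line up to [c + e]. *)
Lemma halfline_boundary_measure (c : R) :
  boundary_measure (fun x y : R => `|x - y|%R) gamma `]-oo, c]%classic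
  <= (gpdf c)%:E.
Proof.
apply/lee_addgt0Pr => d d0; apply: boundary_measure_le.
near=> e.
have e0 : (0 < e)%R by near: e; exact: nbhs_right_gt.
have /andP[_] : (gpdf c / 1 - d <= (gcdf (c + e / 1) - gcdf c) / e <= gpdf c / 1 + d)%R.
  by near: e; exact: gcdf_slope.
rewrite !divr1 => h.
have -> : enlargement (fun x y : R => `|x - y|%R) `]-oo, c]%classic e
           = `]-oo, (c + e)%R[%classic.
  apply/seteqP; split=> x.
    move=> /enlargementP[a /=]; rewrite !in_itv/= => ac; rewrite ltr_distl => /andP[_ xa].
    by rewrite (lt_le_trans xa)// lerD2r.
  rewrite /= in_itv/= => xce; apply/enlargementP.
  have [xc|cx] := leP x c; first by exists x; rewrite ?subrr ?normr0//= in_itv.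
  by exists c; rewrite /= ?in_itv//= ger0_norm ?subr_ge0 ?ltrBlDl// ltW.
have le : gamma `]-oo, (c + e)%R[%classic <= (gcdf (c + e))%:E.
  rewrite -gcdfEFin; apply: le_measure; rewrite ?inE//; apply: subset_itvl.
  by rewrite bnd_simp.
move: (leeB le (lexx (gcdf c)%:E)) => {}le; rewrite gcdfEFin.
rewrite (le_trans (lee_wpmul2r _ le)) ?lee_fin ?invr_ge0 ?(ltW e0)//.
Unshelve. all: end_near. Qed.

Lemma gauss_profile_le (c : R) :
  isoperimetric_profile (fun x y : R => `|x - y|%R) gamma (gcdf c) <= (gpdf c)%:E.
Proof.
apply: le_trans (halfline_boundary_measure c); apply: ereal_inf_lbound.
by exists `]-oo, c]%classic => //; split => //; exact: gcdfEFin.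
Qed.

Lemma gauss_profile0 :
  isoperimetric_profile (fun x y : R => `|x - y|%R) gamma 0 <= 0.
Proof.
apply: (@le_trans _ _ (boundary_measure (fun x y : R => `|x - y|%R) gamma set0)).
  by apply: ereal_inf_lbound; exists set0 => //; split; rewrite ?measure0.
apply: boundary_measure_le; apply: nearW => e.
suff -> : enlargement (fun x y : R => `|x - y|%R) set0 e = set0 by rewrite !measure0 sub0e oppe0 mul0e.
by apply/seteqP; split => x // /enlargementP[].
Qed.

Lemma gauss_profile1 :
  isoperimetric_profile (fun x y : R => `|x - y|%R) gamma 1 <= 0.
Proof.
apply: (@le_trans _ _ (boundary_measure (fun x y : R => `|x - y|%R) gamma setT)).
  by apply: ereal_inf_lbound; exists setT => //; split => //; rewrite probability_setT.
apply: boundary_measure_le; near=> e.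
suff -> : enlargement (fun x y : R => `|x - y|%R) setT e = setT.
  by rewrite !probability_setT subee// mul0e.
apply/seteqP; split => x // _; apply/enlargementP; exists x => //.
by rewrite subrr normr0; near: e; exact: nbhs_right_gt.
Unshelve. all: end_near. Qed.

Section lipschitz_image.
Variables (n : nat) (S : n.-tuple R -> n.-tuple R) (L : R).
Hypotheses (mS : measurable_fun setT S) (SL : lipschitz_bound S L).
Variable mu : set (n.-tuple R) -> \bar R.
Hypothesis muE : forall A, measurable A -> mu A = gauss_tuple (S @^-1` A).

Let mpre A : measurable A -> measurable (S @^-1` A).
Proof. by move=> mA; rewrite -[X in measurable X]setTI; exact: mS. Qed.

Lemma preimage_enlargement A (e : R) : (0 < L)%R ->
  enlargement eucl_dist (S @^-1` A) (e / L) `<=` S @^-1` (enlargement eucl_dist A e).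
Proof.
move=> L0 x /enlargementP[a Aa xa]; apply/enlargementP; exists (S a) => //.
by rewrite (le_lt_trans (SL.2 x a))// mulrC -ltr_pdivlMr.
Qed.

Lemma image_profile_ge0 a : 0 <= isoperimetric_profile eucl_dist mu a.
Proof.
apply: le_ereal_inf_tmp => _ [A [mA muA] <-]; apply: boundary_measure_ge.
near=> e; have e0 : (0 < e)%R by near: e; exact: nbhs_right_gt.
have mAe := measurable_enlargement A e.
rewrite mule_ge0 ?lee_fin ?invr_ge0 ?(ltW e0)// sube_ge0; last by rewrite muA.
rewrite !muE//; apply: le_measure; rewrite ?inE; [exact: mpre|exact: mpre|].
by apply: preimage_subset; exact: sub_enlargement.
Unshelve. all: end_near. Qed.

(** For [0 < a < 1], both sides are compared with [gpdf c / L] where [gcdf c = a].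
    For [a = 0] and [a = 1] the Gaussian profile vanishes, by the empty and the
    full set, and for [L = 0] the factor [L^-1] is 0. *)
Theorem lipschitz_image_profile a : (0 <= a <= 1)%R ->
  (L^-1)%:E * isoperimetric_profile (fun x y : R => `|x - y|%R) gamma a
  <= isoperimetric_profile eucl_dist mu a.
Proof.
move=> /andP[a0 a1]; have := SL.1; rewrite le_eqVlt => /predU1P[<-|L0].
  by rewrite invr0 mul0e image_profile_ge0.
have L'0 : 0%E <= (L^-1)%:E by rewrite lee_fin invr_ge0 ltW.
move: a0; rewrite le_eqVlt => /predU1P[<-|a0].
  by rewrite (le_trans _ (image_profile_ge0 _))// mule_ge0_le0// gauss_profile0.
move: a1; rewrite le_eqVlt => /predU1P[->|a1].
  by rewrite (le_trans _ (image_profile_ge0 _))// mule_ge0_le0// gauss_profile1.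
have [c ca] : exists c, gcdf c = a by apply: gcdf_surj; rewrite a0.
rewrite -ca (le_trans (lee_wpmul2l L'0 (gauss_profile_le c)))// ca.
apply: le_ereal_inf_tmp => _ [A [mA muA] <-].
apply/lee_subgt0Pr => d d0; apply: boundary_measure_ge.
near=> e; have e0 : (0 < e)%R by near: e; exact: nbhs_right_gt.
have mAe := measurable_enlargement A e.
have /andP[h _] : (gpdf c / L - d <= (gcdf (c + e / L) - gcdf c) / e <= gpdf c / L + d)%R.
  by near: e; exact: gcdf_slope.
have : (gcdf (c + e / L))%:E <= mu (enlargement eucl_dist A e).
  rewrite muE//; apply: (@le_trans _ _ (gauss_tuple (enlargement eucl_dist (S @^-1` A) (e / L)))).
    apply: gauss_enlargement; [by rewrite divr_gt0|exact: mpre|].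
    by rewrite -muE// muA ca.
  apply: le_measure; rewrite ?inE; [|exact: mpre|exact: preimage_enlargement].
  exact: measurable_enlargement.
move=> /leeB /(_ (lexx a%:E)) le; rewrite muA.
rewrite (le_trans _ (lee_wpmul2r _ le)) ?lee_fin ?invr_ge0 ?(ltW e0)//.
by rewrite mulrC -ca.
Unshelve. all: end_near. Qed.

End lipschitz_image.

End boundary_measure_bounds.

(** * Integration in polar coordinates *)

Section scaling.
Context {R : realType}.
Local Notation mu := (@lebesgue_measure R).
Implicit Types (n : nat) (t : R).
Local Open Scope ereal_scope.

Lemma integral_lebesgue_scale t (g : R -> \bar R) : (0 < t)%R ->
  measurable_fun setT g -> (forall x, 0 <= g x) ->
  \int[mu]_x g x = t%:E * \int[mu]_x g (t * x)%R.
Proof.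
move=> t0 mg g0.
have mt : measurable_fun setT (fun x : measurableTypeR R => (t * x)%R : measurableTypeR R).
  exact: measurable_funM.
pose m1 : {measure set (measurableTypeR R) -> \bar R} :=
  measure_function_pushforward__canonical__measure_function_Measure mu mt.
pose tn := NngNum (ltW t0).
pose m2 : {measure set (measurableTypeR R) -> \bar R} := mscale tn m1.
transitivity (\int[m2]_x g x).
  apply: eq_measure_integral => A mA _; apply: lebesgue_measure_unique => // X.
  move=> [[a b] /= ab <-].
  rewrite /m2 /mscale/= /pushforward.
  have -> : (fun x : R => (t * x)%R) @^-1` `]a, b]%classic = `](a / t)%R, (b / t)%R]%classic.
    apply/seteqP; split=> x /=; rewrite !in_itv/= ltr_pdivrMr// ler_pdivlMr//.
      by rewrite ![(x * t)%R]mulrC.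
    by rewrite ![(x * t)%R]mulrC.
  rewrite !lebesgue_measure_itv/= !lte_fin ltr_pM2r ?invr_gt0//.
  case: ifPn => _; last by rewrite mule0.
  by rewrite -!EFinD -EFinM; congr EFin; field; rewrite gt_eqF.
rewrite ge0_integral_mscale//; congr (_ * _).
by rewrite ge0_integral_pushforward.
Qed.

Definition scale_tuple n t (x : n.-tuple R) : n.-tuple R :=
  [tuple (t * tnth x i)%R | i < n].

Lemma measurable_scale_tuple n t : measurable_fun setT (@scale_tuple n t).
Proof.
apply/measurable_fun_tnthP => i.
rewrite (_ : _ \o _ = fun x => (t * tnth x i)%R); last first.
  by apply/funext => x /=; rewrite tnth_mktuple.
by apply: measurable_funM => //; exact: measurable_tnth.
Qed.

Lemma scale_tuple_of_pair n t (x : R) (s : n.-tuple R) :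
  scale_tuple t (tuple_of_pair (x, s)) = tuple_of_pair ((t * x)%R, scale_tuple t s).
Proof.
apply: eq_from_tnth => i; rewrite tnth_mktuple.
by case: (unliftP ord0 i) => [j|] ->; rewrite ?tnth0 ?tnthS ?tnth_mktuple.
Qed.

Lemma measurable_integral_tupleS n (f : n.+1.-tuple R -> \bar R) :
  measurable_fun setT f -> (forall x, 0 <= f x) ->
  measurable_fun setT (fun x : R => \int[lebesgue_tuple n]_t f (tuple_of_pair (x, t))).
Proof.
move=> mf f0.
apply: (@measurable_fun_fubini_tonelli_F _ _ _ _ _ (lebesgue_tuple n) (f \o @tuple_of_pair R n)).
  exact: measurableT_comp mf (@measurable_tuple_of_pair R n).
by move=> x; exact: f0.
Qed.

(** Fubini and the scaling of the Lebesgue measure of the line. *)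
Lemma integral_lebesgue_tuple_scale n t (f : n.-tuple R -> \bar R) : (0 < t)%R ->
  measurable_fun setT f -> (forall x, 0 <= f x) ->
  \int[lebesgue_tuple n]_x f x =
  (t ^+ n)%:E * \int[lebesgue_tuple n]_x f (scale_tuple t x).
Proof.
move=> t0; elim: n f => [f _ _|n IHn f mf f0].
  rewrite expr0 mul1e; apply: eq_integral => x _; congr f.
  by rewrite (tuple0 x); apply: eq_from_tnth => -[].
have mft : measurable_fun setT (f \o scale_tuple t).
  exact: measurableT_comp mf (measurable_scale_tuple _).
pose F (x : R) := \int[lebesgue_tuple n]_s f (tuple_of_pair (x, s)).
pose G (x : R) := \int[lebesgue_tuple n]_s f (scale_tuple t (tuple_of_pair (x, s))).
have mF : measurable_fun setT F by exact: measurable_integral_tupleS.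
have mG : measurable_fun setT G by exact: (measurable_integral_tupleS mft (fun x => f0 _)).
have F0 x : 0 <= F x by exact: integral_ge0.
have G0 x : 0 <= G x by exact: integral_ge0.
have FG x : F (t * x)%R = (t ^+ n)%:E * G x.
  rewrite /F IHn//.
    by congr (_ * _); apply: eq_integral => s _; rewrite scale_tuple_of_pair.
  apply: measurableT_comp mf _; apply: measurableT_comp; first exact: measurable_tuple_of_pair.
  exact: measurable_fun_pair.
have -> := integral_lebesgue_tupleS mf f0.
have -> := integral_lebesgue_tupleS mft (fun x => f0 _).
rewrite -/F -[X in _ = _ * X]/(\int[mu]_x G x) (integral_lebesgue_scale t0 mF F0).
rewrite exprS EFinM -muleA; congr (_ * _).
under eq_integral do rewrite FG.
by rewrite ge0_integralZl// lee_fin exprn_ge0// ltW.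
Qed.

Lemma lebesgue_tuple_scale n t (A : set (n.-tuple R)) : (0 < t)%R -> measurable A ->
  lebesgue_tuple n A = (t ^+ n)%:E * lebesgue_tuple n (scale_tuple t @^-1` A).
Proof.
move=> t0 mA.
have mtA : measurable (scale_tuple t @^-1` A).
  by rewrite -[X in measurable X]setTI; exact: measurable_scale_tuple.
rewrite -[in LHS](setIT A) -integral_indic// (integral_lebesgue_tuple_scale t0)//; last first.
  by apply/measurable_EFinP.
by rewrite -[in RHS](setIT (_ @^-1` _)) -integral_indic.
Qed.

Definition tuple_cube n : set (n.-tuple R) := [set x | forall i, `|tnth x i| <= 1]%R.

Lemma measurable_tuple_cube n : measurable (@tuple_cube n).
Proof.
have -> : @tuple_cube n = \bigcap_(i in [set: 'I_n]) [set x | `|tnth x i| <= 1]%R.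
  by apply/seteqP; split=> [x h i _|x h i]; exact: h.
apply: fin_bigcap_measurable => // i _; rewrite -[X in measurable X]setTI.
have mi : measurable_fun setT (fun x : n.-tuple R => `|tnth x i|%R).
  by apply: measurableT_comp => //; exact: measurable_tnth.
have -> : [set x : n.-tuple R | `|tnth x i| <= 1]%R = (fun x : n.-tuple R => `|tnth x i|%R) @^-1` `]-oo, 1%R]%classic.
  by apply/seteqP; split=> x /=; rewrite in_itv.
exact: mi.
Qed.

Lemma lebesgue_tuple_cube_lty n : lebesgue_tuple n (@tuple_cube n) < +oo.
Proof.
elim: n => [|n IHn]; first by rewrite /= diracE ltry.
rewrite -[X in lebesgue_tuple _ X]setIT -integral_indic//; last exact: measurable_tuple_cube.
rewrite integral_lebesgue_tupleS//; last first.
  by apply/measurable_EFinP; apply: measurable_indic; exact: measurable_tuple_cube.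
rewrite (_ : \int[mu]_x _ = \int[mu]_(x in `[(-1)%R, 1%R]) (cst (lebesgue_tuple n (@tuple_cube n)) x)).
  rewrite integral_cst//= lebesgue_measure_itv/= lte_fin.
  by rewrite lte_mul_pinfty// ?ge0_fin_numE//; case: ifP => _; rewrite -?EFinD ltry.
rewrite [RHS]integral_mkcond; apply: eq_integral => x _; rewrite patchE.
case: (boolP (x \in `[(-1)%R, 1%R]%classic)); rewrite ?notin_setE ?inE/= in_itv/= -ler_norml => x1.
  rewrite -[in RHS](setIT (@tuple_cube n)) -integral_indic//; last exact: measurable_tuple_cube.
  apply: eq_integral => t _; rewrite !indicE; congr (_%:R%:E); congr nat_of_bool.
  apply/idP/idP; rewrite !inE => h i; first by have := h (lift ord0 i); rewrite tnthS.
  by case: (unliftP ord0 i) => [j|] ->; rewrite ?tnth0 ?tnthS.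
apply: integral0_eq => t _; rewrite indicE memNset// => /(_ ord0); rewrite tnth0.
exact: x1.
Qed.

End scaling.

Section polar.
Context {R : realType}.
Local Notation mu := (@lebesgue_measure R).
Implicit Types (n : nat) (t : R).

Definition direction n (x : n.-tuple R) : n.-tuple R :=
  [tuple tnth x i / eucl_norm x | i < n].

Lemma eucl_norm_ge0 n (x : n.-tuple R) : 0 <= eucl_norm x.
Proof. exact: sqrtr_ge0. Qed.

Lemma measurable_eucl_norm n : measurable_fun setT (@eucl_norm R n).
Proof.
rewrite (_ : @eucl_norm R n = @eucl_dist R n ^~ [tuple 0 | _ < n]).
  exact: measurable_eucl_dist.
apply/funext => x; rewrite /eucl_norm /eucl_dist; congr Num.sqrt.
by apply: eq_bigr => i _; rewrite tnth_mktuple subr0.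
Qed.

(** Inversion has the value 0 at its discontinuity 0, like the measurable power
    function [_ `^ -1], with which it agrees on nonnegative numbers. *)
Lemma measurable_inv : measurable_fun setT (fun x : R => x^-1).
Proof.
have -> : (fun x : R => x^-1) = fun x => x * ((x ^+ 2) `^ (-1)).
  apply/funext => x; rewrite powR_inv1 ?sqr_ge0//.
  have [->|x0] := eqVneq x 0; first by rewrite invr0 mul0r.
  by field.
apply: measurable_funM => //.
apply: (@measurableT_comp _ _ _ _ _ _ (@powR R ^~ (-1))); first exact: measurable_powR.
exact: measurable_funX.
Qed.

Lemma measurable_direction n : measurable_fun setT (@direction n).
Proof.
apply/measurable_fun_tnthP => i.
rewrite (_ : _ \o _ = fun x => tnth x i / eucl_norm x); last first.
  by apply/funext => x /=; rewrite tnth_mktuple.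
apply: measurable_funM; first exact: measurable_tnth.
exact: measurableT_comp measurable_inv (@measurable_eucl_norm n).
Qed.

(** Uniqueness on the pi-system of closed half-lines; the total masses may be
    infinite. *)
Lemma measure_halfline_unique (m1 m2 : {measure set (measurableTypeR R) -> \bar R}) :
  (forall t : R, m1 `]-oo, t]%classic = m2 `]-oo, t]%classic) ->
  (forall t : R, (m1 `]-oo, t]%classic < +oo)%E) ->
  forall A, measurable A -> m1 A = m2 A.
Proof.
move=> m12 m1oo A mA.
pose G := [set B : set (measurableTypeR R) | exists t : R, B = `]-oo, t]%classic].
apply: (measure_unique G (fun k => `]-oo, k%:R]%classic)) => //.
- rewrite [LHS](RGenOInfty.measurableE R); apply/seteqP; split.
    apply: smallest_sub; first exact: smallest_sigma_algebra.
    move=> _ [x ->]; rewrite -setCitvl.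
    have [_ GC _] := smallest_sigma_algebra setT G.
    by rewrite -setTD; apply: GC; apply: sub_sigma_algebra; exists x.
  apply: smallest_sub; first exact: smallest_sigma_algebra.
  move=> _ [x ->]; rewrite -setCitvr.
  have [_ GC _] := smallest_sigma_algebra setT (@RGenOInfty.G R).
  by rewrite -setTD; apply: GC; apply: sub_sigma_algebra; exists x.
- move=> _ _ [x ->] [y ->]; exists (Num.min x y).
  by apply/seteqP; split=> z /=; rewrite !in_itv/= le_min => /andP.
- by move=> i; exists i%:R.
- apply/seteqP; split=> // x _; exists (Num.truncn `|x|).+1 => //=.
  by rewrite in_itv/= (le_trans (ler_norm x))// ltW// truncnS_gt.
- by move=> _ [t ->].
Qed.

Lemma integral_itv0_exprn (n : nat) t : 0 <= t ->
  (\int[mu]_(r in `[0%R, t]) (r ^+ n)%:E = (t ^+ n.+1 / n.+1%:R)%:E)%E.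
Proof.
rewrite le_eqVlt => /predU1P[<-|t0].
  by rewrite set_itv1 integral_set1 expr0n mul0r.
pose F : R -> R := (n.+1%:R)^-1 \*: ((@id R) ^+ n.+1).
have FE r : F r = (n.+1%:R)^-1 * r ^+ n.+1 by rewrite /F/= fctE.
have dF (r : R) : is_derive r 1 F (r ^+ n).
  rewrite /F; apply: is_derive_eq.
  by rewrite /GRing.scale/= mulr1 mulrA mulVf ?mul1r// pnatr_eq0.
have cF (r : R) : {for r, continuous F}.
  by apply: differentiable_continuous; apply/derivable1_diffP; have [] := dF r.
rewrite (@continuous_FTC2 R (fun r => r ^+ n) F)//.
- by rewrite !FE expr0n/= mulr0 sube0 mulrC.
- by apply: continuous_subspaceT => r; exact: exprn_continuous.
- split => [r _||]; first by have [] := dF r.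
    by apply: cvg_at_right_filter; exact: cF.
  by apply: cvg_at_left_filter; exact: cF.
- by move=> r _; rewrite derive1E; have [_ ->] := dF r.
Qed.

(** A rectangle in polar coordinates, without the origin, which has no direction. *)
Definition sector n (E : set (n.-tuple R)) (B : set R) : set (n.-tuple R) :=
  [set x | [/\ 0 < eucl_norm x, E (direction x) & B (eucl_norm x)]].

Lemma measurable_sector n (E : set (n.-tuple R)) (B : set R) :
  measurable E -> measurable B -> measurable (sector E B).
Proof.
move=> mE mB.
have -> : sector E B = (@eucl_norm R n @^-1` `]0, +oo[ `&` @direction n @^-1` E)
    `&` @eucl_norm R n @^-1` B.
  apply/seteqP; split=> x /=; rewrite in_itv/= andbT; first by move=> [].
  by move=> [[]].
by apply: measurableI; [apply: measurableI|]; rewrite -[X in measurable X]setTI;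
  [exact: measurable_eucl_norm|exact: measurable_direction|exact: measurable_eucl_norm].
Qed.

Lemma eucl_norm_scale n t (x : n.-tuple R) : 0 < t ->
  eucl_norm (scale_tuple t x) = t * eucl_norm x.
Proof.
move=> t0; rewrite /eucl_norm; under eq_bigr do rewrite tnth_mktuple exprMn.
by rewrite -mulr_sumr sqrtrM ?sqr_ge0// sqrtr_sqr gtr0_norm.
Qed.

Lemma direction_scale n t (x : n.-tuple R) : 0 < t ->
  direction (scale_tuple t x) = direction x.
Proof.
move=> t0; apply: eq_from_tnth => i.
by rewrite !tnth_mktuple eucl_norm_scale// -mulf_div divff ?gt_eqF// mul1r.
Qed.

Lemma sphere_measureE n (E : set (n.-tuple R)) :
  sphere_measure E = (n%:R%:E * lebesgue_tuple n (sector E `]-oo, 1%R]%classic))%E.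
Proof.
rewrite /sphere_measure; congr (_ * lebesgue_tuple n _)%E.
apply/seteqP; split=> x; rewrite /sector/= in_itv/=; first by move=> [/andP[]].
by move=> [-> ? ->].
Qed.

Lemma lebesgue_sector_lty n (E : set (n.-tuple R)) : measurable E ->
  (lebesgue_tuple n (sector E `]-oo, 1%R]%classic) < +oo)%E.
Proof.
move=> mE; apply: le_lt_trans (@lebesgue_tuple_cube_lty R n).
apply: le_measure; rewrite ?inE; [exact: measurable_sector|exact: measurable_tuple_cube|].
move=> x [_ _]; rewrite /= in_itv/= => x1 i; apply: le_trans x1.
rewrite -sqrtr_sqr ler_wsqrtr// (bigD1 i)//= lerDl; apply: sumr_ge0 => j _.
exact: sqr_ge0.
Qed.

Lemma sphere_measure_fin n (E : set (n.-tuple R)) : measurable E ->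
  sphere_measure E \is a fin_num.
Proof.
move=> mE; rewrite sphere_measureE fin_numM// ge0_fin_numE//.
exact: lebesgue_sector_lty.
Qed.

Lemma sphere_measure_ge0 n (E : set (n.-tuple R)) : (0 <= sphere_measure E)%E.
Proof. by rewrite sphere_measureE mule_ge0// lee_fin. Qed.

(** Homogeneity: a truncated cone is a scaled copy of the one of [sphere_measure]. *)
Lemma lebesgue_sector_halfline n (E : set (n.-tuple R)) t : (0 < n)%N -> 0 < t ->
  measurable E ->
  lebesgue_tuple n (sector E `]-oo, t]%classic) =
  (fine (sphere_measure E) * (t ^+ n / n%:R))%:E.
Proof.
move=> n0 t0 mE; rewrite (@lebesgue_tuple_scale _ _ t)//; last exact: measurable_sector.
have -> : scale_tuple t @^-1` (sector E `]-oo, t]%classic) = sector E `]-oo, 1%R]%classic.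
  apply/seteqP; split=> x; rewrite /sector/= direction_scale// eucl_norm_scale// !in_itv/=.
    by rewrite pmulr_rgt0// ger_pMr.
  by rewrite pmulr_rgt0// ger_pMr.
rewrite sphere_measureE fineM//=; last first.
  by rewrite ge0_fin_numE// lebesgue_sector_lty.
rewrite -[X in (_ * X)%E]fineK ?ge0_fin_numE ?lebesgue_sector_lty//.
rewrite -EFinM; congr EFin; move: (fine _) => c.
by field; rewrite pnatr_eq0 -lt0n.
Qed.

(** The factor [\1_(]0, +oo[)] makes the density nonnegative on the whole line. *)
Definition radial_pdf (c : R) (k : nat) (r : R) : R := c * r ^+ k * \1_(`]0, +oo[) r.

Lemma radial_pdf_ge0 c k r : 0 <= c -> 0 <= radial_pdf c k r.
Proof.
move=> c0; rewrite /radial_pdf indicE.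
have [|] := boolP (_ \in _); rewrite ?mulr0// inE/= in_itv/= andbT => r0.
by rewrite !mulr_ge0// exprn_ge0// ltW.
Qed.

Lemma measurable_radial_pdf c k : measurable_fun setT (radial_pdf c k).
Proof.
apply: measurable_funM; last exact: measurable_indic.
by apply: measurable_funM => //; exact: measurable_funX.
Qed.

Lemma integral_radial_pdf c k (g : R -> \bar R) (B : set R) : 0 <= c -> measurable B ->
  measurable_fun setT g -> (forall r, 0 <= g r)%E ->
  (\int[mu]_(r in B) (g r * (radial_pdf c k r)%:E) =
   c%:E * \int[mu]_(r in B `&` `]0%R, +oo[) (g r * (r ^+ k)%:E))%E.
Proof.
move=> c0 mB mg g0.
have gk0 r : ((B `&` `]0%R, +oo[) r -> 0 <= g r * (r ^+ k)%:E)%E.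
  by move=> [_ /=]; rewrite in_itv/= andbT => r0; rewrite mule_ge0// lee_fin exprn_ge0// ltW.
rewrite -ge0_integralZl//; last first.
- apply: emeasurable_funM; first exact: measurable_funTS.
  by apply/measurable_EFinP/measurable_funTS; exact: measurable_funX.
- exact: measurableI.
rewrite [RHS]integral_mkcondr; apply: eq_integral => r _; rewrite patchE /radial_pdf indicE.
by case: ifPn => _; rewrite ?mulr1 ?mulr0 ?mule0// EFinM muleCA.
Qed.

Section fixed_directions.
Variables (n : nat) (E : set (n.-tuple R)).
Hypotheses (n_gt0 : (0 < n)%N) (mE : measurable E).
Let c := fine (sphere_measure E).

Let c_ge0 : 0 <= c. Proof. by rewrite fine_ge0// sphere_measure_ge0. Qed.

Let C := sector E setT.
Let mC : measurable C. Proof. exact: measurable_sector. Qed.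
Let C_ge0 x : 0 <= \1_C x :> R. Proof. by []. Qed.
Let mIC : measurable_fun setT (\1_C : n.-tuple R -> R). Proof. exact: measurable_indic. Qed.
Let lam : {measure set (n.-tuple R) -> \bar R} := density_measure (lebesgue_tuple n) C_ge0 mIC.
Let mnorm : measurable_fun setT (@eucl_norm R n : n.-tuple R -> measurableTypeR R).
Proof. exact: measurable_eucl_norm. Qed.
Let m1 : {measure set (measurableTypeR R) -> \bar R} :=
  measure_function_pushforward__canonical__measure_function_Measure lam mnorm.
Let m2 : {measure set (measurableTypeR R) -> \bar R} :=
  density_measure mu (fun r => @radial_pdf_ge0 c n.-1 r c_ge0) (measurable_radial_pdf c n.-1).

Let mpre (B : set R) : measurable B -> measurable (@eucl_norm R n @^-1` B).
Proof. by move=> mB; rewrite -[X in measurable X]setTI; exact: measurable_eucl_norm. Qed.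

Let sectorIC B : sector E B = @eucl_norm R n @^-1` B `&` C.
Proof. by apply/seteqP; split=> [x [? ? ?]|x [? []]]. Qed.

Let lebesgue_sectorE (B : set R) : measurable B -> m1 B = m2 B.
Proof.
have m1E A : measurable A -> m1 A = lebesgue_tuple n (sector E A).
  move=> mA; rewrite /m1/= /pushforward /density_measure integral_indic//; last exact: mpre.
  by congr (lebesgue_tuple n _); rewrite setIC sectorIC.
move=> mB; apply: measure_halfline_unique => // t; rewrite m1E//; last first.
  have [t0|t0] := ltP 0 t; first by rewrite lebesgue_sector_halfline// ltry.
  rewrite (_ : sector E _ = set0) ?measure0//.
  apply/seteqP; split => // x [x0 _]; rewrite /= in_itv/= => xt.
  by move: (lt_le_trans x0 (le_trans xt t0)); rewrite ltxx.
have [t0|t0] := ltP 0 t; last first.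
  rewrite (_ : sector E _ = set0); last first.
    apply/seteqP; split => // x [x0 _]; rewrite /= in_itv/= => xt.
    by move: (lt_le_trans x0 (le_trans xt t0)); rewrite ltxx.
  rewrite measure0; apply/esym; apply: integral0_eq => r; rewrite /= in_itv/= => rt.
  rewrite /radial_pdf indicE memNset ?mulr0//= in_itv/= andbT.
  by apply/negP; rewrite -leNgt (le_trans rt).
rewrite lebesgue_sector_halfline//.
rewrite /= /density_measure.
under [RHS]eq_integral do rewrite -[X in X%:E]mul1r EFinM.
rewrite (@integral_radial_pdf _ _ (cst 1%E))//.
have -> : `]-oo, t]%classic `&` `]0, +oo[%classic = `]0, t]%classic.
  by apply/seteqP; split=> r /=; rewrite !in_itv/= andbT andbC => /andP.
under eq_integral do rewrite mul1e.
rewrite integral_itv_obnd_cbnd; last first.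
  by apply/measurable_EFinP/measurable_funTS; exact: measurable_funX.
by rewrite integral_itv0_exprn ?(ltW t0)// prednK// EFinM.
Qed.

(** For fixed directions [E], the image of the Lebesgue measure on the cone over [E]
    under the norm has the density [sphere_measure E * r ^+ n.-1], as both
    measures agree on half-lines. *)
Lemma polar_integral (g : R -> \bar R) (B : set R) : measurable B ->
  measurable_fun setT g -> (forall r, 0 <= g r)%E ->
  (\int[lebesgue_tuple n]_(x in sector E B) g (eucl_norm x) =
   sphere_measure E * \int[mu]_(r in B `&` `]0%R, +oo[) (g r * (r ^+ n.-1)%:E))%E.
Proof.
move=> mB mg g0.
rewrite -[sphere_measure E]fineK ?sphere_measure_fin// -integral_radial_pdf//.
transitivity (\int[m2]_(r in B) g r)%E; last first.
  by rewrite /m2 integral_density//; exact: measurable_funTS.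
transitivity (\int[m1]_(r in B) g r)%E; last first.
  by apply: eq_measure_integral => A mA _; exact: lebesgue_sectorE.
rewrite ge0_integral_pushforward//; last exact: measurable_funTS.
rewrite integral_density; [|exact: mpre| |by move=> x _; exact: g0]; last first.
  by apply: measurable_funTS; apply: measurableT_comp mg _; exact: measurable_eucl_norm.
rewrite sectorIC integral_mkcondr; apply: eq_integral => x _.
by rewrite patchE/= indicE; case: ifPn; rewrite ?mule1 ?mule0.
Qed.

End fixed_directions.

End polar.

(** * Substitution along an increasing function with critical points *)

Lemma measurable_positive_extension {R : realType} (g : R -> R) :
  measurable_fun (`]0, +oo[ : set R) g ->
  measurable_fun setT (fun r : R => if 0 < r then g r else 0).
Proof.
move=> mg; apply: measurable_fun_if => //; first exact: measurable_fun_ltr.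
rewrite setTI (_ : _ @^-1` _ = `]0, +oo[%classic)//.
by apply/seteqP; split=> x /=; rewrite in_itv/= andbT.
Qed.

Lemma continuous_measurable_positive {R : realType} (g : R -> R) :
  (forall r : R, 0 < r -> {for r, continuous g}) ->
  measurable_fun (`]0, +oo[ : set R) g.
Proof.
move=> cg; apply: open_continuous_measurable_fun; first exact: interval_open.
by move=> x; rewrite inE/= in_itv/= andbT => /cg.
Qed.

Definition positive_range {R : realType} (s : R -> R) : set R := s @` `]0, +oo[%classic.

(** The values are restricted to the image of the positive half-line, in order to
    be nonnegative and, elsewhere, 0. *)
Definition positive_inverse {R : realType} (s : R -> R) (y : R) : R :=
  if y \in positive_range s then xget 0 [set r | s r = y] else 0.

Section increasing_substitution.
Context {R : realType}.
Local Notation mu := (@lebesgue_measure R).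
Variables (s s' : R -> R) (K : R).
Hypothesis s0 : s 0 = 0.
Hypothesis s_inc : {homo s : x y / x < y}.
Hypothesis ds : forall r : R, 0 < r -> is_derive r 1 s (s' r).
Hypothesis cs' : forall r : R, 0 < r -> {for r, continuous s'}.
Hypothesis s_lip : forall r : R, 0 <= r -> s r <= K * r.

Local Notation sigma := (fun y : R => xget 0 [set r | s r = y]).
Local Notation J := (positive_range s).

Let s_inj : injective s.
Proof.
move=> x y sxy; have [xy|yx|//] := ltgtP x y.
  by move: (s_inc xy); rewrite sxy ltxx.
by move: (s_inc yx); rewrite sxy ltxx.
Qed.

Let s_le : {mono s : x y / x <= y}. Proof. exact: le_mono. Qed.

Let sK : cancel s sigma.
Proof.
move=> r; rewrite /sigma; case: xgetP => [x -> /= /s_inj//|].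
by move=> /(_ r) /(_ erefl).
Qed.

Let s'_ge0 (r : R) : 0 < r -> 0 <= s' r.
Proof.
move=> r0; have [dr <-] := ds r0; rewrite -derive1E.
apply: (@incr_derive1_ge0_itvy _ _ false 0); last by rewrite in_itv/= r0.
  by move=> x; rewrite inE/= in_itv/= andbT => x0; have [] := ds x0.
by move=> x y _ _; exact: s_inc.
Qed.

(** Where [s' r = 0] the inverse function is not derivable, for otherwise the chain
    rule would give [1 = 0].  Then [derive1] takes the default value 0, which is
    also the value of [0^-1]. *)
Lemma derive1_inverse (r : R) : 0 < r -> derive1 sigma (s r) = (s' r)^-1.
Proof.
move=> r0; rewrite derive1E; have [s'r0|s'r0] := eqVneq (s' r) 0; last first.
  have [] // : is_derive (s r) 1 sigma (s' r)^-1.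
  apply: is_derive_inverse (ds r0) s'r0; first by near=> x; exact: sK.
  near=> x; have x0 : 0 < x by near: x; exact: lt_nbhsr.
  by apply: differentiable_continuous; apply/derivable1_diffP; have [] := ds x0.
rewrite s'r0 invr0; apply: dvgP => dsigma.
have dd : is_derive (s r) 1 sigma ('D_1 sigma (s r)) by split.
have := is_derive1_comp dd (ds r0).
rewrite s'r0 mulr0 (_ : sigma \o s = id); last exact/funext/sK.
by move=> [_]; rewrite derive_id => /eqP; rewrite oner_eq0.
Unshelve. all: end_near. Qed.

Let s_cvg0 : s r @[r --> 0^'+] --> (0 : R).
Proof.
apply: (@squeeze_cvgr _ _ _ _ (cst 0) (fun r => K * r)).
- near=> r; have r0 : 0 < r by near: r; exact: nbhs_right_gt.
  by rewrite -{1}s0 s_le s_lip ltW.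
- exact: cvg_cst.
- rewrite -[X in _ --> X](mulr0 K); apply: cvgMl_tmp => //.
  by apply: cvg_at_right_filter; exact: cvg_id.
Unshelve. all: end_near. Qed.

Let s_cont (a b : R) : 0 <= a -> a < b -> {within `[a, b], continuous s}.
Proof.
move=> a0 ab; apply/continuous_within_itvP => //; split.
- move=> x; rewrite in_itv/= => /andP[ax _].
  have x0 := le_lt_trans a0 ax.
  by apply: differentiable_continuous; apply/derivable1_diffP; have [] := ds x0.
- move: a0; rewrite le_eqVlt => /predU1P[<-|a0]; first by rewrite s0.
  apply: cvg_at_right_filter.
  by apply: differentiable_continuous; apply/derivable1_diffP; have [] := ds a0.
- have b0 := le_lt_trans a0 ab; apply: cvg_at_left_filter.
  by apply: differentiable_continuous; apply/derivable1_diffP; have [] := ds b0.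
Qed.

Let s_image (t y : R) : 0 < t -> 0 < y <= s t -> exists2 r, 0 < r <= t & s r = y.
Proof.
move=> t0 /andP[y0 yt].
have [|r] := @IVT R s 0 t y (ltW t0) (s_cont (lexx _) t0).
  by rewrite s0 min_l ?max_r ?(ltW y0)// -s0 s_le ltW.
rewrite in_itv/= => /andP[r0 rt] sr; exists r => //; rewrite rt andbT lt_neqAle r0 andbT.
by apply: contra_eqN sr => /eqP <-; rewrite s0 lt_eqF.
Qed.

Let s_gt0 r : 0 < r -> 0 < s r. Proof. by move=> r0; rewrite -s0; exact: s_inc. Qed.

Local Notation sigma0 := (positive_inverse s).

Lemma positive_inverseK r : 0 < r -> sigma0 (s r) = r.
Proof.
move=> r0; rewrite /positive_inverse mem_set ?sK//; exists r => //=.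
by rewrite in_itv/= r0.
Qed.

Let positive_inverseN y : ~ J y -> sigma0 y = 0. Proof. by move=> Jy; rewrite /positive_inverse memNset. Qed.

Let positive_inverse_gt (x : R) : 0 <= x -> sigma0 @^-1` `]x, +oo[%classic = s @` `]x, +oo[%classic.
Proof.
move=> x0; apply/seteqP; split=> y /=; last first.
  move=> [r]; rewrite !in_itv/= !andbT => xr <-.
  by rewrite positive_inverseK// (le_lt_trans x0).
rewrite in_itv/= andbT; have [[r]|/positive_inverseN ->] := pselect (J y); last first.
  by rewrite ltNge x0.
rewrite /= in_itv/= andbT => r0 <-; rewrite positive_inverseK// => xr.
by exists r => //; rewrite in_itv/= xr.
Qed.

Let measurable_image (x : R) : 0 <= x -> measurable (s @` `]x, +oo[%classic).
Proof.
move=> x0; apply: is_interval_measurable => _ _ [p /= + <-] [q /= + <-] y.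
rewrite !in_itv/= !andbT => xp xq /andP[py yq].
have [||r _ sr] := @s_image q y; first exact: le_lt_trans xq.
  by rewrite yq (lt_le_trans _ py)// s_gt0// (le_lt_trans x0).
exists r => //; rewrite /= in_itv/= andbT (lt_le_trans xp)//.
by rewrite -s_le sr.
Qed.

Lemma measurable_positive_range : measurable J. Proof. exact: measurable_image. Qed.

Lemma measurable_positive_inverse : measurable_fun setT sigma0.
Proof.
apply: (measurability _ (RGenOInfty.measurableE R)) => _ [_ [x ->] <-]; rewrite setTI.
have [x0|x0] := leP 0 x; first by rewrite positive_inverse_gt//; exact: measurable_image.
rewrite (_ : _ @^-1` _ = setT)//; apply/seteqP; split=> // y _ /=.
rewrite in_itv/= andbT (lt_le_trans x0)//.
have [[r]|/positive_inverseN -> //] := pselect (J y).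
by rewrite /= in_itv/= andbT => r0 <-; rewrite positive_inverseK// ltW.
Qed.

Local Notation p := (fun r : R => if 0 < r then s' r else 0).
Let p_ge0 r : 0 <= p r. Proof. by rewrite /=; case: (ltP 0 r) => // r0; exact: s'_ge0. Qed.

Let mp : measurable_fun setT p. 
Proof. by apply: measurable_positive_extension; exact: continuous_measurable_positive. Qed.

Let IJ_ge0 x : 0 <= \1_J x :> R. Proof. by []. Qed.
Let mIJ : measurable_fun setT (\1_J : measurableTypeR R -> R).
Proof. by apply: measurable_indic; exact: measurable_positive_range. Qed.
Let lamJ : {measure set (measurableTypeR R) -> \bar R} := density_measure mu IJ_ge0 mIJ.
Let msigma0 : measurable_fun setT (sigma0 : measurableTypeR R -> measurableTypeR R).
Proof. exact: measurable_positive_inverse. Qed.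
Let m1 : {measure set (measurableTypeR R) -> \bar R} :=
  measure_function_pushforward__canonical__measure_function_Measure lamJ msigma0.
Let m2 : {measure set (measurableTypeR R) -> \bar R} := density_measure mu p_ge0 mp.

Let m2_itv (a b : R) : 0 < a -> a < b -> m2 `]a, b]%classic = (s b - s a)%:E.
Proof.
move=> a0 ab; rewrite /m2/= /density_measure.
have b0 := lt_trans a0 ab.
rewrite integral_itv_obnd_cbnd; last by apply/measurable_EFinP; exact: measurable_funTS.
transitivity (\int[mu]_(r in `[a, b]) (s' r)%:E)%E.
  apply: eq_integral => r; rewrite inE/= in_itv/= => /andP[ar _].
  by rewrite (lt_le_trans a0).
rewrite (@continuous_FTC2 R s' s)//.
- apply/continuous_within_itvP => //; split.
  + by move=> x; rewrite in_itv/= => /andP[ax _]; apply: cs'; rewrite (lt_trans a0).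
  + by apply: cvg_at_right_filter; exact: cs'.
  + by apply: cvg_at_left_filter; exact: cs'.
- split.
  + by move=> x; rewrite in_itv/= => /andP[ax _]; have [] := ds (lt_trans a0 ax).
  + apply: cvg_at_right_filter.
    by apply: differentiable_continuous; apply/derivable1_diffP; have [] := ds a0.
  + apply: cvg_at_left_filter.
    by apply: differentiable_continuous; apply/derivable1_diffP; have [] := ds b0.
- move=> x; rewrite in_itv/= => /andP[ax _].
  by rewrite derive1E; have [_ ->] := ds (lt_trans a0 ax).
Qed.

(** [s'] need not have a limit at 0, so that the fundamental theorem of calculus is
    applied on the intervals [[t / k.+2, t]], and [s] tends to 0 at 0. *)
Let m2_halfline (t : R) : 0 < t -> m2 `]0, t]%classic = (s t)%:E.
Proof.
move=> t0; pose F (k : nat) : set R := `](t / k.+2%:R), t]%classic.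
have FE : \bigcup_k F k = `]0, t]%classic.
  apply/seteqP; split=> x.
    move=> [k _]; rewrite /F/= !in_itv/= => /andP[kx ->].
    by rewrite andbT (le_lt_trans _ kx)// divr_ge0// ltW.
  rewrite /= in_itv/= => /andP[x0 xt]; exists (Num.truncn (t / x)) => //.
  rewrite /F/= in_itv/= xt andbT ltr_pdivrMr// mulrC -ltr_pdivrMr//.
  by rewrite (lt_trans (truncnS_gt _))// ltr_nat.
have cF : (m2 \o F) x @[x --> \oo] --> m2 (\bigcup_k F k).
  apply: nondecreasing_cvg_mu.
  - by move=> k; exact: measurable_itv.
  - by rewrite FE; exact: measurable_itv.
  - move=> i j ij; apply/subsetPset; apply: subset_itvr.
    by rewrite bnd_simp ler_pM2l// lef_pV2 ?posrE// ler_nat.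
rewrite -FE -(cvg_lim _ cF)//; apply: cvg_lim => //.
have FE' k : (m2 \o F) k = (s t - s (t / k.+2%:R))%:E.
  rewrite /= m2_itv// ?divr_gt0//.
  by rewrite ltr_pdivrMr// ltr_pMr// ltr1n.
apply/fine_cvgP; split; first by apply: nearW => k; rewrite FE'.
rewrite (_ : fine \o (m2 \o F) = fun k => s t - s (t / k.+2%:R)); last first.
  by apply/funext => k /=; rewrite [m2 _]FE'.
rewrite -[X in _ --> X](subr0 (s t)); apply: cvgB; first exact: cvg_cst.
move/cvg_at_rightP : s_cvg0; apply; split; first by move=> k; rewrite divr_gt0.
rewrite -[X in _ --> X](mulr0 t); apply: cvgMl_tmp.
have := @cvg_harmonic R; rewrite -cvg_shiftS; exact.
Qed.

Let m1E (B : set R) : measurable B -> m1 B = mu (J `&` sigma0 @^-1` B).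
Proof.
move=> mB; rewrite /m1/= /pushforward /density_measure integral_indic//; last exact: measurable_positive_range.
by rewrite -[X in measurable X]setTI; exact: measurable_positive_inverse.
Qed.

Let m12 (B : set R) : measurable B -> m1 B = m2 B.
Proof.
have set0t (t : R) : t <= 0 -> `]0, t]%classic = set0.
  by move=> t0; rewrite set_itv_ge// bnd_simp -leNgt.
have m1t t : m1 `]-oo, t]%classic = m2 `]0, t]%classic.
  rewrite m1E//; have [t0|t0] := ltP 0 t.
    rewrite m2_halfline// (_ : _ `&` _ = `]0, s t]%classic).
      by rewrite lebesgue_measure_itv/= lte_fin s_gt0// sube0.
    apply/seteqP; split=> y /=; rewrite !in_itv/=.
      move=> [[r /=]]; rewrite in_itv/= andbT => r0 <-.
      by rewrite positive_inverseK// s_gt0// s_le.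
    move=> /(s_image t0)[r /andP[r0 rt] <-]; rewrite positive_inverseK//; split=> //.
    by exists r => //=; rewrite in_itv/= r0.
  rewrite set0t// measure0 (_ : _ `&` _ = set0) ?measure0//.
  apply/seteqP; split=> // _ [[r /= + <-]]; rewrite !in_itv/= andbT => r0.
  by rewrite positive_inverseK// => rt; move: (lt_le_trans r0 (le_trans rt t0)); rewrite ltxx.
move=> mB; apply: measure_halfline_unique => // t; rewrite m1t.
  rewrite /m2/= /density_measure.
  have [t0|t0] := ltP 0 t; last first.
    rewrite set0t// integral_set0; apply/esym.
    by apply: integral0_eq => r; rewrite /= in_itv/= => rt; rewrite ltNge (le_trans rt).
  rewrite integral_mkcond [RHS]integral_mkcond; apply: eq_integral => r _.
  rewrite !patchE; have [r0|r0] := ltP 0 r; last by do 2 case: ifPn.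
  congr (if _ then _ else _); apply/idP/idP; rewrite !inE/= !in_itv/= ?r0//.
have [t0|t0] := ltP 0 t; first by rewrite m2_halfline// ltry.
by rewrite set0t// measure0.
Qed.

(** The image of the Lebesgue measure of the range under the inverse function has the
    density [s'].  In this direction, critical points are harmless: no derivative of
    the inverse occurs. *)
Lemma increasing_substitution (h : R -> \bar R) (B : set R) :
  measurable B -> measurable_fun setT h -> (forall r, 0 <= h r)%E ->
  (\int[mu]_(y in J `&` sigma0 @^-1` B) h (sigma0 y) =
   \int[mu]_(r in B) (h r * (p r)%:E))%E.
Proof.
move=> mB mh h0.
have mSB : measurable (sigma0 @^-1` B).
  by rewrite -[X in measurable X]setTI; exact: measurable_positive_inverse.
transitivity (\int[m2]_(r in B) h r)%E; last first.
  by rewrite /m2 integral_density//; exact: measurable_funTS.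
transitivity (\int[m1]_(r in B) h r)%E; last first.
  by apply: eq_measure_integral => A mA _; exact: m12.
rewrite ge0_integral_pushforward//; last exact: measurable_funTS.
rewrite integral_density; [|exact: mSB| |by move=> x _; exact: h0]; last first.
  by apply: measurable_funTS; apply: measurableT_comp mh _; exact: measurable_positive_inverse.
rewrite setIC integral_mkcondr; apply: eq_integral => x _.
by rewrite patchE/= indicE; case: ifPn; rewrite ?mule1 ?mule0.
Qed.

End increasing_substitution.

(** * Radial maps and Poincare densities *)

Section radial_maps.
Context {R : realType}.
Local Notation mu := (@lebesgue_measure R).
Variables (n : nat) (rho : R -> R).
Hypotheses (n_gt0 : (0 < n)%N) (rhoC : conditionC rho) (rhoCn : conditionCn n rho).
Local Notation S := (radial_map n rho).
Local Notation s := (radial_map1 rho).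
Let L := lipschitz_constant S.
Let s' (r : R) : R := derive1 rho r * r + rho r.

Let rho_gt0 r : 0 < r -> 0 < rho r. Proof. by case: rhoC => _ /(_ r). Qed.

Lemma radial_map1_pos (r : R) : 0 < r -> s r = rho r * r.
Proof. by move=> r0; rewrite radial_map1E gt_eqF// gtr0_norm. Qed.

Let s0 : s 0 = 0. Proof. by rewrite radial_map1E eqxx. Qed.

Let rho_deriv (r : R) : 0 < r -> derivable rho r 1 /\ {for r, continuous (derive1 rho)}.
Proof. by case: rhoC => h _ _; exact: h. Qed.

Let s_inc : {homo s : x y / x < y}. Proof. by case: rhoC. Qed.

Lemma is_derive_radial_map1 (r : R) : 0 < r -> is_derive r 1 s (s' r).
Proof.
move=> r0; have [drho _] := rho_deriv r0.
have drho' : is_derive r 1 rho (derive1 rho r) by split; rewrite // derive1E.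
apply: (@near_eq_is_derive _ _ _ (rho * id)).
  near=> x; rewrite radial_map1_pos//.
  by near: x; exact: lt_nbhsr.
apply: is_derive_eq.
by rewrite /GRing.scale/= /s' mulr1 addrC mulrC.
Unshelve. all: end_near. Qed.

Let rho_cont (r : R) : 0 < r -> {for r, continuous rho}.
Proof.
move=> r0; apply: differentiable_continuous; apply/derivable1_diffP.
exact: (rho_deriv r0).1.
Qed.

Let cs' (r : R) : 0 < r -> {for r, continuous s'}.
Proof.
move=> r0; have [_ crho'] := rho_deriv r0.
apply: (@continuousD _ R^o R^o (fun r => derive1 rho r * r) rho r); last exact: rho_cont.
by apply: (@continuousM _ R^o (derive1 rho) id) => //; exact: cvg_id.
Qed.

Lemma radial_map_scale (x : n.-tuple R) : 0 < eucl_norm x ->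
  S x = scale_tuple (rho (eucl_norm x)) x.
Proof. by move=> x0; rewrite /radial_map gt_eqF. Qed.

Lemma eucl_norm_radial_map (x : n.-tuple R) : eucl_norm (S x) = s (eucl_norm x).
Proof.
have := eucl_norm_ge0 x; rewrite le_eqVlt => /predU1P[x0|x0].
  rewrite /radial_map -x0 eqxx s0 /eucl_norm big1 ?sqrtr0// => i _.
  by rewrite tnth_mktuple expr0n.
by rewrite radial_map_scale// eucl_norm_scale ?rho_gt0// radial_map1_pos.
Qed.

Let s_gt0 (r : R) : 0 <= r -> (0 < s r) = (0 < r).
Proof.
rewrite le_eqVlt => /predU1P[<-|r0]; first by rewrite s0 ltxx.
by rewrite r0 -s0 s_inc.
Qed.

Lemma direction_radial_map (x : n.-tuple R) : 0 < eucl_norm x ->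
  direction (S x) = direction x.
Proof. by move=> x0; rewrite radial_map_scale// direction_scale// rho_gt0. Qed.

Lemma preimage_sector (E : set (n.-tuple R)) (B : set R) : S @^-1` (sector E B) = sector E (s @^-1` B).
Proof.
apply/seteqP; split=> x; rewrite /sector/= eucl_norm_radial_map s_gt0 ?eucl_norm_ge0//.
  by move=> [x0]; rewrite direction_radial_map.
by move=> [x0]; rewrite direction_radial_map.
Qed.

Lemma measurable_radial_map : measurable_fun setT S.
Proof.
pose rho0 (r : R) := if 0 < r then rho r else 0.
have mrho0 : measurable_fun setT rho0.
  by apply: measurable_positive_extension; exact: continuous_measurable_positive.
apply/measurable_fun_tnthP => i.
rewrite (_ : _ \o _ = fun x => rho0 (eucl_norm x) * tnth x i); last first.
  apply/funext => x /=; rewrite /radial_map /rho0 lt_neqAle eq_sym eucl_norm_ge0 andbT.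
  by case: ifPn => x0; rewrite ?tnth_mktuple ?mul0r.
apply: measurable_funM; last exact: measurable_tnth.
exact: measurableT_comp mrho0 (@measurable_eucl_norm R n).
Qed.

Let s_lip (r : R) : 0 <= r -> s r <= L * r.
Proof.
move=> r0; have [_ SL] := lipschitz_constantP rhoCn.
pose x : n.-tuple R := [tuple if i == Ordinal n_gt0 then r else 0 | i < n].
have xr : eucl_norm x = r.
  rewrite /eucl_norm (bigD1 (Ordinal n_gt0))//= big1 ?addr0.
    by rewrite tnth_mktuple eqxx sqrtr_sqr ger0_norm.
  by move=> i i0; rewrite tnth_mktuple (negPf i0) expr0n.
have normE (y : n.-tuple R) : eucl_dist y [tuple 0 | _ < n] = eucl_norm y.
  by congr Num.sqrt; apply: eq_bigr => i _; rewrite tnth_mktuple subr0.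
have S0 : S [tuple 0 | _ < n] = [tuple 0 | _ < n].
  rewrite /radial_map (_ : eucl_norm _ = 0) ?eqxx//.
  by rewrite /eucl_norm big1 ?sqrtr0// => i _; rewrite tnth_mktuple expr0n.
by have := SL x [tuple 0 | _ < n]; rewrite S0 !normE eucl_norm_radial_map xr.
Qed.

Let C : R := (2 * pi) `^ (- (n%:R / 2)).
Let gauss_radial (r : R) : R := C * expR (- r ^+ 2 / 2).

(** The product density depends on the norm only; this is the Gaussian factor of
    [poincare_density]. *)
Lemma gauss_tuple_pdf_radial (x : n.-tuple R) :
  gauss_tuple_pdf x = gauss_radial (eucl_norm x).
Proof.
rewrite /gauss_tuple_pdf; under eq_bigr do rewrite gpdfE.
rewrite big_split/= prodr_const card_ord -expR_sum /gauss_radial; congr (_ * expR _).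
  rewrite /C [n%:R / 2]mulrC powRN powRrM powR12_sqrt ?mulr_ge0 ?pi_ge0// powR_mulrn ?sqrtr_ge0//.
  by rewrite /normal_peak expr1n mul1r exprVn [2 * pi]mulr_natl.
rewrite sqr_sqrtr; last by apply: sumr_ge0 => i _; exact: sqr_ge0.
by rewrite sumrN -mulr_suml mulNr.
Qed.

Let C_ge0 : 0 <= C. Proof. exact: powR_ge0. Qed.
Let gauss_radial_ge0 r : 0 <= gauss_radial r. Proof. by rewrite mulr_ge0// expR_ge0. Qed.

Let measurable_gauss_radial : measurable_fun setT gauss_radial.
Proof.
apply: measurable_funM => //; apply: measurableT_comp => //.
by apply: measurable_funM => //; apply: measurableT_comp => //; exact: measurable_funX.
Qed.

Lemma gauss_tuple_sector (E : set (n.-tuple R)) (B : set R) : measurable E -> measurable B ->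
  gauss_tuple (sector E B) =
  (sphere_measure E *
   \int[mu]_(r in B `&` `]0%R, +oo[) ((gauss_radial r)%:E * (r ^+ n.-1)%:E))%E.
Proof.
move=> mE mB; rewrite -(polar_integral n_gt0 mE mB (g := EFin \o gauss_radial)).
- by apply: eq_integral => x _ /=; rewrite gauss_tuple_pdf_radial.
- exact/measurable_EFinP.
- by move=> r; rewrite lee_fin.
Qed.

Local Notation J := (positive_range s).
Local Notation sigma := (positive_inverse s).

Lemma radial_map_range (x : n.-tuple R) : 0 < eucl_norm x ->
  (S @` [set y | y != [tuple 0 | _ < n]]) x <-> J (eucl_norm x).
Proof.
move=> x0; split.
  move=> [y _ yx]; exists (eucl_norm y); last by rewrite -yx eucl_norm_radial_map.
  by rewrite /= in_itv/= andbT -s_gt0 ?eucl_norm_ge0// -eucl_norm_radial_map yx.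
move=> [r /=]; rewrite in_itv/= andbT => r0 sr.
have t0 : 0 < r / eucl_norm x by rewrite divr_gt0.
have yr : eucl_norm (scale_tuple (r / eucl_norm x) x) = r.
  by rewrite eucl_norm_scale// mulfVK ?gt_eqF.
exists (scale_tuple (r / eucl_norm x) x) => /=.
  apply: contraPneq x0 => y0; apply/negP; rewrite -leNgt.
  move: r0; rewrite -yr y0.
  by rewrite /eucl_norm big1 ?sqrtr0 ?ltxx// => i _; rewrite tnth_mktuple expr0n.
rewrite radial_map_scale yr//; apply: eq_from_tnth => i; rewrite !tnth_mktuple.
move: sr; rewrite radial_map1_pos// => sr.
by rewrite mulrA mulrA sr mulfV ?mul1r// gt_eqF.
Qed.

Let p (r : R) := if 0 < r then s' r else 0.
Let mp : measurable_fun setT p.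
Proof. by apply: measurable_positive_extension; exact: continuous_measurable_positive. Qed.

(** The Poincare density as a function of the norm; [(p (sigma y))^-1] is the
    derivative of the inverse, with value 0 at the critical values. *)
Let dens (y : R) : R :=
  (gauss_radial (sigma y) * (sigma y / y) ^+ n.-1 * (p (sigma y))^-1) * \1_J y.

Lemma poincare_density_radial (x : n.-tuple R) : 0 < eucl_norm x ->
  poincare_density rho x = dens (eucl_norm x).
Proof.
move=> x0; rewrite /poincare_density /dens indicE.
have [xJ|xJ] := pselect (J (eucl_norm x)); last first.
  rewrite [_ \in J]memNset// mulr0 ifF//; apply/negbTE.
  by rewrite notin_setE => /(radial_map_range x0).
rewrite ifT; last by rewrite inE; exact/(radial_map_range x0).
rewrite [_ \in J]mem_set// mulr1.
case: xJ => r; rewrite /= in_itv/= andbT => r0 <-.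
have -> : inverse_map1 rho (s r) = r.
  rewrite -[RHS](positive_inverseK s_inc r0) /positive_inverse mem_set//.
  by exists r => //=; rewrite in_itv/= andbT.
have -> : derive1 (inverse_map1 rho) (s r) = (s' r)^-1.
  exact: (derive1_inverse s_inc is_derive_radial_map1 r0).
by rewrite (positive_inverseK s_inc r0) /p r0.
Qed.

Let measurable_dens : measurable_fun setT dens.
Proof.
have msigma : measurable_fun setT sigma.
  exact: (measurable_positive_inverse s0 s_inc is_derive_radial_map1 s_lip).
apply: measurable_funM; last first.
  by apply: measurable_indic; exact: (measurable_positive_range s0 s_inc is_derive_radial_map1 s_lip).
apply: measurable_funM; last first.
  apply: (measurableT_comp measurable_inv); exact: measurableT_comp mp msigma.
apply: measurable_funM; first exact: measurableT_comp measurable_gauss_radial msigma.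
by apply: measurable_funX; apply: measurable_funM => //; exact: measurable_inv.
Qed.

Let p_ge0 r : 0 <= p r.
Proof.
rewrite /p; case: (ltP 0 r) => // r0; have [dr <-] := is_derive_radial_map1 r0.
rewrite -derive1E.
apply: (@incr_derive1_ge0_itvy _ _ false 0); last by rewrite in_itv/= r0.
  by move=> x; rewrite inE/= in_itv/= andbT => x0; have [] := is_derive_radial_map1 x0.
by move=> x y _ _; exact: s_inc.
Qed.

Let sigma_ge0 y : 0 <= sigma y.
Proof.
have [[r /=]|yJ] := pselect (J y); last by rewrite /positive_inverse memNset.
by rewrite in_itv/= andbT => r0 <-; rewrite (positive_inverseK s_inc r0) ltW.
Qed.

Let J_gt0 y : J y -> 0 < y.
Proof.
by move=> [r /=]; rewrite in_itv/= andbT => r0 <-; rewrite s_gt0// ltW.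
Qed.

Let dens_ge0 y : 0 <= dens y.
Proof.
rewrite /dens indicE; have [yJ|yJ] := pselect (J y); last by rewrite [_ \in J]memNset// mulr0.
rewrite [_ \in J]mem_set// mulr1 mulr_ge0 ?invr_ge0// mulr_ge0// exprn_ge0// divr_ge0//.
by rewrite ltW// J_gt0.
Qed.

Lemma measurable_preimage_radial_map1 B : measurable B -> measurable (s @^-1` B).
Proof.
move=> mB; rewrite -[X in measurable X]setTI.
apply: (nondecreasing_measurable (D := setT) (f := s)) => // x y.
by rewrite le_mono.
Qed.

(** After the substitution [y = s r], the Poincare density becomes the Gaussian
    density where [s' r != 0], and 0 at the critical points. *)
Lemma poincare_sector_le (E : set (n.-tuple R)) (B : set R) :
  measurable E -> measurable B ->
  (poincare_measure n rho (sector E B) <= gauss_tuple (S @^-1` (sector E B)))%E.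
Proof.
move=> mE mB; have msB := measurable_preimage_radial_map1 mB.
rewrite preimage_sector gauss_tuple_sector//.
have -> : poincare_measure n rho (sector E B) =
    (\int[lebesgue_tuple n]_(x in sector E B) (EFin \o dens) (eucl_norm x))%E.
  by apply: eq_integral => x; rewrite inE => -[x0 _ _]; rewrite poincare_density_radial.
rewrite (polar_integral n_gt0 mE mB); [|exact/measurable_EFinP|by move=> y; rewrite lee_fin].
apply: lee_wpmul2l; first exact: sphere_measure_ge0.
pose h (r : R) : R := gauss_radial r * `|r| ^+ n.-1 / p r.
have mh : measurable_fun setT h.
  apply: measurable_funM; last exact: measurableT_comp measurable_inv mp.
  by apply: measurable_funM => //; apply: measurable_funX; exact: normr_measurable.
have h0 r : 0 <= h r by rewrite mulr_ge0 ?invr_ge0// mulr_ge0.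
rewrite (_ : (\int[mu]_(r in B `&` _) _)%E =
    (\int[mu]_(y in J `&` sigma @^-1` (s @^-1` B)) (EFin \o h) (sigma y))%E).
  rewrite (increasing_substitution s0 s_inc is_derive_radial_map1 cs' s_lip); [|exact: msB|exact/measurable_EFinP|by move=> r; rewrite lee_fin].
  rewrite [leRHS]integral_mkcondr; apply: ge0_le_integral => //.
  - by move=> r _; rewrite -EFinM lee_fin mulr_ge0// p_ge0.
  - by apply/measurable_EFinP/measurable_funTS; exact: measurable_funM.
  - apply/measurable_restrict => //; apply: measurable_funTS.
    apply/measurable_EFinP; apply: measurable_funM => //; exact: measurable_funX.
  move=> r _; rewrite patchE -/(p r).
  case: ifPn; [rewrite inE|rewrite notin_setE]; rewrite /= in_itv/= andbT => r0.
    rewrite -!EFinM lee_fin /h gtr0_norm//.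
    have [->|pr0] := eqVneq (p r) 0; last by rewrite divfK.
    by rewrite mulr0 mulr_ge0// exprn_ge0// ltW.
  by rewrite /p (negPf (introN idP r0)) mule0.
rewrite integral_mkcond [RHS]integral_mkcond; apply: eq_integral => y _.
rewrite !patchE.
have [yJ|yJ] := pselect (J y); last first.
  rewrite [X in _ = if X then _ else _]memNset; last by move=> [].
  by case: ifPn => // _; rewrite /= /dens indicE [_ \in J]memNset// mulr0 mul0e.
have y0 := J_gt0 yJ.
have sy : s (sigma y) = y.
  case: yJ => r; rewrite /= in_itv/= andbT => r0 <-.
  by rewrite (positive_inverseK s_inc r0).
have -> : (y \in B `&` `]0, +oo[%classic) = (y \in J `&` sigma @^-1` (s @^-1` B)).
  apply/idP/idP; rewrite !inE/= ?in_itv/= ?y0 sy; first by move=> [].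
  by move=> [].
case: ifPn => // _; rewrite /= -EFinM; congr EFin.
rewrite /dens indicE [_ \in J]mem_set// mulr1 /h ger0_norm// expr_div_n.
have : (y : R) ^+ n.-1 != 0 by rewrite expf_neq0// gt_eqF.
move: ((y : R) ^+ n.-1) (gauss_radial (sigma y)) (sigma y ^+ n.-1) (p (sigma y))^-1.
by move=> a b c e a0; field.
Qed.

End radial_maps.

Section polar_rectangles.
Context {R : realType}.
Implicit Types (n : nat).
Local Open Scope ereal_scope.

(** The origin is invariant under scaling by 2, which multiplies measures by [2 ^ n]. *)
Lemma lebesgue_tuple_origin n : (0 < n)%N ->
  lebesgue_tuple n [set x | eucl_norm x = 0%R :> R] = 0.
Proof.
move=> n0; set Z := [set x | _].
have mZ : measurable Z.
  rewrite -[X in measurable X]setTI.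
  rewrite (_ : Z = @eucl_norm R n @^-1` [set 0%R])//; exact: measurable_eucl_norm.
have Zfin : lebesgue_tuple n Z < +oo.
  apply: le_lt_trans (@lebesgue_tuple_cube_lty R n).
  apply: le_measure; rewrite ?inE//; first exact: measurable_tuple_cube.
  move=> x Zx i; apply: (@le_trans _ _ (eucl_norm x)); last by rewrite Zx.
  rewrite -sqrtr_sqr ler_wsqrtr// (bigD1 i)//= lerDl; apply: sumr_ge0 => j _.
  exact: sqr_ge0.
have := @lebesgue_tuple_scale R n 2 Z (ltr0n _ 2) mZ.
have -> : scale_tuple 2%R @^-1` Z = Z.
  apply/seteqP; split=> x; rewrite /Z/= eucl_norm_scale//; last by move=> ->; rewrite mulr0.
  by move/eqP; rewrite mulf_eq0 pnatr_eq0/= => /eqP.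
rewrite -(fineK (_ : lebesgue_tuple n Z \is a fin_num)) ?ge0_fin_numE//.
move: (fine _) => r; rewrite -EFinM => -[/eqP]; rewrite -subr_eq0 -{1}(mul1r r) -mulrBl.
rewrite mulf_eq0 subr_eq0 -natrX eq_sym pnatr_eq1 gtn_eqF ?(ltn_exp2l 0)//=.
by move=> /eqP ->.
Qed.

Definition polar n (x : n.-tuple R) : measurableTypeR R * n.-tuple R :=
  (eucl_norm x, direction x).

Definition unpolar n (p : measurableTypeR R * n.-tuple R) : n.-tuple R :=
  scale_tuple p.1 p.2.

Lemma measurable_polar n : measurable_fun setT (@polar n).
Proof.
by apply: measurable_fun_pair; [exact: measurable_eucl_norm|exact: measurable_direction].
Qed.

Lemma measurable_unpolar n : measurable_fun setT (@unpolar n).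
Proof.
apply/measurable_fun_tnthP => i.
rewrite (_ : _ \o _ = fun p : measurableTypeR R * n.-tuple R => (p.1 * tnth p.2 i)%R); last first.
  by apply/funext => x /=; rewrite tnth_mktuple.
apply: measurable_funM; first exact: measurable_fst.
by apply: (measurableT_comp (measurable_tnth i)); exact: measurable_snd.
Qed.

Lemma eucl_norm_eq0 n (x : n.-tuple R) i : eucl_norm x = 0%R -> tnth x i = 0%R.
Proof.
move=> x0; apply/eqP; rewrite -normr_le0 -x0 -sqrtr_sqr ler_wsqrtr// (bigD1 i)//= lerDl.
by apply: sumr_ge0 => j _; exact: sqr_ge0.
Qed.

Lemma polarK n : cancel (@polar n) (@unpolar n).
Proof.
move=> x; apply: eq_from_tnth => i; rewrite /unpolar/= !tnth_mktuple.
have [x0|x0] := eqVneq (eucl_norm x) 0%R; first by rewrite x0 mul0r eucl_norm_eq0.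
by rewrite mulrC divfK.
Qed.

(** Comparable measures of equal finite mass are equal: the complement of a rectangle
    is a union of two rectangles, on which the inequality also holds.  Rectangles in
    polar coordinates generate the sigma-algebra because [polar] has the measurable
    left inverse [unpolar]. *)
Lemma measure_rectangles_unique n (m1 m2 : {measure set (n.-tuple R) -> \bar R}) :
  m1 setT = 1 -> m2 setT = 1 ->
  (forall (B : set R) (E : set (n.-tuple R)), measurable B -> measurable E ->
    m1 (@polar n @^-1` (B `*` E)) <= m2 (@polar n @^-1` (B `*` E))) ->
  forall A, measurable A -> m1 A = m2 A.
Proof.
move=> m1T m2T m12 A mA.
have mpre (C : set (measurableTypeR R * n.-tuple R)) : measurable C -> measurable (@polar n @^-1` C).
  by move=> mC; rewrite -[X in measurable X]setTI; exact: measurable_polar.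
have rectE (B : set R) (E : set (n.-tuple R)) : measurable B -> measurable E ->
    m1 (@polar n @^-1` (B `*` E)) = m2 (@polar n @^-1` (B `*` E)).
  move=> mB mE.
  have split3 (m : {measure set (n.-tuple R) -> \bar R}) : m setT = 1 ->
      m (@polar n @^-1` (B `*` E)) + (m (@polar n @^-1` (B `*` ~` E)) +
      m (@polar n @^-1` (~` B `*` setT))) = 1.
    move=> mT; rewrite -measureU; last 3 first.
    - by apply: mpre; apply: measurableX => //; exact: measurableC.
    - by apply: mpre; apply: measurableX => //; exact: measurableC.
    - by apply/seteqP; split => // x [[/= ? _] [/= + _]].
    rewrite -measureU; last 3 first.
    - by apply: mpre; exact: measurableX.
    - by apply: measurableU; apply: mpre; apply: measurableX => //; exact: measurableC.
    - by apply/seteqP; split => // x [[/= ? ?] [[/= ? +]|[/= + _]]].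
    rewrite -mT; congr (m _); apply/seteqP; split => // x _ /=.
    by have [|] := pselect (B (eucl_norm x)); have [|] := pselect (E (direction x)); tauto.
  have := split3 m2 m2T; rewrite -(split3 m1 m1T).
  have := m12 B E mB mE; have := m12 B (~` E) mB (measurableC mE).
  have := m12 (~` B) setT (measurableC mB) measurableT.
  have fin (m : {measure set (n.-tuple R) -> \bar R}) C : m setT = 1 -> measurable C -> m C \is a fin_num.
    move=> mT mC; rewrite ge0_fin_numE// (@le_lt_trans _ _ 1)// ?ltry// -mT.
    by apply: le_measure; rewrite ?inE.
  have mBE : measurable (@polar n @^-1` (B `*` E)) by apply: mpre; exact: measurableX.
  have mBE' : measurable (@polar n @^-1` (B `*` ~` E)).
    by apply: mpre; apply: measurableX => //; exact: measurableC.
  have mB' : measurable (@polar n @^-1` (~` B `*` setT)).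
    by apply: mpre; apply: measurableX => //; exact: measurableC.
  rewrite -(fineK (fin _ _ m1T mBE)) -(fineK (fin _ _ m1T mBE')) -(fineK (fin _ _ m1T mB')).
  rewrite -(fineK (fin _ _ m2T mBE)) -(fineK (fin _ _ m2T mBE')) -(fineK (fin _ _ m2T mB')).
  move: (fine _) (fine _) (fine _) (fine _) (fine _) (fine _) => a b c u v w.
  rewrite -!EFinD !lee_fin => h1 h2 h3 [h]; congr EFin.
  by move: h1 h2 h3 h; clear; lra.
have mP := @measurable_polar n.
pose p1 : {measure set (measurableTypeR R * n.-tuple R) -> \bar R} :=
  measure_function_pushforward__canonical__measure_function_Measure m1 mP.
pose p2 : {measure set (measurableTypeR R * n.-tuple R) -> \bar R} :=
  measure_function_pushforward__canonical__measure_function_Measure m2 mP.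
have AE : A = @polar n @^-1` (@unpolar n @^-1` A).
  by rewrite -comp_preimage; apply/seteqP; split=> x; rewrite /= polarK.
have mQA : measurable (@unpolar n @^-1` A).
  by rewrite -[X in measurable X]setTI; exact: measurable_unpolar.
rewrite AE -[LHS]/(p1 _) -[RHS]/(p2 _).
pose G : set (set (measurableTypeR R * n.-tuple R)) :=
  [set B `*` E | B in @measurable _ (measurableTypeR R) & E in @measurable _ (n.-tuple R)].
apply: (@measure_unique _ R _ G (fun _ => setT)) => //.
- by rewrite measurable_prod_measurableType.
- move=> _ _ [B1 mB1 [E1 mE1 <-]] [B2 mB2 [E2 mE2 <-]].
  by rewrite -setXI; exists (B1 `&` B2); [exact: measurableI|exists (E1 `&` E2); [exact: measurableI|]].
- by move=> _; exists setT => //; exists setT => //; rewrite setXTT.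
- by apply/seteqP; split => // x _; exists 0%N.
- by move=> _ [B mB [E mE <-]]; exact: rectE.
- by move=> _; rewrite /p1/= /pushforward preimage_setT m1T ltry.
Qed.

End polar_rectangles.

(** * Radial measures as images of the Gaussian measure *)

Section radial_measures.
Context {R : realType}.
Local Notation mu := (@lebesgue_measure R).
Variables (n : nat) (f rho : R -> R).
Hypothesis n_gt0 : (0 < n)%N.
Hypothesis f_meas : measurable_fun (`]0, +oo[ : set R) f.
Hypothesis f_ge0 : forall r : R, 0 < r -> 0 <= f r.
Hypothesis lim_rho : generalized_poincare_limit_with n f rho.
Hypothesis rhoCn : conditionCn n rho.
Local Notation S := (radial_map n rho).

Let M := fine (radial_mass n f).
Let M_bounds : (0 < radial_mass n f < +oo)%E. Proof. by case: lim_rho. Qed.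
Let rhoC : conditionC rho. Proof. by case: lim_rho. Qed.
Let M_gt0 : 0 < M. Proof. by rewrite fine_gt0. Qed.
Let ME : radial_mass n f = M%:E.
Proof. by move: M_bounds => /andP[M0 Moo]; rewrite fineK// ge0_fin_numE// ltW. Qed.

(** Nothing is known about [f] outside of ]0,+oo[; the value at 0 only matters at the
    origin, a null set. *)
Let f0 (r : R) : R := if 0 < r then f r else 0.
Let mf0 : measurable_fun setT f0. Proof. exact: measurable_positive_extension. Qed.
Let f0_ge0 r : 0 <= f0 r. Proof. by rewrite /f0; case: (ltP 0 r) => // /f_ge0. Qed.

Let q (x : n.-tuple R) : R := f0 (eucl_norm x) / M.
Let q_ge0 x : 0 <= q x. Proof. by rewrite divr_ge0// ltW. Qed.
Let mq : measurable_fun setT q.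
Proof. by apply: measurable_funM => //; exact: measurableT_comp mf0 (@measurable_eucl_norm R n). Qed.
Let m1 : {measure set (n.-tuple R) -> \bar R} := density_measure (lebesgue_tuple n) q_ge0 mq.

Let m1E A : measurable A -> radial_measure n f A = m1 A.
Proof.
move=> mA; rewrite /radial_measure /m1/= /density_measure -/M.
pose f1 (r : R) : R := if 0 < r then f r else f 0.
have mf1 : measurable_fun setT f1.
  apply: measurable_fun_if => //; first exact: measurable_fun_ltr.
  rewrite setTI (_ : _ @^-1` _ = `]0, +oo[%classic)//.
  by apply/seteqP; split=> x /=; rewrite in_itv/= andbT.
apply: ae_eq_integral => //.
- apply/measurable_EFinP/measurable_funTS.
  rewrite (_ : (fun x => _) = fun x : n.-tuple R => f1 (eucl_norm x) / M).
    by apply: measurable_funM => //; exact: measurableT_comp mf1 (@measurable_eucl_norm R n).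
  apply/funext => x; rewrite /f1 lt_neqAle eucl_norm_ge0 andbT eq_sym.
  by case: eqVneq => [->|].
- by apply/measurable_EFinP/measurable_funTS.
exists [set x | eucl_norm x = 0 :> R]; split.
- rewrite -[X in measurable X]setTI.
  by rewrite (_ : [set x | _] = @eucl_norm R n @^-1` [set 0])//; exact: measurable_eucl_norm.
- exact: lebesgue_tuple_origin.
- move=> x /= h; apply/eqP/negPn/negP => x0; apply: h => _.
  by rewrite /q /f0 lt_neqAle eq_sym x0 eucl_norm_ge0.
Qed.

Let sphere_areaE : sphere_area n = sphere_measure [set: n.-tuple R].
Proof.
rewrite /sphere_area /sphere_measure; congr (_ * lebesgue_tuple n _)%E.
apply/seteqP; split => x /= [x01 _]; split => //.
move: x01 => /andP[x0 _].
rewrite (_ : [tuple _ | _ < n] = scale_tuple (eucl_norm x)^-1 x).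
  by rewrite eucl_norm_scale ?invr_gt0// mulVf// gt_eqF.
by apply: eq_from_tnth => i; rewrite !tnth_mktuple mulrC.
Qed.

Let m1_sector (B : set R) (E : set (n.-tuple R)) :
  m1 (@polar R n @^-1` (B `*` E)) = m1 (sector E B).
Proof.
rewrite /m1/= /density_measure integral_mkcond [RHS]integral_mkcond.
apply: eq_integral => x _; rewrite !patchE.
have := eucl_norm_ge0 x; rewrite le_eqVlt => /predU1P[x0|x0].
  by rewrite /q /f0 -x0 ltxx mul0r; do 2 case: ifPn.
congr (if _ then _ else _); apply/idP/idP; rewrite !inE; first by move=> [/= ? ?].
by move=> [].
Qed.

Let m1T : m1 setT = 1%E.
Proof.
have -> : [set: n.-tuple R] = @polar R n @^-1` (setT `*` setT) by rewrite setXTT.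
rewrite m1_sector /m1/= /density_measure.
pose g (r : R) : \bar R := (f0 r / M)%:E.
rewrite -[LHS]/(\int[lebesgue_tuple n]_(x in sector setT setT) g (eucl_norm x))%E.
rewrite polar_integral//; last 2 first.
- by apply/measurable_EFinP; exact: measurable_funM.
- by move=> r; rewrite lee_fin divr_ge0// ltW.
rewrite setTI -sphere_areaE.
have -> : (\int[mu]_(r in `]0%R, +oo[) (g r * (r ^+ n.-1)%:E) =
    M^-1%:E * \int[mu]_(r in `]0%R, +oo[) (f r * r ^+ n.-1)%:E)%E.
  rewrite -ge0_integralZl//; last 3 first.
  - by apply/measurable_EFinP; apply: measurable_funM => //; apply: measurable_funTS; exact: measurable_funX.
  - move=> r; rewrite /= in_itv/= andbT => r0.
    by rewrite lee_fin mulr_ge0 ?f_ge0// exprn_ge0// ltW.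
  - by rewrite lee_fin invr_ge0 ltW.
  apply: eq_integral => r; rewrite inE/= in_itv/= andbT => r0.
  by rewrite /g /f0 r0 -!EFinM; congr EFin; rewrite -mulrA mulrCA mulrA.
by rewrite muleCA -/(radial_mass n f) ME -EFinM mulVf// gt_eqF.
Qed.

(** The Poincare density is dominated by the image of the Gaussian measure on
    sectors, and both have the mass 1. *)
Lemma radial_measureE A : measurable A ->
  radial_measure n f A = gauss_tuple (S @^-1` A).
Proof.
have mS : measurable_fun setT S by exact: measurable_radial_map.
have mpre C : measurable C -> measurable (S @^-1` C).
  by move=> mC; rewrite -[X in measurable X]setTI; exact: mS.
pose m2 : {measure set (n.-tuple R) -> \bar R} :=
  measure_function_pushforward__canonical__measure_function_Measure (@gauss_tuple R n) mS.
move=> mA; rewrite m1E// -[RHS]/(m2 A).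
apply: measure_rectangles_unique => //.
  by rewrite /m2/= /pushforward preimage_setT; exact: gauss_tupleT.
move=> B E mB mE; rewrite m1_sector -m1E; last exact: measurable_sector.
have [_ _ ->] := lim_rho; last exact: measurable_sector.
apply: le_trans (poincare_sector_le n_gt0 rhoC rhoCn mE mB) _.
rewrite /m2/= /pushforward; apply: le_measure; rewrite ?inE.
- by apply: mpre; exact: measurable_sector.
- apply: mpre; rewrite -[X in measurable X]setTI; apply: measurable_polar => //.
  exact: measurableX.
- by move=> x [_ ? ?]; split.
Qed.

End radial_measures.

Theorem theorem1p2 (R : realType) (n : nat) (n_gt0 : (0 < n)%N)
    (f : R -> R) (f_meas : measurable_fun (`]0, +oo[ : set R) f)
    (f_ge0 : forall r : R, 0 < r -> 0 <= f r)
    (rho : nat -> R -> R)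
    (limit_rho : forall m : nat, m = 1%N \/ m = n ->
       generalized_poincare_limit_with m f (rho m) /\ conditionCn m (rho m)) :
  let L := lipschitz_constant (radial_map n (rho n)) in
  let I_mu := isoperimetric_profile eucl_dist (radial_measure n f) in
  let I_gamma := isoperimetric_profile (fun x y : R => `|x - y|)
                   (normal_prob (0 : R) 1) in
  (forall a : R, 0 <= a <= 1 -> a != 1 / 2 ->
     ((L^-1)%:E * I_gamma a <= I_mu a)%E) /\
  ((0 < limf_esup (EFin \o f) (0 : R)^'+ < +oo)%E ->
     ((L^-1)%:E * I_gamma (1 / 2)%R <= I_mu (1 / 2)%R)%E).
Proof.
have [lim_n rhoCn] := limit_rho n (or_intror erefl).
have rhoC : conditionC (rho n) by case: lim_n.
have le (a : R) : 0 <= a <= 1 ->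
    ((lipschitz_constant (radial_map n (rho n)))^-1%:E *
      isoperimetric_profile (fun x y : R => `|x - y|%R) (normal_prob (0 : R) 1) a
     <= isoperimetric_profile eucl_dist (radial_measure n f) a)%E.
  apply: (lipschitz_image_profile (S := radial_map n (rho n))).
  - exact: measurable_radial_map.
  - exact: lipschitz_constantP.
  - by move=> A mA; exact: radial_measureE.
split=> [a a01 _|_]; first exact: le.
by apply: le; rewrite divr_ge0//= ler_pdivrMr// mul1r ler1n.
Qed.
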